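(* Let $M$ be a formal Levi-nondegenerate hypersurface in $\mathbb{C}^{n+1}$ of signature $\ell\le n/2$ at a point $p$. If $\ell=n/2$, assume also that $(M,p)$ is not formally equivalent to $(\mathbb{H}^{2n+1}_{n/2},0)$. Suppose that, for some integers $k_1\le k_2$, there are two formal embeddings $$H_1\colon(M,p)\to\big(\mathbb{H}^{2(n+k_1)+1}_\ell,0\big),\qquad H_2\colon(M,p)\to\big(\mathbb{H}^{2(n+k_2)+1}_\ell,0\big).$$ If $k_1+k_2<n$, then there exists an automorphism $T\in\operatorname{Aut}(\mathbb{H}^{2(n+k_2)+1}_\ell,0)$ such that $$H_2=T\circ L\circ H_1,$$ where $L\colon\mathbb{C}^{n+k_1}\times\mathbb{C}\to\mathbb{C}^{n+k_2}\times\mathbb{C}$ denotes the linear embedding $(z,w)\mapsto(z,0,w)$, which sends $\mathbb{H}^{2(n+k_1)+1}_\ell$ into $\mathbb{H}^{2(n+k_2)+1}_\ell$.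
   Context: Notation: for $0\le\ell\le m$, $\langle a,b\rangle_\ell:=-\sum_{j=1}^{\ell}a_jb_j+\sum_{j=\ell+1}^m a_jb_j$ for $a,b\in\mathbb{C}^m$, and $\mathbb{H}^{2m+1}_\ell:=\{(z,w)\in\mathbb{C}^m\times\mathbb{C}:\operatorname{Im}w=\langle z,\bar z\rangle_\ell\}$. $\operatorname{Aut}(\mathbb{H}^{2m+1}_\ell,0)$ is the group of germs of local biholomorphisms $(\mathbb{C}^{m+1},0)\to(\mathbb{C}^{m+1},0)$ preserving $\mathbb{H}^{2m+1}_\ell$ (identified with their Taylor series). Formal objects: a formal hypersurface $M\subset\mathbb{C}^{n+1}$ at $p$ is given by an equation $\rho(Z,\bar Z)=0$, where $\rho$ is a real-valued formal power series in $(Z-p,\overline{Z-p})$ without constant term and with nonzero differential at $p$. A formal holomorphic map $H\colon(\mathbb{C}^{n+1},p)\to(\mathbb{C}^{N+1},p')$ is a vector of formal power series in $Z-p$ with constant term $p'$; it sends $(M,p)$ into $(M',p')$, $M'=\{\rho'=0\}$, if $\rho'(H,\overline H)$ is a multiple of $\rho$ in the ring of formal power series. It is a formal embedding $(M,p)\to(M',p')$ if, in addition, its differential at $p$ is injective, and a formal equivalence if, in addition, $N=n$ and it is invertible. $M$ is Levi-nondegenerate of signature $\ell$ ($\ell\le n/2$) at $p$ if in some formal holomorphic coordinates $(z,w)\in\mathbb{C}^n\times\mathbb{C}$ vanishing at $p$ it is given by $\operatorname{Im}w=\langle z,\bar z\rangle_\ell+A(z,\bar z,\operatorname{Re}w)$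 with $A$ vanishing to third order at $0$ (no terms of degree less than $3$). *)

(* Defs.v *)
From mathcomp Require Import all_boot all_order all_algebra.
From mathcomp Require Import mpoly.

Set Implicit Arguments.
Unset Strict Implicit.
Unset Printing Implicit Defensive.

Import Order.TTheory GRing.Theory Num.Theory.
Local Open Scope ring_scope.

(* Formal power series in d variables, given by their coefficients. *)
Definition fps (C : Type) (d : nat) : Type := 'X_{1..d} -> C.

Section Series.
Variable C : numClosedFieldType.
Implicit Types d e : nat.

Definition fpoly d (p : {mpoly C[d]}) : fps C d := fun m => p@_m.

Definition fmul d (f g : fps C d) : fps C d := fun m =>
  \sum_(k : 'X_{1..d < (mdeg m).+1, (mdeg m).+1} | m == (k.1 + k.2)%MM)
     f k.1 * g k.2.

Definition ftrunc d (k : nat) (f : fps C d) : {mpoly C[d]} :=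
  \sum_(m : 'X_{1..d < k.+1}) f m *: 'X_[m].

Definition fcenter d (f : fps C d) : fps C d :=
  fun m => if m == 0%MM then 0 else f m.

(* Here f is a series in y - g(0), into which y = g is substituted.  Since
   the g i - g(0) i have no constant term, the coefficient at m of the result
   only involves the terms of f and g of degree at most mdeg m. *)
Definition fcomp d e (f : fps C e) (g : 'I_e -> fps C d) : fps C d := fun m =>
  let k := mdeg m in
  (ftrunc k f \mPo [tuple ftrunc k (fcenter (g i)) | i < e])@_m.

(* Formal holomorphic maps (C^d,p) -> (C^e,p'): tuples of series in Z - p,
   the constant terms being the coordinates of p'. *)
Definition fmap d e : Type := 'I_e -> fps C d.

Definition fmap_at0 d e (H : fmap d e) : 'cV[C]_e := \col_i H i 0%MM.

Definition fmap_comp c d e (G : fmap d e) (H : fmap c d) : fmap c e :=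
  fun i => fcomp (G i) H.

(* the identity of C^d, as a series in Z - p *)
Definition fmap_id d (p : 'cV[C]_d) : fmap d d :=
  fun i => fpoly ((p i 0)%:MP + 'X_i).

Definition fmap_jacobian d e (H : fmap d e) : 'M[C]_(e, d) :=
  \matrix_(i, j) H i U_(j)%MM.

Definition fmap_invertible d (p p' : 'cV[C]_d) (H : fmap d d) : Prop :=
  exists G : fmap d d, [/\ fmap_at0 G = p,
    fmap_comp G H = fmap_id p & fmap_comp H G = fmap_id p'].

(* Series in (Z - p, \bar Z - \bar p) have d + d variables: lshift d i stands
   for Z_i - p_i, and rshift d i for its conjugate. *)
Definition swap_bar d (i : 'I_(d + d)) : 'I_(d + d) :=
  match split i with inl j => rshift d j | inr j => lshift d j end.

Definition mswap_bar d (m : 'X_{1..d + d}) : 'X_{1..d + d} :=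
  [multinom m (swap_bar i) | i < d + d].

Definition real_valued d (f : fps C (d + d)) : Prop :=
  forall m, f (mswap_bar m) = (f m)^*.

Definition fhol d (f : fps C d) : fps C (d + d) :=
  fcomp f (fun i => fpoly 'X_(lshift d i)).

Definition fbar d (f : fps C d) : fps C (d + d) :=
  fcomp (fun m => (f m)^*) (fun i => fpoly 'X_(rshift d i)).

Definition fmap_with_bar d e (H : fmap d e) (j : 'I_(e + e)) : fps C (d + d) :=
  match split j with inl i => fhol (H i) | inr i => fbar (H i) end.

(* hs_rho is the series of rho in (Z - hs_pt, \bar Z - \bar hs_pt). *)
Record hypersurface d := Hypersurface {
  hs_pt : 'cV[C]_d;
  hs_rho : fps C (d + d);
  hs_real : real_valued hs_rho;
  hs_const : hs_rho 0%MM = 0;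
  hs_diff : exists i, hs_rho U_(i)%MM != 0
}.

(* By the centering in fcomp, hs_rho M' is evaluated at H - p', p' = H(p). *)
Definition sends d e (M : hypersurface d) (M' : hypersurface e)
    (H : fmap d e) : Prop :=
  fmap_at0 H = hs_pt M' /\
  exists q : fps C (d + d),
    fcomp (hs_rho M') (fmap_with_bar H) = fmul q (hs_rho M).

Definition formal_embedding d e (M : hypersurface d) (M' : hypersurface e)
    (H : fmap d e) : Prop :=
  sends M M' H /\ injective (fun v : 'cV[C]_d => fmap_jacobian H *m v).

Definition formal_equivalence d (M M' : hypersurface d) (H : fmap d d) : Prop :=
  sends M M' H /\ fmap_invertible (hs_pt M) (hs_pt M') H.

(* Points of C^m x C are (z_0, .., z_(m-1), w). *)
Definition zi m (j : 'I_m) : 'I_m.+1 := lift ord_max j.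
Definition wi m : 'I_m.+1 := ord_max.

Definition form_l (A : pzRingType) m (l : nat) (a b : 'I_m -> A) : A :=
  - (\sum_(j < m | (j < l)%N) a j * b j) + \sum_(j < m | (l <= j)%N) a j * b j.

(* Im w - <z, \bar z>_l *)
Definition hyperquadric_poly m (l : nat) : {mpoly C[m.+1 + m.+1]} :=
  (2 * 'i)^-1 *: ('X_(lshift m.+1 (wi m)) - 'X_(rshift m.+1 (wi m)))
  - form_l l (fun j => 'X_(lshift m.+1 (zi j)))
             (fun j => 'X_(rshift m.+1 (zi j))).

Lemma swap_barK d : involutive (@swap_bar d).
Proof.
move=> i; rewrite /swap_bar; case: (split_ordP i) => j ->.
  by rewrite (unsplitK (inr _)).
by rewrite (unsplitK (inl _)).
Qed.

Lemma swap_bar_lshift d (i : 'I_d) : swap_bar (lshift d i) = rshift d i.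
Proof. by rewrite /swap_bar (unsplitK (inl _)). Qed.

Lemma swap_bar_rshift d (i : 'I_d) : swap_bar (rshift d i) = lshift d i.
Proof. by rewrite /swap_bar (unsplitK (inr _)). Qed.

Lemma mswap_barK d : involutive (@mswap_bar d).
Proof. by move=> m; apply/mnmP => i; rewrite !mnmE swap_barK. Qed.

Lemma mswap_barU d (i : 'I_(d + d)) :
  mswap_bar U_(i)%MM = U_(swap_bar i)%MM.
Proof. by apply/mnmP => j; rewrite !mnmE -(can_eq (@swap_barK d)) swap_barK. Qed.

Lemma mswap_barD d (m1 m2 : 'X_{1..d + d}) :
  mswap_bar (m1 + m2)%MM = (mswap_bar m1 + mswap_bar m2)%MM.
Proof. by apply/mnmP => j; rewrite !mnmE. Qed.

Lemma hyperquadric_real m l : real_valued (fpoly (hyperquadric_poly m l)).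
Proof.
have cX d (a b : 'X_{1..d + d}) :
    ('X_[a] : {mpoly C[d + d]})@_(mswap_bar b)
    = ('X_[mswap_bar a] : {mpoly C[d + d]})@_b.
  by rewrite !mcoeffX -(can_eq (@mswap_barK d)) mswap_barK.
have cjX d (a b : 'X_{1..d + d}) :
    (('X_[a] : {mpoly C[d + d]})@_b)^* = ('X_[a] : {mpoly C[d + d]})@_b.
  by rewrite mcoeffX rmorph_nat.
move=> k; rewrite /fpoly /hyperquadric_poly /form_l.
rewrite !(mcoeffB, mcoeffD, mcoeffN, mcoeffZ) !(raddf_sum (mcoeff _)) /=.
rewrite !(rmorphB, rmorphD, rmorphN, rmorphM) /= !rmorph_sum /=.
rewrite !(fmorphV, rmorphM) /= conjCi rmorph_nat.
congr (_ - (- _ + _)).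
- rewrite !cX !cjX !mswap_barU swap_bar_lshift swap_bar_rshift.
  by rewrite mulrN invrN mulNr -mulrN opprB.
- apply: eq_bigr => j _; rewrite -mpolyXD cX cjX mswap_barD !mswap_barU.
  by rewrite swap_bar_lshift swap_bar_rshift addmC.
- apply: eq_bigr => j _; rewrite -mpolyXD cX cjX mswap_barD !mswap_barU.
  by rewrite swap_bar_lshift swap_bar_rshift addmC.
Qed.

Lemma hyperquadric_const m l : fpoly (hyperquadric_poly m l) 0%MM = 0.
Proof.
rewrite /fpoly /hyperquadric_poly /form_l.
rewrite !(mcoeffB, mcoeffD, mcoeffN, mcoeffZ) !(raddf_sum (mcoeff _)) /=.
rewrite !mcoeffX !mnm1_eq0 subrr mulr0 !big1 ?oppr0 ?addr0 ?subr0 //.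
- by move=> j _; rewrite -mpolyXD mcoeffX mnmD_eq0 !mnm1_eq0.
- by move=> j _; rewrite -mpolyXD mcoeffX mnmD_eq0 !mnm1_eq0.
Qed.

Lemma hyperquadric_diff m l :
  exists i, fpoly (hyperquadric_poly m l) U_(i)%MM != 0.
Proof.
exists (lshift m.+1 (wi m)).
rewrite /fpoly /hyperquadric_poly /form_l.
rewrite !(mcoeffB, mcoeffD, mcoeffN, mcoeffZ) !(raddf_sum (mcoeff _)) /=.
have z j a : ('X_a * 'X_j : {mpoly C[m.+1 + m.+1]})@_U_(lshift m.+1 (wi m)) = 0.
  rewrite -mpolyXD mcoeffX; case: eqP => // /(congr1 mdeg).
  by rewrite mdegD !mdeg1.
rewrite !big1 ?oppr0 ?addr0 ?subr0; do ?[by move=> j _; rewrite z].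
have U : (U_(rshift m.+1 (wi m)) == U_(lshift m.+1 (wi m)))%MM = false.
  apply/negP => /eqP /mnmP /(_ (lshift m.+1 (wi m))).
  by rewrite !mnmE eqxx eq_rlshift.
by rewrite !mcoeffX eqxx U subr0 mulr1 invr_eq0 mulf_neq0 ?neq0Ci ?pnatr_eq0.
Qed.

(* (H^{2m+1}_l, 0) as a formal hypersurface *)
Definition hyperquadric m l : hypersurface m.+1 :=
  Hypersurface 0 (@hyperquadric_real m l) (hyperquadric_const m l)
    (hyperquadric_diff m l).

(* The substitution (z, \bar z, Re w) for the variables of a series A. *)
Definition z_barz_Rew m (j : 'I_(m + m + 1)) : fps C (m.+1 + m.+1) :=
  match split j with
  | inl i => match split i with
             | inl a => fpoly 'X_(lshift m.+1 (zi a))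
             | inr a => fpoly 'X_(rshift m.+1 (zi a))
             end
  | inr _ => fpoly (2^-1 *: ('X_(lshift m.+1 (wi m)) + 'X_(rshift m.+1 (wi m))))
  end.

(* M0 is given by Im w = <z, \bar z>_l + A(z, \bar z, Re w); as its defining
   series is real-valued, so is A. *)
Definition levi_nondegenerate_of_signature n (l : nat)
    (M : hypersurface n.+1) : Prop :=
  exists (M0 : hypersurface n.+1) (A : fps C (n + n + 1)) (F : fmap n.+1 n.+1),
    [/\ hs_pt M0 = 0,
        forall m, hs_rho M0 m
          = fpoly (hyperquadric_poly n l) m - fcomp A (@z_barz_Rew n) m,
        forall m, (mdeg m < 3)%N -> A m = 0
      & formal_equivalence M M0 F].

(* (z, w) |-> (z, 0, w) *)
Definition linear_embedding m m' : fmap m.+1 m'.+1 := fun i =>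
  match unlift ord_max i with
  | None => fpoly 'X_(wi m)
  | Some j => match insub (val j) : option 'I_m with
              | Some a => fpoly 'X_(zi a)
              | None => fpoly 0
              end
  end.

Definition near0 d (P : 'cV[C]_d -> Prop) : Prop :=
  exists2 r : C, 0 < r &
    forall Z : 'cV[C]_d, (forall i, `|Z i 0| < r) -> P Z.

Definition fterm d (f : fps C d) (Z : 'cV[C]_d) (m : 'X_{1..d}) : C :=
  f m * \prod_(i < d) Z i 0 ^+ m i.

Definition converges_to d (f : fps C d) (Z : 'cV[C]_d) (v : C) : Prop :=
  (exists B : C, forall k, \sum_(m : 'X_{1..d < k}) `|fterm f Z m| <= B) /\
  (forall e : C, 0 < e -> exists k0, forall k, (k0 <= k)%N ->
     `|\sum_(m : 'X_{1..d < k}) fterm f Z m - v| < e).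

(* phi is holomorphic near 0, with Taylor series T at 0 *)
Definition taylor_series d e (T : fmap d e) (phi : 'cV[C]_d -> 'cV[C]_e) :
    Prop :=
  near0 (fun Z => forall i, converges_to (T i) Z (phi Z i 0)).

Definition hyperquadric_points m l (Z : 'cV[C]_m.+1) : Prop :=
  'Im (Z (wi m) 0) = form_l l (fun j => Z (zi j) 0) (fun j => (Z (zi j) 0)^*).

(* T is the Taylor series of an element of Aut(H^{2m+1}_l, 0). *)
Definition hyperquadric_aut m l (T : fmap m.+1 m.+1) : Prop :=
  exists (phi psi : 'cV[C]_m.+1 -> 'cV[C]_m.+1) (S : fmap m.+1 m.+1),
    [/\ taylor_series T phi /\ taylor_series S psi,
        phi 0 = 0,
        near0 (fun Z => psi (phi Z) = Z),
        near0 (fun Z => phi (psi Z) = Z)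
      & near0 (fun Z => hyperquadric_points l Z
                        <-> hyperquadric_points l (phi Z))].

End Series.

Arguments hyperquadric C m l : clear implicits.
Arguments linear_embedding C m m' : clear implicits.

(* Main.v *)
Require Import Defs.
From HB Require Import structures.
From mathcomp Require Import all_boot all_order all_algebra.
From mathcomp Require Import spectral sesquilinear.
From mathcomp Require Import mpoly.
From mathcomp Require Import boolp.
From mathcomp Require Import reals.
From mathcomp Require Import complex.
From mathcomp Require Import ring zify.

(** A map H into a hyperquadric is written as the homogeneous vector (1, H).
    The equation of the hyperquadric is a Hermitian form of index l + 1 on such
    vectors, and H sends M into the hyperquadric if the form at (1, H) is a
    multiple of the equation r0 of M.  A matrix preserving the form acts on the
    hyperquadric by a fractional linear automorphism.  So it is enough to show
    that, after multiplication by units u1(Z) and u2(Z), the Taylor coefficients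
    of the vectors of the two maps have the same Gram matrix: the components of
    the vectors split into tangential ones, which will coincide for both maps, and
    normal ones, on which the form is definite, and in the definite case families
    with the same Gram matrix differ by a unitary matrix.

    The form at (1, H) is b r0 for a factor b.  The constant term of b is nonzero:
    otherwise the 1-jet of H would provide an isotropic space of dimension n + 1,
    exceeding the index l + 1 (transversal).  So a unit makes b equal to a sign
    for \bar Z = 0, and a linear change of coordinates splits the vector into
    n + 2 components c with the 1-jet of (1, F), where F are the coordinates in
    which M is given in normal form, and k components phi of order two, on which
    the form is definite by inertia (normal_position).  The sign can be negative
    for 2 l = n only.

    In the chart where the components c of the first map are (1, z, w), the
    equations of the two maps become
      Q1 = Im w - <z, \bar z> -+ |phi|^2,
      Q2 = Im (g \bar e) - <f, \bar f> -+ |psi|^2,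
    with g = w, with e - 1, f - z, phi, psi of order two, and with Q2 = a Q1.
    Rigidity says that a = 1, e = 1 and f = z.  With weight 1 for z and 3 for w,
    the initial part of Q1 is - <z, \bar z>.  If a - 1 had a nonzero initial part
    A, then A <z, \bar z> would be the initial part of Q1 - Q2.  The coefficients
    of f entering it are already known to be those of z from lower weights, so a
    multiple of a form in n variables would be a sum of k1 + k2 < n products of a
    series in Z and one in \bar Z (factor_eq1).  Huang's lemma excludes this: such
    a multiple, read as a matrix indexed by monomials in Z and in \bar Z, has a
    nonvanishing minor of size n (mul_herm_minor).

    Hence |phi|^2 = |psi|^2 if the two signs agree, so that the normal components
    differ by a unitary matrix (unitary_extension), which together with the
    changes of coordinates gives T (automorphism_of_components).  If the signs
    differ, then |phi|^2 = - |psi|^2, so phi = 0 and M is flat, which is excluded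
    for 2 l = n. *)

Set Implicit Arguments.
Unset Strict Implicit.
Unset Printing Implicit Defensive.

Import Order.TTheory GRing.Theory Num.Theory.
Local Open Scope ring_scope.

(** * The ring of formal power series *)

Section SeriesRing.
Variables (C : numClosedFieldType) (d : nat).
Implicit Types (f g h : fps C d) (p q : {mpoly C[d]}).

Lemma fpsP f g : (forall m, f m = g m) -> f = g.
Proof. by move=> fg; apply/funext. Qed.

Definition fzero : fps C d := fun=> 0.
Definition fone : fps C d := fun m => (m == 0%MM)%:R.
Definition fadd f g : fps C d := fun m => f m + g m.
Definition fopp f : fps C d := fun m => - f m.

Lemma mcoeff_ftrunc k f m :
  (ftrunc k f)@_m = if (mdeg m <= k)%N then f m else 0.
Proof.
rewrite /ftrunc raddf_sum /=.
case: ifP => [mk|/negbT mk].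
  pose m' : 'X_{1..d < k.+1} := BMultinom (mk : (mdeg m < k.+1)%N).
  rewrite (bigD1 m') //= mcoeffZ mcoeffX eqxx mulr1 big1 ?addr0 // => i ne.
  rewrite mcoeffZ mcoeffX; case: eqP => [e|]; rewrite ?mulr0 //.
  by case/negP: ne; apply/eqP/val_inj.
rewrite big1 // => i _; rewrite mcoeffZ mcoeffX; case: eqP => [e|]; rewrite ?mulr0 //.
by case/negP: mk; rewrite -e -ltnS bmdeg.
Qed.

(** Below any fixed degree a product of series is a product of polynomials;
    the ring axioms are transported from polynomials along this remark. *)
Lemma fmul_mpoly f g p q m :
    (forall m', (mdeg m' <= mdeg m)%N -> p@_m' = f m') ->
    (forall m', (mdeg m' <= mdeg m)%N -> q@_m' = g m') ->
  fmul f g m = (p * q)@_m.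
Proof.
move=> pf qg; rewrite mcoeffM /fmul; apply: eq_bigr => k _.
by rewrite pf ?qg // -ltnS bmdeg.
Qed.

Lemma fmul_trunc k f g m : (mdeg m <= k)%N ->
  fmul f g m = (ftrunc k f * ftrunc k g)@_m.
Proof.
by move=> mk; apply: fmul_mpoly => m' mm'; rewrite mcoeff_ftrunc (leq_trans mm').
Qed.

Lemma mcoeff_fmul_trunc k f g m : (mdeg m <= k)%N ->
  (ftrunc k (fmul f g))@_m = (ftrunc k f * ftrunc k g)@_m.
Proof. by move=> mk; rewrite mcoeff_ftrunc mk (fmul_trunc _ _ mk). Qed.

Lemma faddA : associative fadd.
Proof. by move=> f g h; apply: fpsP => m; apply: addrA. Qed.
Lemma faddC : commutative fadd.
Proof. by move=> f g; apply: fpsP => m; apply: addrC. Qed.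
Lemma fadd0 : left_id fzero fadd.
Proof. by move=> f; apply: fpsP => m; apply: add0r. Qed.
Lemma faddN : left_inverse fzero fopp fadd.
Proof. by move=> f; apply: fpsP => m; apply: addNr. Qed.

Lemma fmulA : associative (@fmul C d).
Proof.
move=> f g h; apply: fpsP => m; set k := mdeg m.
transitivity ((ftrunc k f * (ftrunc k g * ftrunc k h))@_m).
  apply: fmul_mpoly => m' m'k; first by rewrite mcoeff_ftrunc m'k.
  by rewrite (fmul_trunc _ _ m'k).
rewrite mulrA; symmetry; apply: fmul_mpoly => m' m'k; last by rewrite mcoeff_ftrunc m'k.
by rewrite (fmul_trunc _ _ m'k).
Qed.

Lemma fmulC : commutative (@fmul C d).
Proof.
by move=> f g; apply: fpsP => m; rewrite !(fmul_trunc _ _ (leqnn _)) mulrC.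
Qed.

Lemma fmul1 : left_id fone (@fmul C d).
Proof.
move=> f; apply: fpsP => m.
rewrite (@fmul_mpoly _ _ 1 (ftrunc (mdeg m) f)) ?mul1r ?mcoeff_ftrunc ?leqnn //.
  by move=> m' _; rewrite mcoeff1.
by move=> m' m'm; rewrite mcoeff_ftrunc m'm.
Qed.

Lemma fmulDl : left_distributive (@fmul C d) fadd.
Proof.
move=> f g h; apply: fpsP => m; rewrite /fadd /fmul -big_split /=.
by apply: eq_bigr => k _; rewrite mulrDl.
Qed.

End SeriesRing.

HB.instance Definition _ (C : numClosedFieldType) (d : nat) :=
  gen_eqMixin (fps C d).
HB.instance Definition _ (C : numClosedFieldType) (d : nat) :=
  gen_choiceMixin (fps C d).
HB.instance Definition _ (C : numClosedFieldType) (d : nat) :=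
  GRing.isZmodule.Build (fps C d) (@faddA C d) (@faddC C d) (@fadd0 C d)
    (@faddN C d).
Fact fone_neq0 (C : numClosedFieldType) (d : nat) : @fone C d != 0 :> fps C d.
Proof.
apply/eqP => /(congr1 (fun f : fps C d => f 0%MM)) /eqP.
by rewrite /fone eqxx oner_eq0.
Qed.
HB.instance Definition _ (C : numClosedFieldType) (d : nat) :=
  GRing.Zmodule_isComNzRing.Build (fps C d) (@fmulA C d) (@fmulC C d)
    (@fmul1 C d) (@fmulDl C d) (@fone_neq0 C d).

Section SeriesTheory.
Variables (C : numClosedFieldType) (d : nat).
Implicit Types (f g h : fps C d) (p q : {mpoly C[d]}).

Lemma coefD f g m : (f + g) m = f m + g m. Proof. by []. Qed.
Lemma coefN f m : (- f) m = - f m. Proof. by []. Qed.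
Lemma coefB f g m : (f - g) m = f m - g m. Proof. by []. Qed.
Lemma coef0 m : (0 : fps C d) m = 0. Proof. by []. Qed.
Lemma coef1 m : (1 : fps C d) m = (m == 0%MM)%:R. Proof. by []. Qed.
Lemma fmulE f g : fmul f g = f * g. Proof. by []. Qed.

Lemma coef_sum I r (P : pred I) (F : I -> fps C d) m :
  (\sum_(i <- r | P i) F i) m = \sum_(i <- r | P i) F i m.
Proof. by elim/big_rec2: _ => // i y1 y2 _ <-. Qed.

Lemma fpoly_is_additive : zmod_morphism (@fpoly C d).
Proof. by move=> p q; apply: fpsP => m; rewrite /fpoly mcoeffB. Qed.
Lemma fpoly_is_monoid_morphism : monoid_morphism (@fpoly C d).
Proof.
split; first by apply: fpsP => m; rewrite /fpoly mcoeff1.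
by move=> p q; apply: fpsP => m; rewrite -fmulE (@fmul_mpoly _ _ _ _ p q).
Qed.
HB.instance Definition _ :=
  GRing.isZmodMorphism.Build _ _ (@fpoly C d) fpoly_is_additive.
HB.instance Definition _ :=
  GRing.isMonoidMorphism.Build _ _ (@fpoly C d) fpoly_is_monoid_morphism.

Definition fconst (c : C) : fps C d := fpoly c%:MP.
Lemma fconst_is_additive : zmod_morphism fconst.
Proof. by move=> a b; rewrite /fconst !rmorphB. Qed.
Lemma fconst_is_monoid_morphism : monoid_morphism fconst.
Proof. by split=> [|a b]; rewrite /fconst ?rmorph1 ?rmorphM. Qed.
HB.instance Definition _ :=
  GRing.isZmodMorphism.Build _ _ fconst fconst_is_additive.
HB.instance Definition _ :=
  GRing.isMonoidMorphism.Build _ _ fconst fconst_is_monoid_morphism.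

Definition fvar (i : 'I_d) : fps C d := fpoly 'X_i.

Lemma coef_fconst c m : fconst c m = c *+ (m == 0%MM).
Proof. by rewrite /fconst /fpoly mcoeffC mulr_natr eq_sym. Qed.

Lemma coef_fvar i m : fvar i m = (m == U_(i)%MM)%:R.
Proof. by rewrite /fvar /fpoly mcoeffX eq_sym. Qed.

Lemma coef_constM c f m : (fconst c * f) m = c * f m.
Proof.
rewrite -fmulE (@fmul_mpoly _ _ _ _ (c%:MP) (ftrunc (mdeg m) f)) //.
  by rewrite mul_mpolyC mcoeffZ mcoeff_ftrunc leqnn.
by move=> m' m'm; rewrite mcoeff_ftrunc m'm.
Qed.

Lemma coef_varM i f m :
  (fvar i * f) m = if (0 < m i)%N then f (m - U_(i))%MM else 0.
Proof.
rewrite -fmulE (@fmul_mpoly _ _ _ _ ('X_i) (ftrunc (mdeg m) f)) //; last first.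
  by move=> m' m'm; rewrite mcoeff_ftrunc m'm.
rewrite mulrC; case: ifP => [mi|/negbT mi].
  have e : m = (U_(i) + (m - U_(i)))%MM.
    by rewrite addmC submK //; apply/mnm_lepP => j; rewrite mnm1E; case: eqP => // <-.
  have le : (mdeg (m - U_(i)) <= mdeg m)%N.
    by rewrite [X in (_ <= X)%N](congr1 mdeg e) mdegD leq_addl.
  by rewrite [X in _@_X]e mcoeffMX mcoeff_ftrunc le.
rewrite mcoeffM big1 // => k /eqP e; rewrite mcoeffX; case: eqP => [k2|]; rewrite ?mulr0 //.
by case/negP: mi; rewrite (congr1 (fun m : 'X_{1..d} => m i) e) mnmDE -k2 mnm1E eqxx addn1.
Qed.

End SeriesTheory.
Arguments fconst {C} d c.
Arguments fvar C {d} i.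

(** * Order of vanishing and substitution *)

Section Order.
Variables (C : numClosedFieldType) (d : nat).
Implicit Types (f g h : fps C d) (p q : {mpoly C[d]}) (w : 'X_{1..d} -> nat).

Definition vanish w k f := forall m, (w m < k)%N -> f m = 0.

Lemma vanish_le w j k f : (j <= k)%N -> vanish w k f -> vanish w j f.
Proof. by move=> jk fk m mj; apply: fk; apply: leq_trans jk. Qed.

Lemma vanish0 w k : vanish w k (0 : fps C d). Proof. by []. Qed.

Lemma vanishD w k f g : vanish w k f -> vanish w k g -> vanish w k (f + g).
Proof. by move=> fk gk m mk; rewrite coefD fk ?gk ?addr0. Qed.

Lemma vanishN w k f : vanish w k f -> vanish w k (- f).
Proof. by move=> fk m mk; rewrite coefN fk ?oppr0. Qed.

Lemma vanishB w k f g : vanish w k f -> vanish w k g -> vanish w k (f - g).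
Proof. by move=> fk gk; apply/vanishD/vanishN. Qed.

Lemma vanish_sum w k I r (P : pred I) (F : I -> fps C d) :
  (forall i, P i -> vanish w k (F i)) -> vanish w k (\sum_(i <- r | P i) F i).
Proof.
move=> Fk; elim/big_rec: _ => [|i x Pi xk]; first exact: vanish0.
by apply: vanishD => //; apply: Fk.
Qed.

Lemma vanishM w j k f g : {morph w : a b / (a + b)%MM >-> (a + b)%N} ->
  vanish w j f -> vanish w k g -> vanish w (j + k) (f * g).
Proof.
move=> wD fj gk m mjk; rewrite -fmulE /fmul big1 // => i /eqP e.
case: (ltnP (w i.1) j) => [/fj ->|ji]; first by rewrite mul0r.
rewrite (gk i.2) ?mulr0 // -(ltn_add2l j); apply: leq_ltn_trans mjk.
by rewrite (congr1 w e) wD leq_add2r.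
Qed.

Lemma vanishMl w k f g : {morph w : a b / (a + b)%MM >-> (a + b)%N} ->
  vanish w k g -> vanish w k (f * g).
Proof. by move=> wD; rewrite -(add0n k); apply: vanishM. Qed.

Lemma vanish_eq0 w f : (forall k, vanish w k f) -> f = 0.
Proof. by move=> fk; apply: fpsP => m; apply: (fk (w m).+1). Qed.

Lemma mdeg_morph : {morph @mdeg d : a b / (a + b)%MM >-> (a + b)%N}.
Proof. exact: mdegD. Qed.

Lemma fcenterE f : fcenter f = f - fconst d (f 0%MM).
Proof.
apply: fpsP => m; rewrite coefB coef_fconst /fcenter.
by case: eqP => [->|]; rewrite ?subrr ?subr0.
Qed.

Lemma vanish_fcenter f : vanish mdeg 1 (fcenter f).
Proof. by move=> m; rewrite ltnS leqn0 mdeg_eq0 /fcenter => ->. Qed.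

Lemma fcenter_id f : f 0%MM = 0 -> fcenter f = f.
Proof. by move=> f0; rewrite fcenterE f0 rmorph0 subr0. Qed.

Lemma vanish1P f : vanish mdeg 1 f <-> f 0%MM = 0.
Proof.
split=> [f1|f0]; first by apply: f1; rewrite mdeg0.
by move=> m; rewrite ltnS leqn0 mdeg_eq0 => /eqP ->.
Qed.

Definition eqmod k f g := vanish mdeg k (f - g).

Lemma eqmodxx k f : eqmod k f f.
Proof. by move=> m _; rewrite subrr. Qed.
Lemma eqmod_sym k f g : eqmod k f g -> eqmod k g f.
Proof. by move=> /vanishN; rewrite opprB. Qed.
Lemma eqmod_trans k f g h : eqmod k f g -> eqmod k g h -> eqmod k f h.
Proof. by move=> a /(vanishD a); rewrite addrA subrK. Qed.
Lemma eqmodD k f f' g g' : eqmod k f f' -> eqmod k g g' -> eqmod k (f + g) (f' + g').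
Proof. by move=> a /(vanishD a); rewrite /eqmod opprD addrACA. Qed.
Lemma eqmodM k f f' g g' : eqmod k f f' -> eqmod k g g' -> eqmod k (f * g) (f' * g').
Proof.
move=> a b; rewrite /eqmod; have -> : f * g - f' * g' = g * (f - f') + f' * (g - g') by ring.
by apply: vanishD; apply: vanishMl => //; apply: mdeg_morph.
Qed.
Lemma eqmodE k f g m : eqmod k f g -> (mdeg m < k)%N -> f m = g m.
Proof. by move=> a mk; apply/eqP; rewrite -subr_eq0; apply/eqP/a. Qed.

Lemma eqmod_eq f g : (forall k, eqmod k f g) -> f = g.
Proof. by move=> fg; apply/eqP; rewrite -subr_eq0; apply/eqP/vanish_eq0/fg. Qed.

Lemma eqmod_sum k I r (P : pred I) (F G : I -> fps C d) :
  (forall i, P i -> eqmod k (F i) (G i)) ->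
  eqmod k (\sum_(i <- r | P i) F i) (\sum_(i <- r | P i) G i).
Proof. by move=> FG; rewrite /eqmod -sumrB; apply: vanish_sum. Qed.

Lemma eqmod_prod k I r (P : pred I) (F G : I -> fps C d) :
  (forall i, P i -> eqmod k (F i) (G i)) ->
  eqmod k (\prod_(i <- r | P i) F i) (\prod_(i <- r | P i) G i).
Proof.
move=> FG; elim/big_rec2: _ => [|i x y Pi xy]; first exact: eqmodxx.
by apply: eqmodM => //; apply: FG.
Qed.

Lemma eqmodX k n f g : eqmod k f g -> eqmod k (f ^+ n) (g ^+ n).
Proof.
move=> fg; elim: n => [|n IH]; first exact: eqmodxx.
by rewrite !exprS; apply: eqmodM.
Qed.

Lemma eqmod_ftrunc k f : eqmod k.+1 (fpoly (ftrunc k f)) f.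
Proof.
by move=> m mk; rewrite coefB /fpoly mcoeff_ftrunc -ltnS mk subrr.
Qed.

Lemma ftrunc_fpoly k p : (msize p <= k)%N -> ftrunc k (fpoly p) = p.
Proof.
move=> pk; apply/mpolyP => m; rewrite mcoeff_ftrunc; case: leqP => // km.
by rewrite memN_msupp_eq0 //; apply/negP => /msize_mdeg_lt; lia.
Qed.

Lemma vanishX k n f : vanish mdeg k f -> vanish mdeg (n * k) (f ^+ n).
Proof.
move=> fk; elim: n => [|n IH] //.
by rewrite exprS mulSn; apply: vanishM => //; apply: mdeg_morph.
Qed.

End Order.

Section Substitution.
Variables (C : numClosedFieldType) (d e : nat).
Implicit Types (p q : {mpoly C[e]}) (h : 'I_e -> fps C d) (f g : fps C e).

Local Notation ev h := (mmap (fconst d) h).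

Lemma mmap_eqmod k h h' p : (forall i, eqmod k (h i) (h' i)) ->
  eqmod k (ev h p) (ev h' p).
Proof.
move=> hh; apply: eqmod_sum => m _; apply: eqmodM; first exact: eqmodxx.
by apply: eqmod_prod => i _; apply: eqmodX.
Qed.

Lemma mmap1_vanish h m : (forall i, vanish mdeg 1 (h i)) ->
  vanish mdeg (mdeg m) (mmap1 h m).
Proof.
move=> h1; rewrite mdegE /mmap1; elim/big_rec2: _ => [//|i x y _ xy].
by apply: vanishM => //; [apply: mdeg_morph|rewrite -[X in vanish _ X _]muln1; apply: vanishX].
Qed.

Lemma mmap_vanish k h p : (forall i, vanish mdeg 1 (h i)) ->
  (forall m, (mdeg m < k)%N -> p@_m = 0) -> vanish mdeg k (ev h p).
Proof.
move=> h1 pk; apply: vanish_sum => m _.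
case: (ltnP (mdeg m) k) => mk; first by rewrite pk // rmorph0 mul0r.
apply: vanishMl; first exact: mdeg_morph.
by apply: vanish_le mk _; apply: mmap1_vanish.
Qed.

Lemma fpoly_comp (p : {mpoly C[e]}) (t : e.-tuple {mpoly C[d]}) :
  fpoly (p \mPo t) = ev (fun i => fpoly (tnth t i)) p.
Proof.
rewrite /comp_mpoly /mmap rmorph_sum; apply: eq_bigr => m _.
rewrite rmorphM /=; congr (_ * _); rewrite /mmap1 rmorph_prod.
by apply: eq_bigr => i _; rewrite rmorphXn.
Qed.

Variable g : 'I_e -> fps C d.
Local Notation cg := (fun i => fcenter (g i)).

(** A coefficient of a composite only sees a truncation of the outer series,
    of any sufficiently high order; the composite itself is thereby a limit of
    the ring morphisms that evaluate polynomials. *)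
Lemma fcompE K f m : (mdeg m <= K)%N -> fcomp f g m = ev cg (ftrunc K f) m.
Proof.
move=> mK; rewrite /fcomp; set k := mdeg m.
rewrite -[LHS]/(fpoly _ m) fpoly_comp.
transitivity (ev cg (ftrunc k f) m).
  apply: (@eqmodE _ _ k.+1) => //; apply: mmap_eqmod => i.
  by rewrite tnth_mktuple; apply: eqmod_ftrunc.
apply: (@eqmodE _ _ k.+1) => //; apply: eqmod_sym; rewrite /eqmod -rmorphB.
apply: mmap_vanish => [i|m' m'k]; first exact: vanish_fcenter.
have m'k' : (mdeg m' <= k)%N by [].
by rewrite mcoeffB !mcoeff_ftrunc m'k' (leq_trans m'k' mK) subrr.
Qed.

Definition fsub (f : fps C e) : fps C d := fcomp f g.

Lemma fsub_eqmod K f : eqmod K.+1 (fsub f) (ev cg (ftrunc K f)).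
Proof. by move=> m mK; rewrite coefB /fsub (@fcompE K) ?subrr. Qed.

Lemma fsub_poly p : fsub (fpoly p) = ev cg p.
Proof.
apply: fpsP => m; rewrite /fsub (@fcompE (maxn (mdeg m) (msize p))) ?leq_maxl //.
by rewrite ftrunc_fpoly ?leq_maxr.
Qed.

Lemma fsub_is_additive : zmod_morphism fsub.
Proof.
move=> f1 f2; apply: fpsP => m; rewrite coefB /fsub !(@fcompE (mdeg m)) //.
rewrite -coefB -rmorphB; congr (ev _ _ _); apply/mpolyP => m'.
by rewrite mcoeffB !mcoeff_ftrunc; case: ifP; rewrite ?subrr.
Qed.

(** The degree-k coefficients of a composite only depend on truncations at
    degree k, and evaluation of polynomials is multiplicative; the truncation of
    the product and the product of the truncations differ in degrees above k,
    which evaluation at series without constant term preserves. *)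
Lemma fsub_is_monoid_morphism : monoid_morphism fsub.
Proof.
split; first by rewrite -(rmorph1 (@fpoly C e)) fsub_poly rmorph1.
move=> f1 f2; apply: fpsP => m; set k := mdeg m.
transitivity ((ev cg (ftrunc k f1) * ev cg (ftrunc k f2)) m); last first.
  apply: (@eqmodE _ _ k.+1) => //.
  by apply: eqmodM; apply: eqmod_sym; apply: fsub_eqmod.
rewrite /fsub (@fcompE k) // -rmorphM.
apply: (@eqmodE _ _ k.+1) => //; rewrite /eqmod -rmorphB.
apply: mmap_vanish => [i|m' m'k]; first exact: vanish_fcenter.
by rewrite mcoeffB mcoeff_fmul_trunc ?subrr // -ltnS.
Qed.

HB.instance Definition _ :=
  GRing.isZmodMorphism.Build _ _ fsub fsub_is_additive.
HB.instance Definition _ :=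
  GRing.isMonoidMorphism.Build _ _ fsub fsub_is_monoid_morphism.

Lemma fsub_const c : fsub (fconst e c) = fconst d c.
Proof. by rewrite /fconst fsub_poly mmapC. Qed.

Lemma fsub_var i : fsub (fvar C i) = fcenter (g i).
Proof. by rewrite /fvar fsub_poly mmapX mmap1U. Qed.

Lemma fsub_vanish k f : vanish mdeg k f -> vanish mdeg k (fsub f).
Proof.
move=> fk m mk; rewrite /fsub (@fcompE (mdeg m)) //.
apply: (mmap_vanish (k := k)) => // [i|m' m'k]; first exact: vanish_fcenter.
by rewrite mcoeff_ftrunc fk //; case: ifP.
Qed.

Lemma fsub0 f : fsub f 0%MM = f 0%MM.
Proof.
have : vanish mdeg 1 (fsub (fcenter f)) by apply/fsub_vanish/vanish_fcenter.
move/vanish1P; rewrite fcenterE rmorphB /= fsub_const coefB coef_fconst eqxx.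
by move/eqP; rewrite subr_eq0 => /eqP.
Qed.

Lemma fsub_fcenter f : fsub (fcenter f) = fcenter (fsub f).
Proof. by rewrite !fcenterE rmorphB /= fsub_const fsub0. Qed.

End Substitution.

(** Polynomials being dense, a continuous ring morphism is known from its
    values at constants and variables.  All identities between composites
    below come from this principle. *)
Lemma continuous_ext (C : numClosedFieldType) d e
    (s t : {rmorphism fps C e -> fps C d}) :
    (forall k f, vanish mdeg k f -> vanish mdeg k (s f)) ->
    (forall k f, vanish mdeg k f -> vanish mdeg k (t f)) ->
    (forall c, s (fconst e c) = t (fconst e c)) ->
    (forall i, s (fvar C i) = t (fvar C i)) ->
  s =1 t.
Proof.
move=> sk tk sc sv f; apply: eqmod_eq => k.
have poly p : s (fpoly p) = t (fpoly p).
  have -> : fpoly p = mmap (fconst e) (@fvar C e) p.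
    rewrite {1}[p]mpolyE rmorph_sum /=; apply: eq_bigr => m _.
    rewrite -mul_mpolyC rmorphM; congr (_ * _).
    rewrite mpolyXE_id rmorph_prod; apply: eq_bigr => i _.
    by rewrite rmorphXn.
  rewrite /mmap !rmorph_sum; apply: eq_bigr => m _.
  rewrite !rmorphM sc; congr (_ * _); rewrite !rmorph_prod.
  by apply: eq_bigr => i _; rewrite !rmorphXn sv.
have ap (u : fps C e -> fps C d) : (forall k f, vanish mdeg k f -> vanish mdeg k (u f)) ->
    zmod_morphism u -> eqmod k (u f) (u (fpoly (ftrunc k f))).
  move=> uk uB; rewrite /eqmod -uB; apply: uk; apply: vanish_le (leqnSn k) _.
  exact/eqmod_sym/eqmod_ftrunc.
have := ap s sk (raddfB s); have /eqmod_sym := ap t tk (raddfB t).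
by rewrite poly => /[swap]; apply: eqmod_trans.
Qed.

Section Composition.
Variable C : numClosedFieldType.

Lemma fsub_comp c d e (h : 'I_d -> fps C c) (g : 'I_e -> fps C d) f :
  fsub h (fsub g f) = fsub (fun i => fsub h (g i)) f.
Proof.
apply: (continuous_ext (s := fsub h \o fsub g)) => [k u uk|k u uk|a|i] /=.
- by do 2!apply: fsub_vanish.
- exact: fsub_vanish.
- by rewrite /= !fsub_const.
- by rewrite !fsub_var fsub_fcenter.
Qed.

Lemma fsub_id d (g : 'I_d -> fps C d) f :
  (forall i, fcenter (g i) = fvar C i) -> fsub g f = f.
Proof.
move=> gi; apply: (continuous_ext (s := fsub g) (t := idfun)) => //=.
- exact: fsub_vanish.
- exact: fsub_const.
- by move=> i; rewrite fsub_var gi.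
Qed.

Lemma eq_fsub d e (g g' : 'I_e -> fps C d) f :
  (forall i, fcenter (g i) = fcenter (g' i)) -> fsub g f = fsub g' f.
Proof.
move=> gg; apply: (continuous_ext (s := fsub g) (t := fsub g')).
- exact: fsub_vanish.
- exact: fsub_vanish.
- by move=> c /=; rewrite !fsub_const.
- by move=> i /=; rewrite !fsub_var.
Qed.

Lemma fcenter_fvar d (i : 'I_d) : fcenter (fvar C i) = fvar C i.
Proof.
rewrite fcenter_id // coef_fvar; case: eqP => // /(congr1 mdeg).
by rewrite mdeg0 mdeg1.
Qed.

End Composition.

(** * Inverses of series and of maps *)

Section Inverse.
Variables (C : numClosedFieldType).

Section Unit.
Variable d : nat.
Implicit Types u f : fps C d.

Definition fgeometric : fps C 1 := fun=> 1.

Lemma fgeometricE : (1 - fvar C ord0) * fgeometric = 1.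
Proof.
apply: fpsP => m; rewrite mulrBl mul1r coefB coef_varM coef1 /fgeometric.
have -> : (m == 0%MM) = (m ord0 == 0%N).
  apply/eqP/eqP => [->|m0]; first by rewrite mnm0E.
  by apply/mnmP => i; rewrite mnm0E (ord1 i).
by case: (m ord0) => [|k]; rewrite ?subr0 ?subrr.
Qed.

(** For u = c v with v of constant term 1, this is c^-1 times the geometric
    series in 1 - v. *)
Definition finv u : fps C d :=
  fconst d (u 0%MM)^-1 *
    fsub (fun=> 1 - fconst d (u 0%MM)^-1 * u) fgeometric.

Lemma fmulV u : u 0%MM != 0 -> u * finv u = 1.
Proof.
move=> u0; pose v := fconst d (u 0%MM)^-1 * u.
have v0 : (1 - v) 0%MM = 0 by rewrite coefB coef1 [v _]coef_constM mulVf // eqxx subrr.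
rewrite /finv mulrA (mulrC u) -/v.
have := congr1 (fsub (fun _ : 'I_1 => 1 - v)) fgeometricE.
by rewrite rmorphM rmorphB !rmorph1 /= fsub_var fcenter_id // subKr.
Qed.

Lemma coef0M f g : (f * g) 0%MM = f 0%MM * g 0%MM.
Proof.
have c1 (h : fps C d) : eqmod 1 h (fconst d (h 0%MM)) by rewrite /eqmod -fcenterE; apply: vanish_fcenter.
rewrite (eqmodE (eqmodM (c1 f) (c1 g))) ?mdeg0 //.
by rewrite coef_constM coef_fconst eqxx.
Qed.

Lemma finv0 u : u 0%MM != 0 -> finv u 0%MM = (u 0%MM)^-1.
Proof.
move=> u0; apply: (mulfI u0); rewrite mulfV //.
by rewrite -coef0M fmulV // coef1 eqxx.
Qed.

Lemma fmul_unitI u : u 0%MM != 0 -> injective (fun f => u * f).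
Proof.
move=> u0 f g /(congr1 (fun h => finv u * h)).
by rewrite !mulrA ![finv u * u]mulrC fmulV // !mul1r.
Qed.

End Unit.

Section LinearPart.
Variable d : nat.
Implicit Types f : fps C d.

Lemma mdeg_lt2 (m : 'X_{1..d}) : (mdeg m < 2)%N ->
  m = 0%MM \/ exists i, m = U_(i)%MM.
Proof.
case: (posnP (mdeg m)) => [/eqP|m0 m2]; first by rewrite mdeg_eq0 => /eqP; left.
have /mdeg1P [i /eqP ->] : mdeg m == 1%N by lia.
by right; exists i.
Qed.

Lemma mnm1_inj (i j : 'I_d) : (U_(i)%MM == U_(j)%MM) = (i == j).
Proof.
apply/eqP/eqP => [|-> //] /mnmP /(_ i); rewrite !mnm1E eqxx.
by case: eqP.
Qed.

Lemma mnm1_neq0 (i : 'I_d) : (U_(i)%MM == 0%MM :> 'X_{1..d}) = false.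
Proof. by rewrite -mdeg_eq0 mdeg1. Qed.

Definition flinear (a : 'I_d -> C) : fps C d := \sum_i fconst d (a i) * fvar C i.

Lemma coef_flinear a i : flinear a U_(i)%MM = a i.
Proof.
rewrite /flinear coef_sum (bigD1 i) //= coef_constM coef_fvar eqxx mulr1 big1 ?addr0 //.
by move=> j ji; rewrite coef_constM coef_fvar mnm1_inj eq_sym (negbTE ji) mulr0.
Qed.

Lemma flinear0 a : flinear a 0%MM = 0.
Proof.
rewrite /flinear coef_sum big1 // => j _.
by rewrite coef_constM coef_fvar eq_sym mnm1_neq0 mulr0.
Qed.

Lemma linear_part f : f 0%MM = 0 ->
  vanish mdeg 2 (f - flinear (fun i => f U_(i)%MM)).
Proof.
move=> f0 m /mdeg_lt2 [->|[i ->]].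
  by rewrite coefB f0 flinear0 subrr.
by rewrite coefB coef_flinear subrr.
Qed.

End LinearPart.

Lemma fsub_flinear d e (g : 'I_e -> fps C d) (a : 'I_e -> C) :
  fsub g (flinear a) = \sum_k fconst d (a k) * fcenter (g k).
Proof.
by rewrite /flinear rmorph_sum; apply: eq_bigr => k _; rewrite rmorphM /= fsub_const fsub_var.
Qed.

Lemma chain_rule d e (g : 'I_e -> fps C d) (f : fps C e) j :
  fsub g f U_(j)%MM = \sum_k f U_(k)%MM * g k U_(j)%MM.
Proof.
have fc : fsub g f U_(j)%MM = fsub g (fcenter f) U_(j)%MM.
  by rewrite fsub_fcenter /fcenter mnm1_neq0.
have fc0 : fcenter f 0%MM = 0 by rewrite /fcenter eqxx.
have := fsub_vanish g (linear_part fc0) (m := U_(j)%MM).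
rewrite mdeg1 rmorphB /= coefB => /(_ isT) /eqP; rewrite subr_eq0 fsub_flinear.
rewrite fc => /eqP ->; rewrite coef_sum; apply: eq_bigr => k _.
by rewrite coef_constM /fcenter !mnm1_neq0.
Qed.

(** The relation between two products of r series without constant term whose
    factors agree pairwise up to order k: each extra factor adds one order to
    the agreement of the products. *)
Definition close d k r (x y : fps C d) :=
  [/\ vanish mdeg r x, vanish mdeg r y & eqmod (k + r).-1 x y].

Lemma closeM d k r s (x y x' y' : fps C d) : (0 < k)%N ->
  close k r x y -> close k s x' y' -> close k (r + s) (x * x') (y * y').
Proof.
move=> k0 [rx ry xy] [sx sy xy']; have mD := @mdeg_morph d; split.
- exact: vanishM.
- exact: vanishM.
rewrite /eqmod; have -> : x * x' - y * y' = x * (x' - y') + (x - y) * y' by ring.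
apply: vanishD.
  by have -> : (k + (r + s)).-1 = (r + (k + s).-1)%N by [lia]; apply: vanishM.
by have -> : (k + (r + s)).-1 = ((k + r).-1 + s)%N by [lia]; apply: vanishM.
Qed.

Lemma close1 d k : close k 0 (1 : fps C d) 1.
Proof. by split=> //; apply: eqmodxx. Qed.

(** Substituting into a series of order two gains one order of precision:
    this makes the iteration for the inverse map contract. *)
Lemma fsub_contract d e k (g g' : 'I_e -> fps C d) (f : fps C e) :
    (0 < k)%N -> vanish mdeg 2 f ->
    (forall i, g i 0%MM = 0) -> (forall i, g' i 0%MM = 0) ->
    (forall i, eqmod k (g i) (g' i)) ->
  eqmod k.+1 (fsub g f) (fsub g' f).
Proof.
move=> k0 f2 g0 g'0 gg; apply: (eqmod_trans (@fsub_eqmod _ _ _ g k f)).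
apply: eqmod_sym; apply: (eqmod_trans (@fsub_eqmod _ _ _ g' k f)); apply: eqmod_sym.
apply: eqmod_sum => m _; rewrite mcoeff_ftrunc.
case: (ltnP (mdeg m) 2) => m2.
  by rewrite f2 // if_same rmorph0 !mul0r; apply: eqmodxx.
apply: eqmodM; first exact: eqmodxx.
have cl i n : close k n (fcenter (g i) ^+ n) (fcenter (g' i) ^+ n).
  elim: n => [|n IH]; first exact: close1.
  rewrite !exprS -add1n; apply: closeM => //.
  by split; rewrite ?addn1 ?fcenter_id //; apply/vanish1P.
have [_ _] : close k (mdeg m) (mmap1 (fun i => fcenter (g i)) m)
                              (mmap1 (fun i => fcenter (g' i)) m).
  rewrite mdegE /mmap1; elim/big_rec3: _ => [|i r x y _ IH]; first exact: close1.
  by apply: closeM.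
by apply: vanish_le; lia.
Qed.

(** With J the linear part and N the remainder of H, a right inverse P is a
    fixed point of P |-> J^-1 (Z - N o P).  As N has order two, each iteration
    fixes the coefficients of one more degree. *)
Lemma right_inverse_map d (H : fmap C d d) : (forall i, H i 0%MM = 0) ->
  fmap_jacobian H \in unitmx ->
  exists P : fmap C d d, [/\ forall i, P i 0%MM = 0,
    forall i, fsub P (H i) = fvar C i &
    fmap_jacobian P = invmx (fmap_jacobian H)].
Proof.
move=> H0 Ju; set J := fmap_jacobian H; set I := invmx J.
pose N j : fps C d := H j - flinear (fun k => J j k).
have N2 j : vanish mdeg 2 (N j).
  move=> m m2; rewrite /N -(linear_part (H0 j) m2); congr ((_ - flinear _) _).
  by apply/funext => k; rewrite mxE.
pose step (P : fmap C d d) : fmap C d d :=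
  fun i => \sum_j fconst d (I i j) * (fvar C j - fsub P (N j)).
have step0 P i : step P i 0%MM = 0.
  rewrite /step coef_sum big1 // => j _; rewrite coef_constM coefB fsub0 N2 ?mdeg0 //.
  by rewrite coef_fvar eq_sym mnm1_neq0 subrr mulr0.
have step_c k P P' : (0 < k)%N -> (forall i, P i 0%MM = 0) ->
    (forall i, P' i 0%MM = 0) -> (forall i, eqmod k (P i) (P' i)) ->
    forall i, eqmod k.+1 (step P i) (step P' i).
  move=> k0 P0 P'0 PP i; apply: eqmod_sum => j _; apply: eqmodM; first exact: eqmodxx.
  apply: eqmodD; first exact: eqmodxx.
  move=> m mk; rewrite coefB !coefN opprK addrC.
  by have := eqmod_sym (fsub_contract k0 (N2 j) P0 P'0 PP) mk; rewrite coefB.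
(* The coefficients of degree k of the iterates are stationary from the k-th
   iterate on; P collects them. *)
pose A k := iter k step (fun=> 0).
have A0 k i : A k i 0%MM = 0 by case: k => [|k] //=; apply: step0.
have AS k i : eqmod k.+1 (A k i) (A k.+1 i).
  elim: k i => [|k IH] i; last by apply: step_c.
  by apply/vanish1P; rewrite coefB !A0 subrr.
have A_le j k i : (j <= k)%N -> eqmod j.+1 (A j i) (A k i).
  move=> /subnK <-; elim: (k - j)%N => [|r IH]; first exact: eqmodxx.
  apply: (eqmod_trans IH); apply: vanish_le (AS _ _); lia.
pose P : fmap C d d := fun i m => A (mdeg m) i m.
have PA k i : eqmod k.+1 (P i) (A k i).
  by move=> m mk; rewrite coefB /P (eqmodE (@A_le (mdeg m) k i _)) ?subrr.
have P0 i : P i 0%MM = 0 by apply: A0.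
have Pfix i : P i = step P i.
  apply: eqmod_eq => k; apply: (eqmod_trans (g := A k.+1 i)).
    by apply: vanish_le (PA k.+1 i); lia.
  apply: (vanish_le (leqnSn k)); apply: eqmod_sym; case: k => [|k].
    by apply/vanish1P; rewrite coefB step0 (A0 1) subrr.
  apply: step_c => // j; exact: vanish_le (leqnSn _) (PA k.+1 j).
exists P; split=> // [i|].
  have -> : fsub P (H i) = fsub P (flinear (fun k => J i k)) + fsub P (N i).
    by rewrite -rmorphD addrC subrK.
  have -> : fsub P (flinear (fun k => J i k)) = fvar C i - fsub P (N i).
    rewrite fsub_flinear.
    under eq_bigr => k _ do rewrite fcenter_id // Pfix /step mulr_sumr.
    rewrite exchange_big /=.
    under eq_bigr => j _ do [under eq_bigr => k _ do rewrite mulrA -rmorphM;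
      rewrite -mulr_suml -rmorph_sum].
    rewrite [LHS](bigD1 i) //= [X in _ + X]big1 ?addr0 => [|j ji].
      have -> : \sum_k J i k * I k i = 1.
        by have /matrixP /(_ i i) := mulmxV Ju; rewrite !mxE eqxx.
      by rewrite rmorph1 mul1r.
    have -> : \sum_k J i k * I k j = 0.
      by have /matrixP /(_ i j) := mulmxV Ju; rewrite !mxE eq_sym (negbTE ji).
    by rewrite rmorph0 mul0r.
  by rewrite subrK.
have NP j k : fsub P (N j) U_(k)%MM = 0.
  by apply: (fsub_vanish P (N2 j)); rewrite mdeg1.
apply/matrixP => i k; rewrite mxE Pfix /step coef_sum (bigD1 k) //= big1 ?addr0.
  by rewrite coef_constM coefB coef_fvar eqxx NP subr0 mulr1.
move=> j jk; rewrite coef_constM coefB coef_fvar NP mnm1_inj eq_sym (negbTE jk).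
by rewrite subrr mulr0.
Qed.

(** The right inverse of a map has a right inverse too, which is then the map
    itself. *)
Lemma inverse_map d (H : fmap C d d) : (forall i, H i 0%MM = 0) ->
  fmap_jacobian H \in unitmx ->
  exists P : fmap C d d, [/\ forall i, P i 0%MM = 0,
    forall i, fsub P (H i) = fvar C i & forall i, fsub H (P i) = fvar C i].
Proof.
move=> H0 Ju; have [P [P0 HP JP]] := right_inverse_map H0 Ju.
have [Q [Q0 PQ _]] : exists Q : fmap C d d, [/\ forall i, Q i 0%MM = 0,
    forall i, fsub Q (P i) = fvar C i &
    fmap_jacobian Q = invmx (fmap_jacobian P)].
  by apply: right_inverse_map; rewrite // JP unitmx_inv.
have QH : Q = H.
  apply/funext => i; rewrite -[Q i]fcenter_id // -fsub_var -HP fsub_comp.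
  by apply: fsub_id => j; rewrite PQ fcenter_fvar.
by exists P; split=> // i; rewrite -QH.
Qed.

End Inverse.

(** * Series in Z and its conjugate *)

Section Doubling.
Variable C : numClosedFieldType.

Section Conj.
Variable d : nat.
Implicit Types f g : fps C d.

Definition fconj f : fps C d := fun m => (f m)^*.

Lemma fconj_is_additive : zmod_morphism fconj.
Proof. by move=> f g; apply: fpsP => m; rewrite /fconj !coefB rmorphB. Qed.
Lemma fconj_is_monoid_morphism : monoid_morphism fconj.
Proof.
split; first by apply: fpsP => m; rewrite /fconj !coef1 rmorph_nat.
move=> f g; apply: fpsP => m; rewrite -!fmulE /fconj /fmul rmorph_sum.
by apply: eq_bigr => k _; rewrite rmorphM.
Qed.
HB.instance Definition _ :=
  GRing.isZmodMorphism.Build _ _ fconj fconj_is_additive.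
HB.instance Definition _ :=
  GRing.isMonoidMorphism.Build _ _ fconj fconj_is_monoid_morphism.

Lemma fconj_const c : fconj (fconst d c) = fconst d c^*.
Proof. by apply: fpsP => m; rewrite /fconj !coef_fconst; case: eqP; rewrite ?rmorph0. Qed.

Lemma fconj_var i : fconj (fvar C i) = fvar C i.
Proof. by apply: fpsP => m; rewrite /fconj !coef_fvar rmorph_nat. Qed.

Lemma fconj_vanish w k f : vanish w k f -> vanish w k (fconj f).
Proof. by move=> fk m mk; rewrite /fconj fk ?rmorph0. Qed.

Lemma fconj_fcenter f : fconj (fcenter f) = fcenter (fconj f).
Proof. by rewrite !fcenterE rmorphB /= fconj_const. Qed.

End Conj.

Lemma fconj_fsub d e (g : 'I_e -> fps C d) f :
  fconj (fsub g f) = fsub (fun i => fconj (g i)) (fconj f).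
Proof.
apply: (continuous_ext (s := @fconj d \o fsub g)
                       (t := fsub (fun i => fconj (g i)) \o @fconj e)) => /=.
- by move=> k u uk; apply/fconj_vanish/fsub_vanish.
- by move=> k u uk; apply/fsub_vanish/fconj_vanish.
- by move=> c /=; rewrite !(fsub_const, fconj_const).
- by move=> i; rewrite !(fsub_var, fconj_var) fconj_fcenter.
Qed.

Section Kernel.
Variable d : nat.
Implicit Types (f g : fps C d) (a b : 'X_{1..d}) (k : fps C (d + d)).

Definition lft f : fps C (d + d) := fsub (fun i => fvar C (lshift d i)) f.
Definition rgt f : fps C (d + d) := fsub (fun i => fvar C (rshift d i)) f.

HB.instance Definition _ := GRing.isZmodMorphism.Build _ _ lft
  (@fsub_is_additive _ _ _ (fun i => fvar C (lshift d i))).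
HB.instance Definition _ := GRing.isMonoidMorphism.Build _ _ lft
  (@fsub_is_monoid_morphism _ _ _ (fun i => fvar C (lshift d i))).
HB.instance Definition _ := GRing.isZmodMorphism.Build _ _ rgt
  (@fsub_is_additive _ _ _ (fun i => fvar C (rshift d i))).
HB.instance Definition _ := GRing.isMonoidMorphism.Build _ _ rgt
  (@fsub_is_monoid_morphism _ _ _ (fun i => fvar C (rshift d i))).

Definition mjoin a b : 'X_{1..d + d} :=
  [multinom match split i with inl j => a j | inr j => b j end | i < d + d].
Definition mleft (m : 'X_{1..d + d}) : 'X_{1..d} :=
  [multinom m (lshift d i) | i < d].
Definition mright (m : 'X_{1..d + d}) : 'X_{1..d} :=
  [multinom m (rshift d i) | i < d].

Lemma mjoinl a b i : mjoin a b (lshift d i) = a i.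
Proof. by rewrite mnmE (unsplitK (inl _)). Qed.
Lemma mjoinr a b i : mjoin a b (rshift d i) = b i.
Proof. by rewrite mnmE (unsplitK (inr _)). Qed.

Lemma mjoin_left a b : mleft (mjoin a b) = a.
Proof. by apply/mnmP => i; rewrite mnmE mjoinl. Qed.
Lemma mjoin_right a b : mright (mjoin a b) = b.
Proof. by apply/mnmP => i; rewrite mnmE mjoinr. Qed.
Lemma mjoinK m : mjoin (mleft m) (mright m) = m.
Proof.
by apply/mnmP => i; case: (split_ordP i) => j ->; rewrite ?mjoinl ?mjoinr mnmE.
Qed.

Lemma mjoinD a b a' b' : (mjoin a b + mjoin a' b' = mjoin (a + a') (b + b'))%MM.
Proof.
apply/mnmP => i; case: (split_ordP i) => j ->.
  by rewrite mnmDE !mjoinl mnmDE.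
by rewrite mnmDE !mjoinr mnmDE.
Qed.

Lemma mjoinB a b a' b' : (mjoin a b - mjoin a' b' = mjoin (a - a') (b - b'))%MM.
Proof.
apply/mnmP => i; case: (split_ordP i) => j ->.
  by rewrite mnmBE !mjoinl mnmBE.
by rewrite mnmBE !mjoinr mnmBE.
Qed.

Lemma mjoinUl i : U_(lshift d i)%MM = mjoin U_(i) 0%MM.
Proof.
apply/mnmP => j; case: (split_ordP j) => r ->; rewrite ?mjoinl ?mjoinr !mnmE.
  by rewrite eq_lshift.
by rewrite eq_lrshift.
Qed.

Lemma mjoinUr i : U_(rshift d i)%MM = mjoin 0%MM U_(i).
Proof.
apply/mnmP => j; case: (split_ordP j) => r ->; rewrite ?mjoinl ?mjoinr !mnmE.
  by rewrite eq_rlshift.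
by rewrite eq_rshift.
Qed.

Lemma mjoin_eq a b a' b' : (mjoin a b == mjoin a' b') = (a == a') && (b == b').
Proof.
apply/eqP/andP => [e|[/eqP -> /eqP -> //]].
by split; apply/eqP; [rewrite -(mjoin_left a b) e mjoin_left
                     |rewrite -(mjoin_right a b) e mjoin_right].
Qed.

Lemma mjoin00 : mjoin 0%MM 0%MM = 0%MM.
Proof. by rewrite -[RHS]mjoinK; congr mjoin; apply/mnmP => i; rewrite !mnmE. Qed.

Lemma mdeg_mjoin a b : mdeg (mjoin a b) = (mdeg a + mdeg b)%N.
Proof.
rewrite !mdegE big_split_ord /=; congr (_ + _)%N; apply: eq_bigr => i _.
  by rewrite mjoinl.
by rewrite mjoinr.
Qed.

(** A series in (Z, \bar Z) is read as a matrix indexed by pairs of monomials: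
    products of a series in Z and one in \bar Z become matrices of rank one. *)
Definition ker k a b : C := k (mjoin a b).

Lemma kerP k k' : (forall a b, ker k a b = ker k' a b) -> k = k'.
Proof. by move=> kk; apply: fpsP => m; rewrite -(mjoinK m); apply: kk. Qed.

Lemma kerD k k' a b : ker (k + k') a b = ker k a b + ker k' a b. Proof. by []. Qed.
Lemma kerB k k' a b : ker (k - k') a b = ker k a b - ker k' a b. Proof. by []. Qed.
Lemma ker_sum I r (P : pred I) (F : I -> fps C (d + d)) a b :
  ker (\sum_(i <- r | P i) F i) a b = \sum_(i <- r | P i) ker (F i) a b.
Proof. exact: coef_sum. Qed.
Lemma ker_constM c k a b : ker (fconst _ c * k) a b = c * ker k a b.
Proof. exact: coef_constM. Qed.

(** The monomials of f(Z) g(\bar Z) determine their factors, so no two terms of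
    the product collide. *)
Lemma ker_lr f g a b : ker (lft f * rgt g) a b = f a * g b.
Proof.
rewrite /ker; set k := (mdeg a + mdeg b)%N.
have kE : (mdeg (mjoin a b) < k.+1)%N by rewrite mdeg_mjoin.
rewrite (eqmodE (eqmodM (@fsub_eqmod _ _ _ _ k f) (@fsub_eqmod _ _ _ _ k g)) kE).
have lE p : mmap (fconst _) (fun i => fcenter (fvar C (lshift d i))) p =
    fpoly (\sum_(m <- msupp p) p@_m *: 'X_[mjoin m 0%MM]).
  rewrite /mmap rmorph_sum; apply: eq_bigr => m _ /=.
  rewrite -mul_mpolyC rmorphM; congr (_ * _).
  rewrite mpolyXE_id rmorph_prod big_split_ord /= [X in _ * X]big1 ?mulr1.
    by apply: eq_bigr => i _; rewrite mjoinl rmorphXn fcenter_fvar.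
  by move=> i _; rewrite mjoinr mnm0E expr0 rmorph1.
have rE p : mmap (fconst _) (fun i => fcenter (fvar C (rshift d i))) p =
    fpoly (\sum_(m <- msupp p) p@_m *: 'X_[mjoin 0%MM m]).
  rewrite /mmap rmorph_sum; apply: eq_bigr => m _ /=.
  rewrite -mul_mpolyC rmorphM; congr (_ * _).
  rewrite mpolyXE_id rmorph_prod big_split_ord /= [X in X * _]big1 ?mul1r.
    by apply: eq_bigr => i _; rewrite mjoinr rmorphXn fcenter_fvar.
  by move=> i _; rewrite mjoinl mnm0E expr0 rmorph1.
rewrite lE rE -rmorphM /= /fpoly mulr_suml raddf_sum /=.
have cE (h : fps C d) m : (mdeg m <= k)%N ->
    \sum_(m' <- msupp (ftrunc k h)) (ftrunc k h)@_m' * (m' == m)%:R = h m :> C.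
  move=> mk; have E : (ftrunc k h)@_m = h m by rewrite mcoeff_ftrunc mk.
  have := congr1 (mcoeff m) (mpolyE (ftrunc k h)); rewrite E raddf_sum /= => ->.
  by apply: eq_bigr => m' _; rewrite mcoeffZ mcoeffX.
rewrite -(cE f a) ?leq_addr // mulr_suml; apply: eq_bigr => m1 _.
rewrite mulr_sumr raddf_sum /= -(cE g b) ?leq_addl // mulr_sumr.
apply: eq_bigr => m2 _.
rewrite -scalerAl -scalerAr -mpolyXD !mcoeffZ mcoeffX mjoinD addm0 add0m mjoin_eq.
by case: eqP => _; case: eqP => _; rewrite ?(mulr0, mul0r, mulr1).
Qed.

Lemma ker_l f a b : ker (lft f) a b = f a * (b == 0%MM)%:R.
Proof. by rewrite -[lft f]mulr1 -(rmorph1 rgt) ker_lr. Qed.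
Lemma ker_r f a b : ker (rgt f) a b = (a == 0%MM)%:R * f b.
Proof. by rewrite -[rgt f]mul1r -(rmorph1 lft) ker_lr. Qed.

(** Restriction to \bar Z = 0, where Z and \bar Z are independent variables. *)
Definition fl k : fps C d := fun a => ker k a 0%MM.
(** Restriction to Z = 0. *)
Definition fr k : fps C d := fun b => ker k 0%MM b.

Lemma flD k k' : fl (k + k') = fl k + fl k'. Proof. by []. Qed.
Lemma flB k k' : fl (k - k') = fl k - fl k'. Proof. by []. Qed.
Lemma frD k k' : fr (k + k') = fr k + fr k'. Proof. by []. Qed.
Lemma frB k k' : fr (k - k') = fr k - fr k'. Proof. by []. Qed.

Lemma fl_lft f : fl (lft f) = f.
Proof. by apply: fpsP => a; rewrite /fl ker_l eqxx mulr1. Qed.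
Lemma fr_rgt f : fr (rgt f) = f.
Proof. by apply: fpsP => a; rewrite /fr ker_r eqxx mul1r. Qed.
Lemma fl_rgt f : fl (rgt f) = fconst d (f 0%MM).
Proof. by apply: fpsP => a; rewrite /fl ker_r coef_fconst mulr_natl. Qed.
Lemma fl_eq0M k k' : fl k = 0 -> fl (k' * k) = 0.
Proof.
move=> k0; apply: fpsP => a.
have w : {morph (fun m : 'X_{1..d + d} => mdeg (mright m)) :
    x y / (x + y)%MM >-> (x + y)%N}.
  move=> x y /=; rewrite -mdegD; congr mdeg; apply/mnmP => i.
  by rewrite mnmDE !mnmE.
apply: (vanishMl (k := 1) k' w); last by rewrite mjoin_right mdeg0.
move=> m; rewrite ltnS leqn0 mdeg_eq0 => /eqP m0; rewrite -[m]mjoinK m0.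
exact: (congr1 (fun f : fps C d => f _) k0).
Qed.

Lemma fr_eq0M k k' : fr k = 0 -> fr (k' * k) = 0.
Proof.
move=> k0; apply: fpsP => a.
have w : {morph (fun m : 'X_{1..d + d} => mdeg (mleft m)) :
    x y / (x + y)%MM >-> (x + y)%N}.
  move=> x y /=; rewrite -mdegD; congr mdeg; apply/mnmP => i.
  by rewrite mnmDE !mnmE.
apply: (vanishMl (k := 1) k' w); last by rewrite mjoin_left mdeg0.
move=> m; rewrite ltnS leqn0 mdeg_eq0 => /eqP m0; rewrite -[m]mjoinK m0.
exact: (congr1 (fun f : fps C d => f _) k0).
Qed.

(** Restriction to \bar Z = 0 is multiplicative because the series vanishing
    there form an ideal. *)
Lemma flM k k' : fl (k * k') = fl k * fl k'.
Proof.
have -> : k * k' = lft (fl k * fl k') + lft (fl k) * (k' - lft (fl k')) +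
    k' * (k - lft (fl k)).
  by rewrite rmorphM /=; ring.
by rewrite !flD fl_lft !fl_eq0M ?addr0 // flB fl_lft subrr.
Qed.

Lemma frM k k' : fr (k * k') = fr k * fr k'.
Proof.
have -> : k * k' = rgt (fr k * fr k') + rgt (fr k) * (k' - rgt (fr k')) +
    k' * (k - rgt (fr k)).
  by rewrite rmorphM /=; ring.
by rewrite !frD fr_rgt !fr_eq0M ?addr0 // frB fr_rgt subrr.
Qed.

Lemma lft_var i : lft (fvar C i) = fvar C (lshift d i).
Proof. by rewrite /lft fsub_var fcenter_fvar. Qed.
Lemma rgt_var i : rgt (fvar C i) = fvar C (rshift d i).
Proof. by rewrite /rgt fsub_var fcenter_fvar. Qed.

End Kernel.

Section Pullback.
Variables (d e : nat) (H : fmap C d e).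

Definition pull2 : fps C (e + e) -> fps C (d + d) := fsub (fmap_with_bar H).
HB.instance Definition _ := GRing.isZmodMorphism.Build _ _ pull2
  (@fsub_is_additive _ _ _ (fmap_with_bar H)).
HB.instance Definition _ := GRing.isMonoidMorphism.Build _ _ pull2
  (@fsub_is_monoid_morphism _ _ _ (fmap_with_bar H)).

Lemma fmap_with_bar_l i : fmap_with_bar H (lshift e i) = lft (H i).
Proof. by rewrite /fmap_with_bar (unsplitK (inl _)). Qed.
Lemma fmap_with_bar_r i : fmap_with_bar H (rshift e i) = rgt (fconj (H i)).
Proof. by rewrite /fmap_with_bar (unsplitK (inr _)). Qed.

Lemma pull2_const c : pull2 (fconst _ c) = fconst _ c.
Proof. exact: fsub_const. Qed.

Lemma pull2_lft f : pull2 (lft f) = lft (fsub H f).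
Proof.
rewrite /pull2 /lft !fsub_comp; apply: eq_fsub => i.
rewrite fsub_var fmap_with_bar_l.
by rewrite fcenter_id // /fcenter eqxx.
Qed.

Lemma pull2_rgt f : pull2 (rgt (fconj f)) = rgt (fconj (fsub H f)).
Proof.
rewrite fconj_fsub /pull2 /rgt !fsub_comp; apply: eq_fsub => i.
rewrite fsub_var fmap_with_bar_r.
by rewrite fcenter_id // /fcenter eqxx.
Qed.

Lemma pull2_vanish k f : vanish mdeg k f -> vanish mdeg k (pull2 f).
Proof. exact: fsub_vanish. Qed.

End Pullback.

End Doubling.

(** * The rank of a multiple of a Hermitian form *)

Section RankOfMultiples.
Variables (C : numClosedFieldType) (d : nat) (eps : 'I_d -> C).
Hypothesis eps_neq0 : forall m, eps m != 0.
Local Notation X := 'X_{1..d}.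
Implicit Types (A : X -> X -> C) (s : seq 'I_d) (a b : X).

(** The matrix of the product of A with the form
    \sum_(m <- s) eps_m z_m \bar z_m.  The list s makes room for an induction on the number of variables. *)
Definition mul_herm s A a b : C := \sum_(m <- s)
  if (0 < a m)%N && (0 < b m)%N then eps m * A (a - U_(m))%MM (b - U_(m))%MM
  else 0.

Lemma det_neq0_row k (M : 'M[C]_k) i : \det M != 0 -> exists j, M i j != 0.
Proof.
move=> D; apply/existsP; apply: contraNT D => /existsPn M0.
rewrite (expand_det_row _ i) big1 // => j _.
by have /negPn/eqP -> := M0 j; rewrite mul0r.
Qed.

Lemma det_neq0_col k (M : 'M[C]_k) j : \det M != 0 -> exists i, M i j != 0.
Proof. by move=> D; have [|i] := @det_neq0_row _ M^T j; rewrite ?det_tr // mxE; exists i. Qed.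

Lemma mul_herm_neq0 s A a b : mul_herm s A a b != 0 ->
  exists m, [/\ m \in s, (0 < a m)%N, (0 < b m)%N &
                A (a - U_(m))%MM (b - U_(m))%MM != 0].
Proof.
move=> K; suff: has (fun m => [&& (0 < a m)%N, (0 < b m)%N &
    A (a - U_(m))%MM (b - U_(m))%MM != 0]) s.
  by case/hasP => m ms /and3P [a0 b0 A0]; exists m.
apply: contraNT K => /hasPn N; rewrite /mul_herm big_seq big1 // => m /N.
by case: (0 < a m)%N; case: (0 < b m)%N => //= /negPn/eqP ->; rewrite mulr0.
Qed.

Lemma split_lshift m n (i : 'I_m) : split (lshift n i) = inl i.
Proof. exact: (unsplitK (inl _)). Qed.
Lemma split_rshift m n (i : 'I_n) : split (rshift m i) = inr i.
Proof. exact: (unsplitK (inr _)). Qed.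

Lemma mnm_sub_neq (a : X) (m m' : 'I_d) : m != m' -> (a - U_(m'))%MM m = a m.
Proof. by move=> mm; rewrite mnmBE mnm1E eq_sym (negbTE mm) subn0. Qed.

(** Huang's lemma in matrix form.  Induction on the number of variables of the
    form, grading by the difference of the exponents of z_m and \bar z_m:
    z_m \bar z_m has degree 0, so in lowest degree the matrix of the product
    is block triangular.  The block with least z_m-exponent contains the
    product with the remaining form, and the block with greatest z_m-exponent
    contributes one more nonzero entry. *)
Lemma mul_herm_minor s A N a0 b0 : uniq s ->
    (forall a b, A a b != 0 -> (mdeg a < N)%N && (mdeg b < N)%N) ->
    A a0 b0 != 0 ->
  exists r c : 'I_(size s) -> X,
    \det (\matrix_(i, j) mul_herm s A (r i) (c j)) != 0.
Proof.
elim: s A a0 b0 => [|m s IH] A a0 b0 /=.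
  by move=> _ _ _; exists (fun=> 0%MM), (fun=> 0%MM); rewrite det_mx00 oner_eq0.
case/andP=> ms us AN A0.
have ltN a (i : 'I_d) : (mdeg a < N)%N -> (a i < N)%N.
  by move=> aN; apply: leq_ltn_trans aN; rewrite mdegE (bigD1 i) //= leq_addr.
have bN a b : A a b != 0 -> (b m < N)%N by move/AN => /andP [_ /ltN].
have aN a b : A a b != 0 -> (a m < N)%N by move/AN => /andP [/ltN].
(* The shift by N keeps the difference of the exponents nonnegative. *)
pose gr a b := (a m + N - b m)%N.
have exD : exists k, `[< exists a b, A a b != 0 /\ gr a b = k >].
  by exists (gr a0 b0); apply/asboolP; exists a0, b0.
case: (ex_minnP exD) => D /asboolP [aD [bD [AD grD]]] minD.
have Dle a b : A a b != 0 -> (D <= gr a b)%N.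
  by move=> Aab; apply: minD; apply/asboolP; exists a, b.
(* (al, be) has least and (a1, b1) greatest z_m-exponent in lowest degree D. *)
have exi : exists i, `[< exists a b, [/\ A a b != 0, gr a b = D & a m = i] >].
  by exists (aD m); apply/asboolP; exists aD, bD.
case: (ex_minnP exi) => i0 /asboolP [al [be [Aalbe gr0 ali]]] mini.
have i0le a b : A a b != 0 -> gr a b = D -> (i0 <= a m)%N.
  by move=> Aab g; apply: mini; apply/asboolP; exists a, b.
have bdi i : `[< exists a b, [/\ A a b != 0, gr a b = D & a m = i] >] -> (i <= N)%N.
  by case/asboolP => a [b [/aN lt _ <-]]; apply: ltnW.
case: (ex_maxnP exi bdi) => i1 /asboolP [a1 [b1 [A1 gr1 a1i]]] maxi.
have i1le a b : A a b != 0 -> gr a b = D -> (a m <= i1)%N.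
  by move=> Aab g; apply: maxi; apply/asboolP; exists a, b.
(* The part of A to which the induction hypothesis applies. *)
pose A' a b := if (a m == i0) && (b m == be m) then A a b else 0.
have A'al : A' al be != 0 by rewrite /A' ali !eqxx.
have A'N a b : A' a b != 0 -> (mdeg a < N)%N && (mdeg b < N)%N.
  by rewrite /A'; case: ifP => _; rewrite ?eqxx //; apply: AN.
have [r [c rc]] := IH A' al be us A'N A'al.
have A'm a b : mul_herm s A' a b != 0 -> a m = i0 /\ b m = be m.
  case/mul_herm_neq0 => m' [m's _ _]; rewrite /A'; case: ifP; last by rewrite eqxx.
  have mm' : m != m' by apply: contraNneq ms => ->.
  by rewrite !(mnm_sub_neq _ mm') => /andP [/eqP -> /eqP ->].
have rm i : r i m = i0.
  by have [j] := det_neq0_row i rc; rewrite mxE => /A'm [].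
have cm j : c j m = be m.
  by have [i'] := det_neq0_col j rc; rewrite mxE => /A'm [].
pose r1 (i : 'I_(1 + size s)) := match split i with
  inl _ => (a1 + U_(m))%MM | inr i => r i end.
pose c1 (i : 'I_(1 + size s)) := match split i with
  inl _ => (b1 + U_(m))%MM | inr i => c i end.
exists r1, c1.
(* The zero block: in its entries the degree would fall below D, or the
   z_m-exponent would leave the range from i0 to i1. *)
have UE : (\matrix_(i, j) mul_herm (m :: s) A (r1 i) (c1 j) : 'M_(1 + size s))
  = block_mx (eps m * A a1 b1)%:M
      (\row_j mul_herm (m :: s) A (a1 + U_(m))%MM (c j)) 0
      (\matrix_(i, j) mul_herm s A' (r i) (c j)).
  apply/matrixP => i j; rewrite mxE /r1 /c1.
  case: (split_ordP i) => {}i ->; case: (split_ordP j) => {}j ->.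
  - rewrite block_mxEul !mxE ?(split_lshift, split_rshift) !ord1 eqxx mulr1n.
    rewrite /mul_herm big_cons !mnmDE !mnm1E eqxx !addn1 /= !addmK.
    rewrite big_seq big1 ?addr0 // => m' m's; case: ifP => // /andP [p1 p2].
    have mm' : m != m' by apply: contraNneq ms => ->.
    apply/eqP; rewrite mulf_eq0 (negbTE (eps_neq0 _)) /=; apply: contraT => An.
    have := i1le _ _ An; rewrite /gr !(mnm_sub_neq _ mm') !mnmDE !mnm1E eqxx.
    by move: gr1 (bN _ _ A1); rewrite /gr a1i; clear; lia.
  - by rewrite block_mxEur !mxE ?(split_lshift, split_rshift).
  - rewrite block_mxEdl !mxE ?(split_lshift, split_rshift).
    apply/eqP; apply: contraT => /mul_herm_neq0 [m' [m's p1 p2 An]].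
    have i01 := i1le _ _ Aalbe gr0; rewrite ali in i01.
    have bl := bN _ _ A1; have An1 := Dle _ _ An; have An2 := bN _ _ An.
    case: (eqVneq m m') => [e|mm'].
      move: p1 An1 An2; rewrite -e /gr !mnmBE !mnmDE rm !mnm1E eqxx.
      by move: gr1; rewrite /gr a1i; clear -i01 bl; lia.
    move: An1 An2; rewrite /gr !(mnm_sub_neq _ mm') mnmDE rm mnm1E eqxx.
    by move: gr1; rewrite /gr a1i; clear -i01 bl; lia.
  - rewrite block_mxEdr !mxE ?(split_lshift, split_rshift).
    rewrite /mul_herm big_cons; set t := (X in X + _).
    have -> : t = 0.
      rewrite /t; case: ifP => // /andP [p1 p2]; apply/eqP.
      rewrite mulf_eq0 (negbTE (eps_neq0 _)) /=; apply: contraT => An.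
      have := i0le _ _ An; have := bN _ _ An; move: gr0 (bN _ _ Aalbe) p1 p2.
      by rewrite /gr !mnmBE !mnm1E eqxx rm cm ali; clear; lia.
    rewrite add0r; apply: eq_big_seq => m' m's.
    have mm' : m != m' by apply: contraNneq ms => ->.
    by rewrite /A' !(mnm_sub_neq _ mm') rm cm !eqxx.
have D1 : \det (\matrix_(i, j) mul_herm (m :: s) A (r1 i) (c1 j)
    : 'M_(1 + size s)) != 0.
  by rewrite UE det_ublock det_scalar1 mulf_neq0 // mulf_neq0.
exact: D1.
Qed.

(** Huang's lemma: a nonvanishing minor of size > k excludes a sum of k products
    u_t(Z) v_t(\bar Z).  The identity with the sum is only asked for in rows and
    columns where the multiple is nonzero, since these are the only ones that a
    nonvanishing minor meets. *)
Lemma huang_lemma k (u v : 'I_k -> X -> C) s A N : uniq s -> (k < size s)%N ->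
    (forall a b, A a b != 0 -> (mdeg a < N)%N && (mdeg b < N)%N) ->
    (forall a b a' b', mul_herm s A a b' != 0 -> mul_herm s A a' b != 0 ->
       mul_herm s A a b = \sum_t u t a * v t b) ->
  forall a b, A a b = 0.
Proof.
move=> us ks AN AE a b; apply/eqP; apply: contraT => Aab.
have [r [c rc]] := mul_herm_minor us AN Aab.
have E : \matrix_(i, j) mul_herm s A (r i) (c j) =
    (\matrix_(i, t) u t (r i)) *m (\matrix_(t, j) v t (c j)) :> 'M_(size s).
  apply/matrixP => i j; rewrite !mxE.
  have [j'] := det_neq0_row i rc; rewrite mxE => rj.
  have [i'] := det_neq0_col j rc; rewrite mxE => ci.
  by rewrite (AE _ _ _ _ rj ci); apply: eq_bigr => t _; rewrite !mxE.
have : \matrix_(i, j) mul_herm s A (r i) (c j) \in unitmx by rewrite unitmxE unitfE.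
rewrite E -row_full_unit /row_full => /eqP rk.
have := leq_trans (mxrankM_maxl _ _) (rank_leq_col (\matrix_(i, t) u t (r i))).
by move=> /(_ _ (\matrix_(t, j) v t (c j))); rewrite rk leqNgt ks.
Qed.

End RankOfMultiples.

(** * Rigidity of pairs of equations *)

Section Form.
Variables (C : numClosedFieldType) (n l d : nat).

(** The diagonal coefficients of the form with l negative squares. *)
Definition eps (j : 'I_n) : C := (-1) ^+ (j < l)%N.

Lemma eps_neq0 j : eps j != 0. Proof. by rewrite signr_eq0. Qed.

Lemma eps_conj j : (eps j)^* = eps j.
Proof. by rewrite /eps rmorph_sign. Qed.

Lemma form_lE (A : comNzRingType) (phi : {rmorphism C -> A}) (a b : 'I_n -> A) :
  form_l l a b = \sum_j phi (eps j) * (a j * b j).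
Proof.
rewrite /form_l [RHS](bigID (fun j : 'I_n => (j < l)%N)) /= -sumrN; congr (_ + _).
  by apply: eq_bigr => j jl; rewrite /eps jl expr1 rmorphN1 mulN1r.
apply: eq_big => j; first by rewrite leqNgt.
by move=> jl; rewrite /eps ltnNge jl expr0 rmorph1 mul1r.
Qed.

(** The equation Im w - <z, \bar z>_l of the hyperquadric made homogeneous: the
    additional coordinate e takes the place of the constant 1. *)
Definition herm_form (e : fps C d) (f : 'I_n -> fps C d) (g : fps C d) :
    fps C (d + d) :=
  fconst _ (2 * 'i)^-1 * (lft g * rgt (fconj e) - lft e * rgt (fconj g))
  - \sum_j fconst _ (eps j) * (lft (f j) * rgt (fconj (f j))).

Definition norm2 k (p : 'I_k -> fps C d) : fps C (d + d) :=
  \sum_t lft (p t) * rgt (fconj (p t)).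

Lemma ker_herm_form e f g a b : ker (herm_form e f g) a b =
  (2 * 'i)^-1 * (g a * (e b)^* - e a * (g b)^*)
  - \sum_j eps j * (f j a * (f j b)^*).
Proof.
rewrite kerB ker_constM kerB !ker_lr ker_sum; congr (_ - _).
by apply: eq_bigr => j _; rewrite ker_constM ker_lr.
Qed.

Lemma ker_norm2 k (p : 'I_k -> fps C d) a b :
  ker (norm2 p) a b = \sum_t p t a * (p t b)^*.
Proof. by rewrite ker_sum; apply: eq_bigr => t _; rewrite ker_lr. Qed.

End Form.

Section Rigidity.
Variables (C : numClosedFieldType) (n l k1 k2 : nat).
Local Notation d := n.+1.
Variables (e g : fps C d) (f : 'I_n -> fps C d).
Variables (phi : 'I_k1 -> fps C d) (psi : 'I_k2 -> fps C d).
Variables (s1 s2 : C) (a : fps C (d + d)).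
Local Notation z j := (fvar C (@zi n j)).
Local Notation w := (fvar C (wi n)).
Local Notation eps := (@eps C n l).
Local Notation X := 'X_{1..d}.

Hypothesis e1 : vanish mdeg 2 (e - 1).
Hypothesis f1 : forall j, vanish mdeg 2 (f j - z j).
Hypothesis gE : g = w.
Hypothesis phi1 : forall t, vanish mdeg 2 (phi t).
Hypothesis psi1 : forall t, vanish mdeg 2 (psi t).

Let Q1 := herm_form l 1 (fun j => z j) w - fconst _ s1 * norm2 phi.
Let Q2 := herm_form l e f g - fconst _ s2 * norm2 psi.
Hypothesis Q21 : Q2 = a * Q1.

Let D := a - 1.
Let K := Q2 - Q1.

Let KE : K = D * Q1.
Proof. by rewrite /K /D Q21 mulrBl mul1r. Qed.

Lemma zi_neq_wi m (j : 'I_m) : (zi j == wi m) = false.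
Proof. by apply/eqP => /eqP; rewrite eq_sym (negbTE (neq_lift _ _)). Qed.

Lemma zi_inj m : injective (@zi m). Proof. exact: lift_inj. Qed.

Let low (h h' : fps C d) m : vanish mdeg 2 (h - h') -> (mdeg m < 2)%N -> h m = h' m.
Proof. by move=> hh m2; apply: (eqmodE hh). Qed.

Let z0 j : z j 0%MM = 0. Proof. by rewrite coef_fvar eq_sym mnm1_neq0. Qed.
Let w0 : w 0%MM = 0. Proof. by rewrite coef_fvar eq_sym mnm1_neq0. Qed.
Let e0 : e 0%MM = 1. Proof. by rewrite (low e1) ?mdeg0 // coef1 eqxx. Qed.
Let f0 j : f j 0%MM = 0. Proof. by rewrite (low (f1 j)) ?mdeg0. Qed.
Let g0 : g 0%MM = 0. Proof. by rewrite gE w0. Qed.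

Let zU i (j : 'I_n) : z j U_(i)%MM = (i == zi j)%:R.
Proof. by rewrite coef_fvar mnm1_inj. Qed.
Let wU i : w U_(i)%MM = (i == wi n)%:R.
Proof. by rewrite coef_fvar mnm1_inj. Qed.

Let kerK x y : ker K x y =
  (2 * 'i)^-1 * (g x * (e y)^* - e x * (g y)^*
    - (w x * ((1 : fps C d) y)^* - (1 : fps C d) x * (w y)^*))
  - \sum_j eps j * (f j x * (f j y)^* - z j x * (z j y)^*)
  - (s2 * (\sum_t psi t x * (psi t y)^*) - s1 * \sum_t phi t x * (phi t y)^*).
Proof.
rewrite /K kerB /Q2 /Q1 2!(kerB (herm_form _ _ _ _)) !ker_herm_form !ker_constM !ker_norm2.
under [in RHS]eq_bigr => j _ do rewrite mulrBr.
rewrite sumrB; ring.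
Qed.

Let i2_neq0 : (2 * 'i : C)^-1 != 0.
Proof. by rewrite invr_eq0 mulf_neq0 ?neq0Ci ?pnatr_eq0. Qed.


Let varI (i : 'I_d) (h : fps C d) : fvar C i * h = 0 -> h = 0.
Proof.
move=> wh; apply: fpsP => x; have := congr1 (fun f : fps C d => f (U_(i) + x)%MM) wh.
by rewrite /= coef_varM mnmDE mnm1E eqxx /= addmC addmK.
Qed.

Let ker_K_l x : ker K x 0%MM = 0.
Proof.
rewrite kerK e0 gE w0 !coef1 eqxx rmorph0 rmorph1 !mulr1 !mulr0 !subrr mulr0.
rewrite [X in _ - X - _]big1 ?[in X in s2 * X]big1 ?[in X in s1 * X]big1.
- by rewrite !mulr0 !subr0.
- by move=> t _; rewrite [phi t 0%MM]phi1 ?mdeg0 // rmorph0 mulr0.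
- by move=> t _; rewrite [psi t 0%MM]psi1 ?mdeg0 // rmorph0 mulr0.
- by move=> j _; rewrite f0 z0 rmorph0 !mulr0 subrr mulr0.
Qed.

Let ker_K_r x : ker K 0%MM x = 0.
Proof.
rewrite kerK e0 gE w0 !coef1 eqxx !mul0r !mul1r !subrr mulr0.
rewrite [X in _ - X - _]big1 ?[in X in s2 * X]big1 ?[in X in s1 * X]big1.
- by rewrite !mulr0 !subr0.
- by move=> t _; rewrite [phi t 0%MM]phi1 ?mdeg0 // mul0r.
- by move=> t _; rewrite [psi t 0%MM]psi1 ?mdeg0 // mul0r.
- by move=> j _; rewrite f0 z0 !mul0r subrr mulr0.
Qed.

Let fl_Q1 : fl Q1 = fconst _ (2 * 'i)^-1 * w.
Proof.
apply: fpsP => x; rewrite /fl /Q1 kerB ker_herm_form ker_constM ker_norm2.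
rewrite w0 !coef1 eqxx rmorph0 rmorph1 mulr1 mulr0 subr0 coef_constM.
rewrite big1 ?[in X in s1 * X]big1 ?mulr0 ?subr0 //.
  by move=> t _; rewrite [phi t 0%MM]phi1 ?mdeg0 // rmorph0 mulr0.
by move=> j _; rewrite z0 rmorph0 !mulr0.
Qed.

Let fr_Q1 : fr Q1 = fconst _ (- (2 * 'i)^-1) * w.
Proof.
apply: fpsP => x; rewrite /fr /Q1 kerB ker_herm_form ker_constM ker_norm2.
rewrite w0 !coef1 eqxx mul0r mul1r sub0r coef_constM mulrN -mulNr.
rewrite [w x]coef_fvar rmorph_nat.
rewrite big1 ?[in X in s1 * X]big1 ?mulr0 ?subr0 //.
  by move=> t _; rewrite [phi t 0%MM]phi1 ?mdeg0 // mul0r.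
by move=> j _; rewrite z0 !mul0r mulr0.
Qed.

Let constI (c : C) (h : fps C d) : c != 0 -> fconst d c * h = 0 -> h = 0.
Proof.
move=> c0 ch; apply: fpsP => x; apply: (mulfI c0); rewrite -coef_constM ch.
by rewrite !coef0 mulr0.
Qed.

(** As e, f, phi and psi have the constant terms of 1, z, 0 and 0, and g = w,
    the difference K vanishes for \bar Z = 0, where Q1 is a multiple of w; hence
    D = a - 1 vanishes there. *)
Let D_l m : ker D m 0%MM = 0.
Proof.
have : fl D * fl Q1 = 0 by rewrite -flM -KE; apply: fpsP => x; apply: ker_K_l.
rewrite fl_Q1 mulrCA => /(constI i2_neq0); rewrite mulrC => /varI D0.
exact: (congr1 (fun f : fps C d => f m) D0).
Qed.

Let D_r m : ker D 0%MM m = 0.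
Proof.
have : fr D * fr Q1 = 0 by rewrite -frM -KE; apply: fpsP => x; apply: ker_K_r.
rewrite fr_Q1 mulrCA => /constI; rewrite oppr_eq0 => /(_ i2_neq0).
rewrite mulrC => /varI D0.
exact: (congr1 (fun f : fps C d => f m) D0).
Qed.

(** Up to sign, the row of K = Q2 - Q1 at the monomial z_j consists of the
    conjugates of the coefficients of f_j - z_j: in the products of K no other
    factor in Z has a coefficient at z_j. *)
Let f_coef j y : ker K U_(zi j)%MM y = 0 -> f j y = z j y.
Proof.
have lin u : (mdeg (U_(u)%MM : X) < 2)%N by rewrite mdeg1.
rewrite kerK gE (low e1 (lin _)) wU zi_neq_wi !coef1 mnm1_neq0 !mul0r !subrr mulr0.
rewrite ?[in X in s2 * X]big1 ?[in X in s1 * X]big1; last 2 first.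
- by move=> t _; rewrite phi1 // mul0r.
- by move=> t _; rewrite psi1 // mul0r.
rewrite (bigD1 j) //= big1 => [|i ij].
  rewrite (low (f1 j) (lin _)) zU eqxx !mul1r !mulr0 !addr0 subrr subr0 sub0r.
  move=> /eqP; rewrite oppr_eq0 mulf_eq0 (negbTE (eps_neq0 C l j)) /=.
  by rewrite subr_eq0 => /eqP /(congr1 Num.conj); rewrite !conjCK.
rewrite (low (f1 i) (lin _)) zU (inj_eq (@zi_inj n)) eq_sym (negbTE ij).
by rewrite !mul0r subrr mulr0.
Qed.

Let zdeg (x : X) : nat := (\sum_(j < n) x (zi j))%N.
(** The weights are 1 for z and 3 for w: with any weight of w above 2 the
    initial part of the equation Q1 is - <z, \bar z>, since norm2 phi has weight
    at least 4. *)
Let wt (x : X) : nat := (zdeg x + 3 * x (wi n))%N.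
Let om (m : 'X_{1..d + d}) : nat := (wt (mleft m) + wt (mright m))%N.

Let zdegD x y : zdeg (x + y)%MM = (zdeg x + zdeg y)%N.
Proof. by rewrite /zdeg -big_split; apply: eq_bigr => j _; rewrite mnmDE. Qed.

Let wtD x y : wt (x + y)%MM = (wt x + wt y)%N.
Proof. by rewrite /wt zdegD mnmDE; lia. Qed.

Let om_join x y : om (mjoin x y) = (wt x + wt y)%N.
Proof. by rewrite /om mjoin_left mjoin_right. Qed.

Let omD : {morph om : x y / (x + y)%MM >-> (x + y)%N}.
Proof.
move=> x y; rewrite -[x]mjoinK -[y]mjoinK mjoinD !om_join !wtD.
by rewrite addnACA.
Qed.

Let wt_mdeg (x : X) : (mdeg x <= wt x)%N.
Proof.
have -> : mdeg x = (zdeg x + x (wi n))%N.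
  rewrite mdegE big_ord_recr /=; congr (_ + _)%N; apply: eq_bigr => j _.
  by congr (x _); apply: val_inj; rewrite /= /bump leqNgt ltn_ord.
by rewrite /wt leq_add2l leq_pmull.
Qed.

Let zdegU j : zdeg U_(zi j)%MM = 1%N.
Proof.
rewrite /zdeg (bigD1 j) //= mnm1E eqxx big1 // => i ij.
by rewrite mnm1E (inj_eq (@zi_inj n)) eq_sym (negbTE ij).
Qed.

Let wtU j : wt U_(zi j)%MM = 1%N.
Proof. by rewrite /wt zdegU mnm1E zi_neq_wi. Qed.

Let s := [seq @zi n j | j <- enum 'I_n].
Let s_uniq : uniq s. Proof. by rewrite map_inj_uniq ?enum_uniq //; apply: zi_inj. Qed.
Let s_size : size s = n. Proof. by rewrite size_map size_enum_ord. Qed.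

Let epsX (i : 'I_d) : C := if unlift ord_max i is Some j then eps j else 1.
Let epsX_zi j : epsX (zi j) = eps j. Proof. by rewrite /epsX liftK. Qed.
Let epsX_neq0 i : epsX i != 0.
Proof. by rewrite /epsX; case: unlift => [j|]; rewrite ?oner_eq0 ?eps_neq0. Qed.

Let S : fps C (d + d) := \sum_j fconst _ (eps j) * (lft (z j) * rgt (z j)).

Let ker_varM (u : 'I_d) (k : fps C (d + d)) x y :
  ker (lft (fvar C u) * rgt (fvar C u) * k) x y =
  if (0 < x u)%N && (0 < y u)%N then ker k (x - U_(u))%MM (y - U_(u))%MM else 0.
Proof.
rewrite lft_var rgt_var -mulrA /ker coef_varM mjoinl.
case: ifP => x0 //=; rewrite coef_varM mjoinUl mjoinUr !mjoinB mjoinr.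
by rewrite !mnmBE mnm0E subn0; case: ifP => // y0; congr (k (mjoin _ _));
  apply/mnmP => v; rewrite !mnmBE mnm0E subn0.
Qed.

Let ker_S k x y : ker (S * k) x y = mul_herm epsX s (ker k) x y.
Proof.
rewrite /mul_herm big_map big_enum /= mulr_suml ker_sum; apply: eq_bigr => j _.
by rewrite -mulrA ker_constM ker_varM epsX_zi; case: ifP; rewrite ?mulr0.
Qed.

Let R := fconst _ (2 * 'i)^-1 * (lft w - rgt w) - fconst _ s1 * norm2 phi.

(** R collects the terms of Q1 of weight at least 3. *)
Let Q1E : Q1 = R - S.
Proof.
rewrite /Q1 /R /herm_form !rmorph1 mul1r mulr1 fconj_var addrAC; congr (_ - _).
by apply: eq_bigr => j _; rewrite fconj_var.
Qed.

Let vanish_l k (h : fps C d) : vanish wt k h -> vanish om k (lft h).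
Proof.
move=> hk m; rewrite -[m]mjoinK om_join => mk.
by rewrite -[LHS]/(ker _ _ _) ker_l hk ?mul0r //; apply: leq_ltn_trans mk; apply: leq_addr.
Qed.

Let vanish_r k (h : fps C d) : vanish wt k h -> vanish om k (rgt h).
Proof.
move=> hk m; rewrite -[m]mjoinK om_join => mk.
by rewrite -[LHS]/(ker _ _ _) ker_r hk ?mulr0 //; apply: leq_ltn_trans mk; apply: leq_addl.
Qed.

Let vanish_w : vanish wt 3 w.
Proof.
move=> m; rewrite coef_fvar; case: eqP => // ->.
by rewrite /wt mnm1E eqxx addnC.
Qed.

Let vanish_R : vanish om 3 R.
Proof.
apply: vanishB.
  by apply: vanishMl => //; apply: vanishB; [apply: vanish_l|apply: vanish_r].
apply: vanishMl => //; apply: vanish_sum => t _.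
have pt : vanish wt 2 (phi t).
  by move=> m m2; apply: phi1; apply: leq_ltn_trans m2.
apply: (vanish_le (k := 4)) => //; apply: (@vanishM _ _ om 2 2) => //.
  exact: vanish_l.
by apply: vanish_r; apply: fconj_vanish.
Qed.

Let vanish_S : vanish om 2 S.
Proof.
apply: vanish_sum => j _; apply: vanishMl => //.
have zj : vanish wt 1 (z j).
  by move=> m; rewrite coef_fvar; case: eqP => // ->; rewrite wtU.
by apply: (@vanishM _ _ om 1 1) => //; [apply: vanish_l|apply: vanish_r].
Qed.

(** Suppose a - 1 is nonzero and let A be a bihomogeneous component (in z, w and
    their conjugates) of its part of least weight.  Then A <z, \bar z> is a
    component of Q1 - Q2.  In lower weight Q2 - Q1 vanishes, which identifies
    the coefficients of f with those of z as far as they could enter, and the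
    components of A have positive degree in both Z and \bar Z.  So only
    products of phi and of psi remain, and their number k1 + k2 < n is too
    small for a multiple of <z, \bar z>. *)
Lemma factor_eq1 : (k1 + k2 < n)%N -> D = 0.
Proof.
move=> kn; apply: contrapT => D0.
have exm : exists k, `[< exists m, D m != 0 /\ om m = k >].
  have [m Dm] : exists m, D m != 0.
    apply: contrapT => no; apply: D0; apply: fpsP => m.
    by apply/eqP; apply: contraT => Dm; case: no; exists m.
  by exists (om m); apply/asboolP; exists m.
case: (ex_minnP exm) => Om /asboolP [m0 [Dm0 omm0]] minO.
have DO : vanish om Om D.
  move=> m mO; apply/eqP; apply: contraTT mO => Dm; rewrite -leqNgt.
  by apply: minO; apply/asboolP; exists m.
(* Om is the least weight in a - 1: in weight Om + 2 the product (a - 1) Q1 is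
   minus the product of a - 1 with S = <z, \bar z>. *)
have KS x y : (wt x + wt y < Om.+3)%N -> ker K x y = - mul_herm epsX s (ker D) x y.
  move=> xy; rewrite KE Q1E mulrBr kerB (mulrC D S) ker_S.
  rewrite /ker [(D * R) _](vanishM omD DO vanish_R) ?sub0r //.
  by rewrite om_join addn3.
have K0 x y : (wt x + wt y < Om.+2)%N -> ker K x y = 0.
  move=> xy; rewrite KS; last exact: leq_trans xy _.
  rewrite -ker_S /ker (mulrC S D) (vanishM omD DO vanish_S) ?oppr0 //.
  by rewrite om_join addn2.
have fz j y : (wt y < Om.+1)%N -> f j y = z j y.
  by move=> yO; apply: f_coef; apply: K0; rewrite wtU add1n.
pose a0 := mleft m0; pose b0 := mright m0.
have D00 : ker D a0 b0 != 0 by rewrite /ker mjoinK.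
have wt0 x : (wt x == 0%N) = (x == 0%MM).
  apply/eqP/eqP => [x0|->]; last by rewrite /wt mnm0E /zdeg big1 // => j _; rewrite mnm0E.
  by apply/eqP; rewrite -mdeg_eq0 -leqn0 -x0 wt_mdeg.
have a0_gt0 : (0 < wt a0)%N.
  by rewrite lt0n wt0; apply: contraNneq D00 => ->; rewrite D_r.
have b0_gt0 : (0 < wt b0)%N.
  by rewrite lt0n wt0; apply: contraNneq D00 => ->; rewrite D_l.
have OmE : (wt a0 + wt b0 = Om)%N by rewrite -omm0.
(* The component of bidegree (zdeg, degree in w) that contains (a0, b0). *)
pose A x y := if [&& zdeg x == zdeg a0, x (wi n) == a0 (wi n),
  zdeg y == zdeg b0 & y (wi n) == b0 (wi n)] then ker D x y else 0.
pose u (t : 'I_(k1 + k2)) x := match split t with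
  inl t => - (s1 * phi t x) | inr t => s2 * psi t x end.
pose v (t : 'I_(k1 + k2)) y := match split t with
  inl t => (phi t y)^* | inr t => (psi t y)^* end.
(* Nonzero entries of A <z, \bar z> lie in one bidegree. *)
have row x y : mul_herm epsX s A x y != 0 ->
  [/\ zdeg x = (zdeg a0).+1, x (wi n) = a0 (wi n),
      zdeg y = (zdeg b0).+1 & y (wi n) = b0 (wi n)].
  case/mul_herm_neq0 => m [/mapP [j _ ->]] x0 y0; rewrite /A; case: ifP; last by rewrite eqxx.
  have dec (x1 : X) : (0 < x1 (zi j))%N ->
      zdeg x1 = (zdeg (x1 - U_(zi j))%MM).+1 /\ (x1 - U_(zi j))%MM (wi n) = x1 (wi n).
    move=> p; split; last by rewrite mnmBE mnm1E zi_neq_wi subn0.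
    rewrite -addn1 -(zdegU j) -zdegD submK //.
    by apply/mnm_lepP => i; rewrite mnm1E; case: eqP => // <-.
  have [-> ->] := dec _ x0; have [-> ->] := dec _ y0.
  by case/and4P => /eqP -> /eqP -> /eqP -> /eqP ->.
suff A0 : A a0 b0 = 0 by move: A0 D00; rewrite /A !eqxx /= => ->; rewrite eqxx.
apply: (@huang_lemma C d epsX epsX_neq0 (k1 + k2) u v s A Om.+1 s_uniq); first by rewrite s_size.
  move=> x y; rewrite /A; case: ifP; last by rewrite eqxx.
  case/and4P => /eqP zx /eqP wx /eqP zy /eqP wy _.
  rewrite !ltnS !(leq_trans (wt_mdeg _)) // -OmE /wt.
    by rewrite zy wy leq_addl.
  by rewrite zx wx leq_addr.
move=> x y x' y' /row [zx wx _ _] /row [_ _ zy wy].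
have wtx : wt x = (wt a0).+1 by rewrite /wt zx wx addSn.
have wty : wt y = (wt b0).+1 by rewrite /wt zy wy addSn.
have -> : mul_herm epsX s A x y = mul_herm epsX s (ker D) x y.
  apply: eq_big_seq => m /mapP [j _ ->]; case: ifP => // /andP [x0 y0].
  have zd (x1 : X) k : (0 < x1 (zi j))%N -> zdeg x1 = k.+1 -> zdeg (x1 - U_(zi j))%MM = k.
    move=> p zx1; have := zdegD (x1 - U_(zi j))%MM U_(zi j)%MM.
    rewrite submK ?zdegU ?zx1 ?addn1; first by case.
    by apply/mnm_lepP => i; rewrite mnm1E; case: eqP => // <-.
  have wd (x1 : X) : (x1 - U_(zi j))%MM (wi n) = x1 (wi n).
    by rewrite mnmBE mnm1E zi_neq_wi subn0.
  by rewrite /A (zd _ _ x0 zx) (zd _ _ y0 zy) !wd wx wy !eqxx.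
have nw (x1 : X) k : zdeg x1 = k.+1 -> w x1 = 0.
  rewrite coef_fvar; case: eqP => // ->; rewrite /zdeg big1 // => j _.
  by rewrite mnm1E eq_sym zi_neq_wi.
have n1 (x1 : X) k : zdeg x1 = k.+1 -> (1 : fps C d) x1 = 0.
  by rewrite coef1; case: eqP => // ->; rewrite /zdeg big1 // => j _; rewrite mnm0E.
(* wt x = wt a0 + 1 is at most Om because wt b0 is positive. *)
have fx j : f j x = z j x by apply: fz; rewrite wtx; lia.
have fy j : f j y = z j y by apply: fz; rewrite wty; lia.
rewrite -[LHS]opprK -KS; last by rewrite wtx wty; lia.
rewrite kerK gE (nw _ _ zx) (nw _ _ zy) (n1 _ _ zx) rmorph0 !(mul0r, mulr0) !subrr mulr0.
rewrite big1 => [|j _]; last by rewrite fx fy subrr mulr0.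
rewrite subrr sub0r opprK big_split_ord /= addrC !mulr_sumr -sumrN; congr (_ + _).
  by apply: eq_bigr => t _; rewrite /u /v !split_rshift mulrA.
by apply: eq_bigr => t _; rewrite /u /v !split_lshift; ring.
Qed.

(** Once a = 1 all of Q2 - Q1 vanishes: its rows at z_j and at w identify f and
    e, and what is left compares the squares of phi and of psi. *)
Lemma rigidity : (k1 + k2 < n)%N ->
  [/\ e = 1, forall j, f j = z j &
      forall x y, s2 * (\sum_t psi t x * (psi t y)^*) =
                  s1 * \sum_t phi t x * (phi t y)^*].
Proof.
move=> /factor_eq1 D0.
have K0 x y : ker K x y = 0 by rewrite KE D0 mul0r.
have fE j : f j = z j by apply: fpsP => y; apply: f_coef.
have eE : e = 1.
  have lin u : (mdeg (U_(u)%MM : X) < 2)%N by rewrite mdeg1.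
  apply: fpsP => y; have := K0 U_(wi n)%MM y.
  rewrite kerK gE (low e1 (lin _)) wU eqxx [(1 : fps C d) U_(_)%MM]coef1 mnm1_neq0.
  rewrite !mul0r !mul1r !subr0.
  rewrite [X in _ - X - _]big1 => [|j _]; last by rewrite fE subrr mulr0.
  rewrite ?[in X in s2 * X]big1 ?[in X in s1 * X]big1; last 2 first.
  - by move=> t _; rewrite phi1 // mul0r.
  - by move=> t _; rewrite psi1 // mul0r.
  rewrite !mulr0 !subr0 => /eqP; rewrite mulf_eq0 (negbTE i2_neq0) /= subr_eq0.
  by move=> /eqP /(congr1 Num.conj); rewrite !conjCK.
split=> // x y; have := K0 x y.
rewrite kerK eE gE subrr mulr0 big1 => [|j _]; last by rewrite fE subrr mulr0.
by rewrite subrr sub0r => /eqP; rewrite oppr_eq0 subr_eq0 => /eqP.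
Qed.

End Rigidity.

(** * Hermitian linear algebra *)

Section HermitianMatrices.
Variable C : numClosedFieldType.
Local Open Scope sesquilinear_scope.

Lemma adj_mul m n p (A : 'M[C]_(m, n)) (B : 'M_(n, p)) :
  (A *m B)^t* = B^t* *m A^t*.
Proof. by rewrite trmx_mul map_mxM. Qed.

Lemma adj_inj m n : injective (fun A : 'M[C]_(m, n) => A^t*).
Proof. by move=> A B /(congr1 (fun M => M^t*)); rewrite !trmxCK. Qed.

Lemma adj1 n : (1%:M : 'M[C]_n)^t* = 1%:M.
Proof. by rewrite trmx1 map_mx1. Qed.

Lemma dot_ge0 n (x : 'rV[C]_n) : 0 <= (x *m x^t*) 0 0.
Proof.
rewrite mxE; apply: sumr_ge0 => j _.
by rewrite !mxE mul_conjC_ge0.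
Qed.

Lemma dot_eq0 n (x : 'rV[C]_n) : (x *m x^t*) 0 0 = 0 -> x = 0.
Proof.
rewrite mxE => /psumr_eq0P x0; apply/rowP => j.
have := x0 _ j isT; rewrite !mxE => x0'.
apply/eqP; rewrite -mul_conjC_eq0; apply/eqP; apply: x0' => i' _.
by rewrite !mxE mul_conjC_ge0.
Qed.

(** Diagonalize by a unitary matrix and divide by the square roots of the
    eigenvalues. *)
Lemma posdef_normalize k (D : 'M[C]_k) : D^t* = D ->
    (forall x : 'rV_k, x != 0 -> 0 < (x *m D *m x^t*) 0 0) ->
  exists R : 'M_k, R *m D *m R^t* = 1%:M.
Proof.
move=> Dh Dp; have Dn : D \is normalmx by apply/normalmxP; rewrite Dh.
pose P := spectralmx D; pose sp := spectral_diag D.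
have Pu : P \is unitarymx := spectral_unitarymx D.
have DE : D = P^t* *m diag_mx sp *m P.
  by rewrite -(invmx_unitary Pu); apply/orthomx_spectralP.
have PP : P *m P^t* = 1%:M by apply/unitarymxP.
have PDP : P *m D *m P^t* = diag_mx sp.
  by rewrite DE !mulmxA PP mul1mx -mulmxA PP mulmx1.
have sp0 i : 0 < sp 0 i.
  pose x : 'rV[C]_k := delta_mx 0 i.
  have E : (x *m diag_mx sp *m x^t*) 0 0 = sp 0 i.
    rewrite -rowE mxE (bigD1 i) //= !mxE !eqxx rmorph1 mulr1n mulr1.
    by rewrite big1 ?addr0 // => j ji; rewrite !mxE (negbTE ji) andbF rmorph0 mulr0.
  rewrite -E -PDP !mulmxA -[_ *m P^t* *m _]mulmxA -adj_mul; apply: Dp.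
  apply/negP => /eqP /(congr1 (fun M => M *m P^t*)).
  rewrite -mulmxA PP mulmx1 mul0mx => /matrixP /(_ 0 i) /eqP.
  by rewrite !mxE !eqxx oner_eq0.
pose r : 'rV_k := \row_i (sqrtC (sp 0 i))^-1.
have sq i : (sqrtC (sp 0 i))^* = sqrtC (sp 0 i).
  by apply/CrealP; apply: ger0_real; rewrite sqrtC_ge0 ltW.
exists (diag_mx r *m P); rewrite adj_mul !mulmxA.
rewrite -(mulmxA (diag_mx r)) -(mulmxA (diag_mx r)) PDP.
rewrite tr_diag_mx map_diag_mx !mulmx_diag.
apply/matrixP => i j; rewrite !mxE; case: eqP => // _; rewrite !mulr1n.
rewrite fmorphV /= sq mulrAC -invfM -expr2 sqrtCK mulVf //.
by rewrite gt_eqF.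
Qed.

Lemma adj_opp m n (A : 'M[C]_(m, n)) : (- A)^t* = - A^t*.
Proof. by apply/matrixP => i j; rewrite !mxE rmorphN. Qed.

Lemma adj_form_eq0 p q m (J : 'M[C]_m) (A : 'M_(p, m)) (B : 'M_(q, m)) :
  J^t* = J -> A *m J *m B^t* = 0 -> B *m J *m A^t* = 0.
Proof.
move=> Jh AB; apply: adj_inj.
by rewrite /= !adj_mul trmxCK Jh mulmxA AB trmx0 map_mx0.
Qed.

Lemma form_orth_add p q r m (J : 'M[C]_m) (A : 'M_(p, m)) (B : 'M_(q, m))
    (a : 'M_(r, p)) (b : 'M_(r, q)) : J^t* = J -> A *m J *m B^t* = 0 ->
  (a *m A + b *m B) *m J *m (a *m A + b *m B)^t* =
  a *m A *m J *m (a *m A)^t* + b *m (B *m J *m B^t*) *m b^t*.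
Proof.
move=> Jh AB; have BA := adj_form_eq0 Jh AB.
have -> : (a *m A + b *m B)^t* = A^t* *m a^t* + B^t* *m b^t*.
  by rewrite -!adj_mul linearD /= map_mxD.
rewrite !mulmxDl !mulmxDr.
have -> : a *m A *m J *m (B^t* *m b^t*) = a *m (A *m J *m B^t*) *m b^t*.
  by rewrite !mulmxA.
have -> : b *m B *m J *m (A^t* *m a^t*) = b *m (B *m J *m A^t*) *m a^t*.
  by rewrite !mulmxA.
by rewrite AB BA !mulmx0 !mul0mx addr0 add0r adj_mul !mulmxA.
Qed.

(** The orthogonal of a nondegenerate family W of p vectors has dimension k; the
    form being definite there, a basis of it can be normalized. *)
Lemma negative_complement p k (J : 'M[C]_(p + k)) (W : 'M_(p, p + k)) :
    J^t* = J -> W *m J *m W^t* \in unitmx ->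
    (forall x : 'rV_(p + k), x *m J *m W^t* = 0 -> x != 0 ->
       (x *m J *m x^t*) 0 0 < 0) ->
  exists K : 'M_(k, p + k),
    K *m J *m W^t* = 0 /\ K *m J *m K^t* = - 1%:M.
Proof.
move=> Jh Gu neg; pose N := J *m W^t*.
have rN : \rank N = p.
  apply/eqP; rewrite eqn_leq rank_leq_col /=.
  rewrite -[X in (X <= _)%N](mxrank_unit Gu) -mulmxA.
  exact: mxrankM_maxr.
have rk : \rank (kermx N) = k by rewrite mxrank_ker rN addKn.
pose K0 : 'M_(k, p + k) := castmx (rk, erefl) (row_base (kermx N)).
have K0free : row_free K0 by rewrite row_free_castmx row_base_free.
have K0N : K0 *m N = 0.
  apply/sub_kermxP; rewrite /K0 eqmx_cast eq_row_base.
  exact: submx_refl.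
pose D := - (K0 *m J *m K0^t*).
have [||R RD] := @posdef_normalize k D.
- by rewrite /D adj_opp !adj_mul trmxCK Jh mulmxA.
- move=> x x0; rewrite /D mulmxN mulNmx mxE oppr_gt0 !mulmxA -[_ *m _ *m x^t*]mulmxA -adj_mul.
  apply: neg; first by rewrite -!mulmxA -/N K0N mulmx0.
  by rewrite mulmx_free_eq0.
exists (R *m K0); split; first by rewrite -!mulmxA -/N K0N mulmx0.
apply: oppr_inj; rewrite opprK -RD /D mulmxN mulNmx adj_mul !mulmxA.
by [].
Qed.

(** W and the normalized basis K of its orthogonal are independent, as their
    joint Gram matrix is invertible. *)
Lemma complete_basis p k (J : 'M[C]_(p + k)) (W : 'M_(p, p + k)) :
    J^t* = J -> W *m J *m W^t* \in unitmx ->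
    (forall x : 'rV_(p + k), x *m J *m W^t* = 0 -> x != 0 ->
       (x *m J *m x^t*) 0 0 < 0) ->
  exists K : 'M_(k, p + k), col_mx W K \in unitmx /\
    col_mx W K *m J *m (col_mx W K)^t* = block_mx (W *m J *m W^t*) 0 0 (- 1%:M).
Proof.
move=> Jh Gu neg; have [K [KW KK]] := negative_complement Jh Gu neg.
have WK : W *m J *m K^t* = 0 by apply: adj_form_eq0.
have E : col_mx W K *m J *m (col_mx W K)^t* = block_mx (W *m J *m W^t*) 0 0 (- 1%:M).
  by rewrite tr_col_mx map_row_mx mul_col_mx mul_col_row WK KW KK.
exists K; split=> //.
have : col_mx W K *m (J *m (col_mx W K)^t*) \in unitmx.
  rewrite mulmxA E unitmxE det_ublock unitrM -unitmxE Gu /=.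
  by rewrite -scaleN1r detZ det1 mulr1 unitrX ?unitrN1.
by rewrite unitmx_mul => /andP [].
Qed.

(** A linear relation between the x_a means that a combination has norm 0, which
    is read off the Gram matrix; so it holds between the y_a as well.  It is
    therefore enough to map a maximal independent subfamily X of x to the
    corresponding subfamily Y of y.  The same matrix R orthonormalizes both, and
    both orthonormal families are completed to orthonormal bases. *)
Lemma unitary_extension (I : Type) k (x y : I -> 'rV[C]_k) :
    (forall a b, x a *m (x b)^t* = y a *m (y b)^t*) ->
  exists2 U : 'M_k, U *m U^t* = 1%:M & forall a, y a = x a *m U.
Proof.
move=> xy.
pose P r := `[< exists f : 'I_r -> I, row_free (\matrix_(i < r) x (f i)) >].
have exP : exists r, P r.
  exists 0%N; apply/asboolP.
  have f : 'I_0 -> I by case.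
  by exists f; rewrite /row_free; apply/eqP; apply/eqP; rewrite -leqn0 rank_leq_row.
have bP r : P r -> (r <= k)%N.
  by case/asboolP => f /eqP <-; apply: rank_leq_col.
case: (ex_maxnP exP bP) => r /asboolP [f ff] maxr.
pose X := \matrix_(i < r) x (f i); pose Y := \matrix_(i < r) y (f i).
have gram : X *m X^t* = Y *m Y^t*.
  apply/matrixP => i j; have /matrixP /(_ 0 0) := xy (f i) (f j).
  rewrite !mxE => E; rewrite (eq_bigr (fun t => x (f i) 0 t * (x (f j))^t* t 0)).
    by rewrite E; apply: eq_bigr => t _; rewrite !mxE.
  by move=> t _; rewrite !mxE.
have spanX a : exists c : 'rV_r, x a = c *m X.
  apply/submxP; apply: contraT => xa.
  suff : P r.+1 by move/maxr; rewrite ltnn.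
  apply/asboolP; exists (fun i : 'I_(1 + r) => if split i is inr j then f j else a).
  have -> : \matrix_i x (if split i is inr j then f j else a) = col_mx (x a) X.
    apply/row_matrixP => i; rewrite rowK; case: (split_ordP i) => j ->.
      by rewrite rowKu !ord1 row_id.
    by rewrite rowKd rowK.
  apply: (@inj_row_free _ (1 + r)) => v; rewrite -[v]hsubmxK mul_row_col => v0.
  have l0 : lsubmx v = 0.
    apply/eqP; apply: contraNT xa => l0.
    rewrite [lsubmx v]mx11_scalar in l0 v0.
    have {}l0 : lsubmx v 0 0 != 0 by apply: contraNneq l0 => ->; rewrite raddf0.
    move/eqP: v0; rewrite mul_scalar_mx addr_eq0 => /eqP.
    move/(congr1 (fun w => (lsubmx v 0 0)^-1 *: w)); rewrite scalerA mulVf // scale1r => ->.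
    by rewrite scalemx_sub // -mulNmx submxMl.
  move: v0; rewrite l0 mul0mx add0r => v0.
  have /eqP := v0; rewrite mulmx_free_eq0 // => /eqP ->; exact: row_mx0.
have spanY a c : x a = c *m X -> y a = c *m Y.
  move=> xa; apply/eqP; rewrite -subr_eq0; apply/eqP/dot_eq0.
  have cr : y a *m Y^t* = x a *m X^t*.
    apply/matrixP => i j; have /matrixP /(_ 0 0) := xy a (f j).
    rewrite !mxE ord1 => E; transitivity (\sum_t y a 0 t * (y (f j))^t* t 0).
      by apply: eq_bigr => t _; rewrite !mxE.
    by rewrite -E; apply: eq_bigr => t _; rewrite !mxE.
  have cl : Y *m (y a)^t* = X *m (x a)^t*.
    by apply: adj_inj; rewrite /= !adj_mul !trmxCK.
  have dB (u : 'rV[C]_k) (Z : 'M_(r, k)) : (u - c *m Z) *m (u - c *m Z)^t* =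
      u *m u^t* - (u *m Z^t*) *m c^t* - c *m (Z *m u^t*) + c *m (Z *m Z^t*) *m c^t*.
    have -> : (u - c *m Z)^t* = u^t* - Z^t* *m c^t*.
      by rewrite linearB /= map_mxB adj_mul.
    by rewrite mulmxBl !mulmxBr !mulmxA opprB addrA addrAC.
  by rewrite dB -xy cr cl -gram -dB xa subrr mul0mx mxE.
have rk : (r <= k)%N by apply: bP; apply/asboolP; exists f.
have := subnKC rk; move: (k - r)%N => q Ek; subst k.
have XXu : forall v : 'rV_r, v != 0 -> 0 < (v *m (X *m X^t*) *m v^t*) 0 0.
  move=> v v0; rewrite mulmxA -mulmxA -adj_mul lt_neqAle dot_ge0 andbT eq_sym.
  by apply: contra v0 => /eqP /dot_eq0 /eqP; rewrite mulmx_free_eq0.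
have [|R RX] := posdef_normalize _ XXu; first by rewrite adj_mul trmxCK.
have RY : R *m (Y *m Y^t*) *m R^t* = 1%:M by rewrite -gram.
have Ru : R \in unitmx.
  have : R *m (X *m X^t* *m R^t*) \in unitmx by rewrite mulmxA RX unitmx1.
  by rewrite unitmx_mul => /andP [].
have comp (Z : 'M_(r, r + q)) : R *m (Z *m Z^t*) *m R^t* = 1%:M ->
    exists K : 'M_(q, r + q), col_mx (R *m Z) K *m (col_mx (R *m Z) K)^t* = 1%:M.
  move=> RZ; have WW : (R *m Z) *m (- 1%:M) *m (R *m Z)^t* = - 1%:M.
    by rewrite mulmxN mulNmx mulmx1 adj_mul !mulmxA -[R *m Z *m _]mulmxA RZ.
  have [|||K [_ KK]] := @complete_basis r q (- 1%:M) (R *m Z).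
  - by rewrite adj_opp adj1.
  - by rewrite WW -scaleN1r unitmxZ ?unitrN1 ?unitmx1.
  - move=> v _ v0; rewrite mulmxN mulmx1 mulNmx mxE oppr_lt0 lt_neqAle dot_ge0 andbT.
    by rewrite eq_sym; apply: contra v0 => /eqP /dot_eq0 ->.
  have sN p : - 1%:M = (- 1)%:M :> 'M[C]_p by rewrite raddfN.
  exists K; apply: oppr_inj; move: KK; rewrite mulmxN mulmx1 mulNmx WW => ->.
  by rewrite !sN -scalar_mx_block.
have [KX XU] := comp X RX; have [KY YU] := comp Y RY.
exists ((col_mx (R *m X) KX)^t* *m col_mx (R *m Y) KY).
  rewrite adj_mul trmxCK !mulmxA -(mulmxA _ _ ((col_mx (R *m Y) KY)^t*)) YU mulmx1.
  by apply: mulmx1C.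
move=> a; have [c xa] := spanX a; rewrite (spanY a c xa) xa.
have E (Z : 'M_(r, r + q)) (K : 'M_(q, r + q)) : c *m Z = row_mx (c *m invmx R) 0 *m col_mx (R *m Z) K.
  by rewrite mul_row_col mul0mx addr0 -mulmxA mulKmx.
rewrite (E X KX) !mulmxA -(mulmxA _ _ ((col_mx (R *m X) KX)^t*)) XU mulmx1.
exact: E.
Qed.

End HermitianMatrices.

(** * The homogeneous form of the hyperquadric *)

Section HomogeneousForm.
Variable C : numClosedFieldType.
Local Open Scope sesquilinear_scope.

(** Homogeneous coordinates (1, z, w): the index set 'I_m.+2 is that of the
    affine coordinates with one index put in front, so that z and w keep the
    indices zi j and wi m behind it. *)
Definition h0 m : 'I_m.+2 := ord0.
Definition hz m (j : 'I_m) : 'I_m.+2 := lift ord0 (zi j).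
Definition hw m : 'I_m.+2 := lift ord0 (wi m).

Lemma val_hz m (j : 'I_m) : val (hz j) = j.+1.
Proof. by rewrite /= /bump /= leqNgt ltn_ord. Qed.

Definition form_mx m l : 'M[C]_m.+2 :=
  (2 * 'i)^-1 *: (delta_mx (hw m) (h0 m) - delta_mx (h0 m) (hw m))
  - \sum_(j < m) eps C l j *: delta_mx (hz j) (hz j).

Lemma mul_delta_adj p (x y : 'rV[C]_p) i j :
  (x *m delta_mx i j *m y^t*) 0 0 = x 0 i * (y 0 j)^*.
Proof.
rewrite -(mul_delta_mx (0 : 'I_1)) -!mulmxA mulmxA -colE -rowE mxE big_ord1.
by rewrite !mxE.
Qed.

Lemma form_mxE m l (x y : 'rV[C]_m.+2) : (x *m form_mx m l *m y^t*) 0 0 =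
  (2 * 'i)^-1 * (x 0 (hw m) * (y 0 (h0 m))^* - x 0 (h0 m) * (y 0 (hw m))^*)
  - \sum_j eps C l j * (x 0 (hz j) * (y 0 (hz j))^*).
Proof.
rewrite /form_mx mulmxBr mulmxBl mxE [X in _ + X]mxE; congr (_ - _).
  rewrite -scalemxAr -scalemxAl mxE mulmxBr mulmxBl mxE [X in _ + X]mxE.
  by rewrite !mul_delta_adj.
rewrite mulmx_sumr mulmx_suml summxE; apply: eq_bigr => j _.
by rewrite -scalemxAr -scalemxAl mxE mul_delta_adj.
Qed.

Lemma adj_form_mx m l : (form_mx m l)^t* = form_mx m l.
Proof.
have dl (i j i' j' : 'I_m.+2) : (delta_mx i j i' j' : C)^* = delta_mx i j i' j'.
  by rewrite !mxE rmorph_nat.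
apply/matrixP => i j; rewrite /form_mx !mxE !summxE rmorphB /=; congr (_ - _).
  rewrite rmorphM rmorphB /= !rmorph_nat fmorphV rmorphM /= conjCi rmorph_nat.
  by rewrite mulrN invrN mulNr -mulrN opprB !(andbC (j == _)).
rewrite rmorph_sum; apply: eq_bigr => t _.
by rewrite !mxE rmorphM /= eps_conj rmorph_nat andbC.
Qed.

Lemma form_mx_real m l (x : 'rV[C]_m.+2) :
  (x *m form_mx m l *m x^t*) 0 0 \is Num.real.
Proof.
have E : (x *m form_mx m l *m x^t*)^t* = x *m form_mx m l *m x^t*.
  by rewrite !adj_mul trmxCK adj_form_mx mulmxA.
by apply/CrealP; rewrite -[in RHS]E [RHS]mxE [X in _ = Num.conj X]mxE.
Qed.

Let I2 : (2 * 'i : C)^-1 * (- 'i - 'i) = - 1.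
Proof.
by rewrite -opprD mulrN -mulr2n -['i *+ 2]mulr_natl mulVf // mulf_neq0 ?neq0Ci ?pnatr_eq0.
Qed.

(** The coordinates x_0 and x_w span a hyperbolic plane, in which
    x_w = -+ i x_0 are a negative and a positive direction; they are combined
    with the coordinates z_j of the sign t. *)
Lemma form_cone m l (t : C) (x : 'rV[C]_m.+2) : t = 1 \/ t = -1 ->
    x 0 (hw m) + t * 'i * x 0 (h0 m) = 0 ->
    (forall j, eps C l j != t -> x 0 (hz j) = 0) -> x != 0 ->
  t * (x *m form_mx m l *m x^t*) 0 0 < 0.
Proof.
move=> t1 xw xj x0.
have tt : t * t = 1 by case: t1 => ->; rewrite ?mulrNN mulr1.
have tc : t^* = t by case: t1 => ->; rewrite ?rmorphN1 ?rmorph1.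
have E : t * (x *m form_mx m l *m x^t*) 0 0 =
    - (`|x 0 (h0 m)| ^+ 2 + \sum_j `|x 0 (hz j)| ^+ 2).
  rewrite form_mxE; move/eqP: xw; rewrite addr_eq0 => /eqP ->.
  rewrite mulrBr opprD; congr (_ - _).
    rewrite rmorphN !rmorphM /= tc conjCi normCK.
    set a := x 0 _.
    transitivity ((t * t) * ((2 * 'i : C)^-1 * (- 'i - 'i)) * (a * a^*)); first by ring.
    by rewrite I2 tt mul1r mulN1r.
  rewrite mulr_sumr; apply: eq_bigr => j _.
  have [->|/xj ->] := eqVneq (eps C l j) t; first by rewrite [LHS]mulrA tt mul1r normCK.
  by rewrite normr0 !mul0r !mulr0 expr0n.
rewrite E oppr_lt0 lt_neqAle addr_ge0 ?exprn_ge0 ?sumr_ge0 // => [|j _]; last first.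
  by rewrite exprn_ge0.
rewrite andbT eq_sym; apply: contra x0 => /eqP s0.
have /andP [/eqP a0 /eqP b0] : (`|x 0 (h0 m)| ^+ 2 == 0) && (\sum_j `|x 0 (hz j)| ^+ 2 == 0).
  by rewrite -paddr_eq0 ?exprn_ge0 ?sumr_ge0 ?s0 // => j _; rewrite exprn_ge0.
have x00 : x 0 (h0 m) = 0.
  by apply/eqP; move/eqP: a0; rewrite expf_eq0 normr_eq0.
apply/eqP/rowP => i; rewrite mxE; case: (unliftP ord0 i) => [i' ->|-> //].
case: (unliftP ord_max i') => [j ->|->]; last first.
  by move: xw; rewrite x00 mulr0 addr0.
move/psumr_eq0P: b0 => /(_ (fun j _ => exprn_ge0 2 (normr_ge0 _))) /(_ j isT) /eqP.
by rewrite expf_eq0 normr_eq0 => /eqP.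
Qed.

(** The definite subspaces of form_cone are cut out by r + 1 linear equations,
    the form in which they serve to bound dimensions. *)
Lemma form_cone_eqs m l (t : C) (r : nat) : (l <= m)%N ->
    (t = 1 /\ r = l) \/ (t = -1 /\ r = (m - l)%N) ->
  exists L : 'M[C]_(m.+2, r.+1), forall x : 'rV_m.+2, x *m L = 0 -> x != 0 ->
    t * (x *m form_mx m l *m x^t*) 0 0 < 0.
Proof.
move=> lm tr; have t1 : t = 1 \/ t = -1 by case: tr => [] [-> _]; [left|right].
pose off := if t == 1 then 0%N else l.
exists (\matrix_(i < m.+2, a < r.+1) if unlift ord0 a is Some a' then
    (val i == (off + a').+1)%:R
  else (i == hw m)%:R + t * 'i * (i == h0 m)%:R) => x xL x0.
apply: form_cone => // [|j ej].
  have /rowP /(_ ord0) := xL; rewrite !mxE => <-; apply/esym.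
  under eq_bigr => i _ do rewrite mxE unlift_none mulrDr.
  rewrite big_split /= (bigD1 (hw m)) //= eqxx mulr1 big1 ?addr0; last first.
    by move=> i /negbTE ->; rewrite mulr0.
  rewrite (bigD1 (h0 m)) //= ?eqxx mulr1 big1 ?addr0; last first.
    by move=> i /negbTE ->; rewrite !mulr0.
  by rewrite mulrC.
have jr : (j - off < r)%N /\ (off <= j)%N.
  have n11 : (-1 == 1 :> C) = false.
    by apply/negbTE; rewrite eq_sym -subr_eq0 opprK -(natrD _ 1 1) pnatr_eq0.
  rewrite /off; move: ej; rewrite /eps; case: tr => [] [-> ->]; rewrite ?eqxx ?n11.
    by case: (ltnP j l) => jl; rewrite ?expr0 ?eqxx // subn0.
  have jm := ltn_ord j.
  case: (ltnP j l) => jl; rewrite ?expr1 ?eqxx // => _; split=> //.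
  by rewrite ltn_sub2r //; apply: leq_ltn_trans jl jm.
have /rowP /(_ (lift ord0 (Ordinal jr.1))) := xL; rewrite !mxE => <-; apply/esym.
under eq_bigr => i _ do rewrite mxE liftK.
rewrite (bigD1 (hz j)) // val_hz subnKC ?jr.2 // eqxx mulr1 big1 => [|i /= ij].
  exact: addr0.
case: eqP => [e|]; rewrite ?mulr0 //.
by case/negP: ij; apply/eqP/val_inj; rewrite val_hz.
Qed.

Lemma form_mx_unit m l : form_mx m l \in unitmx.
Proof.
rewrite -row_free_unit; apply: inj_row_free => x xJ.
have E i : (x *m form_mx m l *m (delta_mx 0 i : 'rV_m.+2)^t*) 0 0 = 0.
  by rewrite xJ mul0mx mxE.
have I20 : (2 * 'i : C)^-1 != 0 by rewrite invr_eq0 mulf_neq0 ?neq0Ci ?pnatr_eq0.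
have hz0 (j : 'I_m) : (hz j == h0 m) = false by [].
have hzw (j : 'I_m) : (hz j == hw m) = false.
  by apply/eqP => /lift_inj /eqP; rewrite eq_sym (negbTE (neq_lift _ _)).
have hzz (j j' : 'I_m) : (hz j == hz j') = (j == j').
  by apply/eqP/eqP => [/lift_inj /lift_inj|->].
apply/rowP => i; rewrite mxE; case: (unliftP ord0 i) => [i' ->|->]; last first.
  move: (E (hw m)); rewrite form_mxE !mxE !eqxx /= rmorph0 rmorph1 mulr0 mulr1.
  rewrite big1 => [|j _]; last by rewrite !mxE hzw rmorph0 !mulr0.
  move=> /eqP; rewrite subr0 sub0r mulf_eq0 (negbTE I20) oppr_eq0 /=.
  by move/eqP.
case: (unliftP ord_max i') => [j ->|->].
  move: (E (hz j)); rewrite form_mxE !mxE !(eq_sym _ (hz j)) hz0 hzw !andbF.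
  rewrite rmorph0 !mulr0 subrr mulr0 (bigD1 j) //= !mxE !eqxx rmorph1 mulr1.
  rewrite big1 => [|j' jj']; last by rewrite !mxE hzz (negbTE jj') rmorph0 !mulr0.
  by move=> /eqP; rewrite sub0r addr0 oppr_eq0 mulf_eq0 (negbTE (eps_neq0 _ _ _)) => /eqP.
move: (E (h0 m)); rewrite form_mxE !mxE !eqxx /= rmorph0 rmorph1 mulr0 mulr1.
rewrite big1 => [|j _]; last by rewrite !mxE hz0 rmorph0 !mulr0.
by move=> /eqP; rewrite !subr0 mulf_eq0 (negbTE I20) => /eqP.
Qed.

(** Inertia: a subspace on which the form is nonnegative meets the negative
    definite subspace only in 0, and that subspace has codimension l + 1. *)
Lemma form_index m l r (X : 'M[C]_(r, m.+2)) : (l <= m)%N -> row_free X ->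
    (forall y : 'rV_r, 0 <= (y *m X *m form_mx m l *m (y *m X)^t*) 0 0) ->
  (r <= l.+1)%N.
Proof.
move=> lm Xf Xp; have [L Ln] := @form_cone_eqs m l 1 l lm (or_introl (conj erefl erefl)).
have : row_free (X *m L).
  apply: inj_row_free => v; rewrite mulmxA => vL; apply/eqP; apply: contraT => v0.
  have := Ln _ vL; rewrite mulmx_free_eq0 // => /(_ v0).
  by rewrite mul1r (le_gtF (Xp v)).
by rewrite /row_free => /eqP <-; apply: rank_leq_col.
Qed.

End HomogeneousForm.

(** * Vectors of series and their first-order jets *)

Section Jets.
Variable C : numClosedFieldType.
Local Open Scope sesquilinear_scope.

Section LowDegree.
Variable d : nat.
Implicit Types (f g : fps C d).

Lemma coefM_U (f g : fps C d) i :
  (f * g) U_(i)%MM = f 0%MM * g U_(i)%MM + f U_(i)%MM * g 0%MM.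
Proof.
have -> : f * g = fconst d (f 0%MM) * g + fconst d (g 0%MM) * fcenter f
    + fcenter f * fcenter g by rewrite !fcenterE; ring.
rewrite !coefD !coef_constM [X in _ + X](@vanishM _ _ mdeg 1 1) ?mdeg1 //.
- by rewrite addr0 {1}/fcenter mnm1_neq0 [X in _ + X]mulrC.
- exact: mdeg_morph.
- exact: vanish_fcenter.
- exact: vanish_fcenter.
Qed.

Lemma coefM_UU (f g : fps C d) i j : f 0%MM = 0 -> g 0%MM = 0 ->
  (f * g) (U_(i) + U_(j))%MM =
  f U_(i)%MM * g U_(j)%MM + (i != j)%:R * (f U_(j)%MM * g U_(i)%MM).
Proof.
move=> f0 g0; set m := (U_(i) + U_(j))%MM.
have m2 : mdeg m = 2%N by rewrite mdegD !mdeg1.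
have -> : (f * g) m = (flinear (fun k => f U_(k)%MM) * g) m.
  apply: (@eqmodE _ _ 3); last by rewrite m2.
  rewrite /eqmod -mulrBl; apply: (@vanishM _ _ mdeg 2 1).
  - exact: mdeg_morph.
  - exact: linear_part.
  - exact/vanish1P.
rewrite /flinear mulr_suml coef_sum.
under eq_bigr => k _ do rewrite -mulrA coef_constM coef_varM.
rewrite (bigD1 i) //= mnmDE !mnm1E eqxx /= {1}/m addmC addmK; congr (_ + _).
case: (eqVneq i j) => [e|ij] /=.
  rewrite mul0r big1 // => k ki; rewrite mnmDE !mnm1E -e eq_sym (negbTE ki) /=.
  by rewrite mulr0.
rewrite mul1r (bigD1 j) 1?eq_sym //= mnmDE !mnm1E eqxx addn1 /=.
rewrite -/m /m addmK big1 ?addr0 // => k /andP [ki kj].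
by rewrite mnmDE !mnm1E ![_ == k]eq_sym (negbTE ki) (negbTE kj) mulr0.
Qed.

End LowDegree.

Section VectorSeries.
Variable d : nat.
Implicit Types (x y : 'X_{1..d}).

Definition cvec p (X : 'I_p -> fps C d) x : 'rV[C]_p := \row_i X i x.

Definition herm_vec m l (X : 'I_m.+2 -> fps C d) : fps C (d + d) :=
  herm_form l (X (h0 m)) (fun j => X (hz j)) (X (hw m)).

Lemma ker_herm_vec m l (X : 'I_m.+2 -> fps C d) x y :
  ker (herm_vec l X) x y = (cvec X x *m form_mx C m l *m (cvec X y)^t*) 0 0.
Proof.
rewrite /herm_vec ker_herm_form form_mxE !mxE; congr (_ - _).
by apply: eq_bigr => j _; rewrite !mxE.
Qed.

Lemma ker_herm_conj m l (X : 'I_m.+2 -> fps C d) x y :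
  ker (herm_vec l X) y x = (ker (herm_vec l X) x y)^*.
Proof.
rewrite !ker_herm_vec; set J := form_mx C m l.
have E : (cvec X x *m J *m (cvec X y)^t*)^t* = cvec X y *m J *m (cvec X x)^t*.
  by rewrite !adj_mul trmxCK adj_form_mx mulmxA.
by rewrite -E [LHS]mxE [X in Num.conj X = _]mxE.
Qed.

Definition linmul p q (X : 'I_p -> fps C d) (B : 'M[C]_(p, q)) : 'I_q -> fps C d :=
  fun i => \sum_j fconst d (B j i) * X j.

Lemma cvec_linmul p q (X : 'I_p -> fps C d) (B : 'M[C]_(p, q)) x :
  cvec (linmul X B) x = cvec X x *m B.
Proof.
apply/rowP => i; rewrite !mxE /linmul coef_sum; apply: eq_bigr => j _.
by rewrite coef_constM mxE mulrC.
Qed.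

Lemma cvec_inj p (X Y : 'I_p -> fps C d) :
  (forall x, cvec X x = cvec Y x) -> forall i, X i = Y i.
Proof.
by move=> XY i; apply: fpsP => x; have /rowP /(_ i) := XY x; rewrite !mxE.
Qed.

Lemma herm_vecM m l (X : 'I_m.+2 -> fps C d) u :
  herm_vec l (fun i => u * X i) = lft u * rgt (fconj u) * herm_vec l X.
Proof.
have E f g : lft (u * f) * rgt (fconj (u * g)) =
    lft u * rgt (fconj u) * (lft f * rgt (fconj g)).
  by rewrite (rmorphM (@fconj C d)) !rmorphM; apply: mulrACA.
rewrite /herm_vec /herm_form [RHS]mulrBr; congr (_ - _).
  by rewrite !E -mulrBr [RHS]mulrCA.
by rewrite mulr_sumr; apply: eq_bigr => j _; rewrite E [RHS]mulrCA.
Qed.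

Definition vjoin p q (X : 'I_p -> fps C d) (Y : 'I_q -> fps C d) :
    'I_(p + q) -> fps C d :=
  fun i => match split i with inl j => X j | inr j => Y j end.

Lemma cvec_vjoin p q (X : 'I_p -> fps C d) (Y : 'I_q -> fps C d) x :
  cvec (vjoin X Y) x = row_mx (cvec X x) (cvec Y x).
Proof.
apply/rowP => i; rewrite mxE /vjoin; case: (split_ordP i) => j ->.
  by rewrite row_mxEl mxE.
by rewrite row_mxEr mxE.
Qed.

Definition mono (a : 'I_d.+1) : 'X_{1..d} :=
  if unlift ord0 a is Some i then U_(i)%MM else 0%MM.

Lemma mono0 : mono ord0 = 0%MM. Proof. by rewrite /mono unlift_none. Qed.
Lemma monoS i : mono (lift ord0 i) = U_(i)%MM. Proof. by rewrite /mono liftK. Qed.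

Lemma mdeg_mono a : (mdeg (mono a) <= 1)%N.
Proof. by rewrite /mono; case: unlift => [i'|]; rewrite ?mdeg1 ?mdeg0. Qed.

Lemma vanish2_mono (f : fps C d) : (forall a, f (mono a) = 0) -> vanish mdeg 2 f.
Proof.
move=> f0 m /mdeg_lt2 [->|[i' ->]]; first by rewrite -mono0.
by rewrite -monoS.
Qed.

(** The 1-jet as a matrix: its row 0 holds the constant terms, the others the
    first derivatives. *)
Definition jet p (X : 'I_p -> fps C d) : 'M[C]_(d.+1, p) :=
  \matrix_(a, i) X i (mono a).

Lemma row_jet p (X : 'I_p -> fps C d) a : row a (jet X) = cvec X (mono a).
Proof. by apply/rowP => i; rewrite !mxE. Qed.

Lemma jet_form m l (X : 'I_m.+2 -> fps C d) a b :
  (jet X *m form_mx C m l *m (jet X)^t*) a b = ker (herm_vec l X) (mono a) (mono b).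
Proof.
rewrite ker_herm_vec -!row_jet -row_mul mxE [RHS]mxE; apply: eq_bigr => j _.
by rewrite !mxE.
Qed.

Definition hom p (H : fmap C d p) : 'I_p.+1 -> fps C d :=
  fun i => if unlift ord0 i is Some j then H j else 1.

Lemma hom0 p (H : fmap C d p) : hom H ord0 = 1. Proof. by rewrite /hom unlift_none. Qed.
Lemma homS p (H : fmap C d p) i : hom H (lift ord0 i) = H i.
Proof. by rewrite /hom liftK. Qed.

Lemma jet_hom_free p (H : fmap C d p) : (forall i, H i 0%MM = 0) ->
  (forall v : 'cV_d, fmap_jacobian H *m v = 0 -> v = 0) -> row_free (jet (hom H)).
Proof.
move=> H0 Hj; apply: inj_row_free => v vj.
have v0 : v 0 ord0 = 0.
  have /rowP /(_ ord0) := vj; rewrite !mxE (bigD1 ord0) //= mxE hom0 mono0 coef1 eqxx mulr1.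
  rewrite big1 ?addr0 // => a; rewrite eq_sym mxE hom0 coef1 => /unlift_some [j -> _].
  by rewrite monoS mnm1_neq0 mulr0.
have vS : (\col_i v 0 (lift ord0 i) : 'cV_d) = 0.
  apply: Hj; apply/colP => i; have /rowP /(_ (lift ord0 i)) := vj.
  rewrite !mxE big_ord_recl v0 mul0r add0r => E; rewrite -[RHS]E.
  by apply: eq_bigr => j _; rewrite !mxE homS monoS mulrC.
apply/rowP => a; rewrite mxE; case: (unliftP ord0 a) => [j ->|-> //].
by have /colP /(_ j) := vS; rewrite !mxE.
Qed.

Lemma ker_UU (k k' : fps C (d + d)) i j : k 0%MM = 0 -> k' 0%MM = 0 ->
  ker (k * k') U_(i)%MM U_(j)%MM =
  ker k U_(i)%MM 0%MM * ker k' 0%MM U_(j)%MM +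
  ker k 0%MM U_(j)%MM * ker k' U_(i)%MM 0%MM.
Proof.
move=> k0 k'0; rewrite /ker.
have -> : mjoin U_(i)%MM U_(j)%MM = (U_(lshift d i) + U_(rshift d j))%MM.
  by rewrite mjoinUl mjoinUr mjoinD addm0 add0m.
by rewrite coefM_UU // eq_lrshift mul1r !mjoinUl !mjoinUr.
Qed.

End VectorSeries.

(** In homogeneous coordinates with respect to a basis B of block diagonal Gram
    matrix, the form of the target is that of the source, up to the sign s, minus
    a sum of squares. *)
Lemma herm_split d n l k s (Y : 'I_(n.+2 + k) -> fps C d)
    (B : 'M[C]_(n.+2 + k, (n + k).+2)) :
    B *m form_mx C (n + k) l *m B^t* = block_mx (s *: form_mx C n l) 0 0 (- 1%:M) ->
  herm_vec (m := n + k) l (linmul Y B) =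
  fconst _ s * herm_vec l (fun i => Y (lshift k i)) - norm2 (fun t => Y (rshift n.+2 t)).
Proof.
move=> BJ; apply: kerP => x y; rewrite [RHS]kerB ker_constM ker_norm2 !ker_herm_vec.
rewrite !cvec_linmul adj_mul !mulmxA.
have -> : cvec Y x *m B *m form_mx C (n + k) l *m B^t* *m (cvec Y y)^t* =
   cvec Y x *m (B *m form_mx C (n + k) l *m B^t*) *m (cvec Y y)^t*.
  by rewrite !mulmxA.
rewrite BJ.
have sp z : cvec Y z = row_mx (cvec (fun i => Y (lshift k i)) z)
                              (cvec (fun t => Y (rshift n.+2 t)) z).
  apply/rowP => i; rewrite mxE; case: (split_ordP i) => j ->.
    by rewrite row_mxEl mxE.
  by rewrite row_mxEr mxE.
rewrite !sp mul_row_block !mulmx0 add0r addr0 tr_row_mx map_col_mx mul_row_col.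
rewrite mxE -scalemxAr -scalemxAl mxE; congr (_ + _).
rewrite mulmxN mulmx1 mulNmx mxE; congr (- _); rewrite mxE; apply: eq_bigr => t _.
by rewrite !mxE.
Qed.

End Jets.

(** * Normal position of an embedding *)

Section NormalUnit.
Variables (C : numClosedFieldType) (d : nat) (b : fps C (d + d)).

(** Used for real nonzero x only. *)
Definition csgn (x : C) : C := if 0 < x then 1 else -1.

(** Multiplying a homogeneous vector by a series u multiplies the form by
    u(Z) \bar u(\bar Z).  This u is chosen such that u \bar u b is the sign of
    b(0) for \bar Z = 0. *)
Definition normal_unit : fps C d :=
  fconst d (csgn (b 0%MM) * sqrtC `|b 0%MM|) * finv (fl b).

Definition normal_factor : fps C (d + d) :=
  lft normal_unit * rgt (fconj normal_unit) * b.

Lemma csgn_pm (x : C) : csgn x = 1 \/ csgn x = -1.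
Proof. by rewrite /csgn; case: ifP; [left|right]. Qed.

End NormalUnit.

Section NormalPosition.
Variables (C : numClosedFieldType) (n l k : nat).
Local Open Scope sesquilinear_scope.
Local Notation d := n.+1.
Local Notation X := 'X_{1..d}.
Variables (F : fmap C d d) (r0 b : fps C (d + d)) (H : fmap C d (n + k).+1).

Hypothesis n_gt0 : (0 < n)%N.
Hypothesis l_le : (l.*2 <= n)%N.
Hypothesis F0 : forall i, F i 0%MM = 0.
Hypothesis F_unit : fmap_jacobian F \in unitmx.
Hypothesis r0F : eqmod 3 r0 (herm_vec l (hom F)).
Hypothesis H0 : forall i, H i 0%MM = 0.
Hypothesis H_inj : injective (fun v : 'cV[C]_d => fmap_jacobian H *m v).
Hypothesis HE : herm_vec l (hom H) = b * r0.

Local Notation J := (form_mx C (n + k) l).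
Local Notation Jn := (form_mx C n l).

Let h0E p (G : fmap C d p.+1) : hom G (h0 p) = 1. Proof. exact: hom0. Qed.
Let hzE p (G : fmap C d p.+1) j : hom G (hz j) = G (zi j). Proof. exact: homS. Qed.
Let hwE p (G : fmap C d p.+1) : hom G (hw p) = G (wi p). Proof. exact: homS. Qed.

Let r0_ker x y : (mdeg x + mdeg y < 3)%N -> ker r0 x y = ker (herm_vec l (hom F)) x y.
Proof. by move=> xy; apply: (eqmodE r0F); rewrite mdeg_mjoin. Qed.

Let F_ker_l x : ker (herm_vec l (hom F)) x 0%MM = (2 * 'i)^-1 * F (wi n) x.
Proof.
rewrite /herm_vec ker_herm_form h0E hwE F0 coef1 eqxx rmorph0 rmorph1 mulr1 mulr0 subr0.
by rewrite big1 ?subr0 // => j _; rewrite hzE F0 rmorph0 !mulr0.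
Qed.

Let r00 : r0 0%MM = 0.
Proof.
have -> : r0 0%MM = ker r0 0%MM 0%MM by rewrite /ker mjoin00.
by rewrite r0_ker ?mdeg0 // F_ker_l F0 mulr0.
Qed.

Let r (i : 'I_d) := ker r0 U_(i)%MM 0%MM.

Let r_conj i : ker r0 0%MM U_(i)%MM = (r i)^*.
Proof.
rewrite /r !r0_ker ?mdeg0 ?mdeg1 //; exact: ker_herm_conj.
Qed.

(** Otherwise the w-component of F would have no linear part. *)
Lemma source_gradient : exists i, ker r0 U_(i)%MM 0%MM != 0.
Proof.
apply: contrapT => no.
have Fw i : F (wi n) U_(i)%MM = 0.
  apply/eqP; apply: contraT => Fi; case: no; exists i.
  rewrite r0_ker ?mdeg0 ?mdeg1 // F_ker_l mulf_neq0 // invr_eq0.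
  by rewrite mulf_neq0 ?neq0Ci ?pnatr_eq0.
have : delta_mx 0 (wi n) *m fmap_jacobian F = 0 :> 'rV_d.
  by rewrite -rowE; apply/rowP => i; rewrite !mxE Fw.
move/(congr1 (fun M => M *m invmx (fmap_jacobian F))).
rewrite mulmxK // mul0mx => /rowP /(_ (wi n)) /eqP.
by rewrite !mxE !eqxx oner_eq0.
Qed.

Let beta := b 0%MM.

Let ker00 (f : fps C (d + d)) : ker f 0%MM 0%MM = f 0%MM.
Proof. by rewrite /ker mjoin00. Qed.

Let ker_U0 i : ker (b * r0) U_(i)%MM 0%MM = beta * r i.
Proof. by rewrite /ker -mjoinUl coefM_U r00 mulr0 addr0 /r /ker mjoinUl. Qed.

Let ker_0U i : ker (b * r0) 0%MM U_(i)%MM = beta * (r i)^*.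
Proof. by rewrite -r_conj /ker -mjoinUr coefM_U r00 mulr0 addr0 /ker mjoinUr. Qed.

Let jetH_free : row_free (jet (hom H)).
Proof. by apply: jet_hom_free => // v jv; apply: H_inj; rewrite /= jv mulmx0. Qed.

Let ll : (l <= n + k)%N. Proof. lia. Qed.
Let ln : (l <= n)%N. Proof. lia. Qed.

(** Transversality.  If beta = b(0) vanished, the Gram matrix of the 1-jet of
    (1, H) would have the form N G + G' N^* with a single column N, hence vanish
    on the kernel of N.  This is an isotropic space of dimension at least n + 1,
    which exceeds the index l + 1. *)
Lemma transversal : beta != 0.
Proof.
apply/negP => /eqP b0.
pose N : 'cV[C]_d.+1 := \col_a ker r0 (mono a) 0%MM.
pose G : 'rV[C]_d.+1 := \row_a ker b 0%MM (mono a).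
pose G' : 'cV[C]_d.+1 := \col_a ker b (mono a) 0%MM.
have gram : jet (hom H) *m J *m (jet (hom H))^t* = N *m G + G' *m N^t*.
  apply/matrixP => a c; rewrite jet_form HE mxE !mxE !big_ord1 !mxE.
  case: (unliftP ord0 a) => [i ->|->]; case: (unliftP ord0 c) => [j ->|->];
    rewrite ?monoS ?mono0.
  - by rewrite ker_UU // r_conj mulrC [X in _ = X]addrC [X in _ + X]mulrC.
  - by rewrite ker_U0 b0 mul0r !ker00 r00 -/beta b0 rmorph0 !mulr0 addr0.
  - by rewrite ker_0U b0 mul0r !ker00 r00 -/beta b0 !mul0r addr0.
  - by rewrite !ker00 coef0M r00 rmorph0 mul0r !mulr0 addr0.
pose E := row_base (kermx N).
have EN : E *m N = 0.
  by apply/sub_kermxP; rewrite eq_row_base submx_refl.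
have rE : (d <= \rank (kermx N))%N.
  rewrite mxrank_ker; have := rank_leq_col N; lia.
suff : (\rank (kermx N) <= l.+1)%N by lia.
apply: (@form_index C (n + k) l _ (E *m jet (hom H)) ll).
  by rewrite /row_free mxrankMfree //; apply: row_base_free.
have NE : N^t* *m E^t* = 0 by rewrite -adj_mul EN trmx0 map_mx0.
set Z := E *m jet (hom H); have Z0 : Z *m J *m Z^t* = 0.
  rewrite /Z adj_mul mulmxA -(mulmxA E) -(mulmxA E) gram mulmxDr mulmxDl.
  by rewrite mulmxA EN mul0mx mul0mx add0r -!mulmxA NE !mulmx0.
by move=> y; rewrite adj_mul mulmxA -(mulmxA y) -(mulmxA y) Z0 mulmx0 mul0mx mxE.
Qed.

(** Both equations are Hermitian, and beta is the ratio of their gradients. *)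
Lemma beta_real : beta \is Num.real.
Proof.
have [i ri] := source_gradient; apply/CrealP.
have := @ker_herm_conj C d _ l (hom H) U_(i)%MM 0%MM.
rewrite HE ker_0U ker_U0 rmorphM => /mulIf E.
by apply/esym/E; rewrite fmorph_eq0.
Qed.

Let s : C := csgn beta.

Let s_pm : s = 1 \/ s = -1.
Proof. exact: csgn_pm. Qed.
Let ss : s * s = 1. Proof. by case: s_pm => ->; rewrite ?mulrNN mulr1. Qed.
Let sc : s^* = s. Proof. by case: s_pm => ->; rewrite ?rmorphN1 ?rmorph1. Qed.

Let beta_s : beta = s * `|beta|.
Proof.
rewrite /s /csgn; case: ifP => [b_gt0|/negbT b_ngt0]; first by rewrite mul1r gtr0_norm.
have b_lt0 : beta <= 0.
  by have := real_leNgt beta_real (real0 C); rewrite b_ngt0.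
by rewrite mulN1r ler0_norm ?opprK.
Qed.

Let t : C := sqrtC `|beta|.
Let t_neq0 : t != 0. Proof. by rewrite sqrtC_eq0 normr_eq0 transversal. Qed.
Let tt : t * t = `|beta|. Proof. by rewrite -expr2 sqrtCK. Qed.
Let tc : t^* = t.
Proof. by apply/CrealP; apply: ger0_real; rewrite sqrtC_ge0. Qed.

Let u : fps C d := normal_unit b.

Let flb0 : fl b 0%MM = beta. Proof. exact: ker00. Qed.

Let u0 : u 0%MM = t^-1.
Proof.
rewrite /u /normal_unit -/beta -/s -/t coef_constM finv0 flb0 ?transversal //.
apply: (mulIf transversal); rewrite mulfVK ?transversal //.
by rewrite beta_s -tt mulrCA mulKf // .
Qed.

Let b' := normal_factor b.

Let HE' : herm_vec l (fun i => u * hom H i) = b' * r0.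
Proof. by rewrite herm_vecM HE /b' /normal_factor !mulrA. Qed.

Let fl_b' : fl b' = fconst d s.
Proof.
rewrite /b' /normal_factor -/u !flM fl_lft fl_rgt /fconj u0 fmorphV /= tc mulrAC.
have flb : fl b * finv (fl b) = 1 by rewrite fmulV // flb0 transversal.
rewrite /u /normal_unit -/beta -/s -/t -(mulrA (fconst _ _)) (mulrC (finv _)) flb mulr1 -rmorphM.
by rewrite mulfK.
Qed.

(** The factor b' is s for \bar Z = 0.  As b' r0 is Hermitian, and r0 is so up to
    order three, the product of f = fr b' - s and fr r0 has order three.  Both
    have no constant term and fr r0 has a nonzero linear part, so f has no linear
    part. *)
Let fr_b'_low i : ker b' 0%MM U_(i)%MM = 0.
Proof.
have frh : fr b' * fr r0 = fconst d s * fconj (fl r0).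
  rewrite -frM -HE'; apply: fpsP => y; rewrite /fr (ker_herm_conj l _ y 0%MM) HE'.
  rewrite -[ker _ _ _]/(fl (b' * r0) y) flM fl_b' !coef_constM rmorphM /= sc //.
pose f := fr b' - fconst d s.
(* The quadratic part of f fr r0 is a product of two linear forms. *)
have fg : vanish mdeg 3 (f * fr r0).
  move=> m m3; rewrite /f mulrBl coefB frh !coef_constM -mulrBr.
  have -> : fconj (fl r0) m = fr r0 m; last by rewrite subrr mulr0.
  rewrite /fconj /fl /fr !r0_ker ?mdeg0 ?addn0 //.
  by rewrite -ker_herm_conj.
have f0 : f 0%MM = 0.
  have <- : s - s = 0 by rewrite subrr.
  rewrite /f coefB coef_fconst eqxx; congr (_ - _).
  rewrite -[LHS]/(fl b' 0%MM) fl_b'.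
  by rewrite coef_fconst eqxx.
have g0 : fr r0 0%MM = 0 by rewrite /fr ker00 r00.
have [j rj] := source_gradient.
have gj : fr r0 U_(j)%MM != 0 by rewrite /fr r_conj conjC_eq0.
have fj : f U_(j)%MM = 0.
  have := fg (U_(j) + U_(j))%MM; rewrite mdegD !mdeg1 coefM_UU // eqxx mul0r addr0.
  by move=> /(_ isT) /eqP; rewrite mulf_eq0 (negbTE gj) orbF => /eqP.
have fi : f U_(i)%MM = 0.
  have := fg (U_(i) + U_(j))%MM; rewrite mdegD !mdeg1 coefM_UU // fj mul0r mulr0 addr0.
  by move=> /(_ isT) /eqP; rewrite mulf_eq0 (negbTE gj) orbF => /eqP.
by move: fi; rewrite /f coefB coef_fconst mnm1_neq0 subr0.
Qed.

Let b'_low : vanish mdeg 2 (b' - fconst _ s).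
Proof.
move=> m m2; rewrite -(mjoinK m) coefB coef_fconst; move: m2.
rewrite -{1}(mjoinK m) mdeg_mjoin; move: (mleft m) (mright m) => x y m2.
have E y0 : ker b' y0 0%MM = s *+ (y0 == 0%MM).
  by rewrite -[LHS]/(fl b' y0) fl_b' coef_fconst.
have [->|[i yi]] := @mdeg_lt2 d y (leq_ltn_trans (leq_addl _ _) m2).
  by rewrite -[b' _]/(ker b' _ _) E -mjoin00 mjoin_eq eqxx andbT subrr.
have -> : x = 0%MM.
  by apply/eqP; rewrite -mdeg_eq0; move: m2; rewrite yi mdeg1; lia.
rewrite yi -[b' _]/(ker b' _ _) fr_b'_low -mjoin00 mjoin_eq eqxx mnm1_neq0.
by rewrite subr0.
Qed.

Let V := jet (fun i => u * hom H i).
Let BF := jet (hom F).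

Let V_gram : V *m J *m V^t* = s *: (BF *m Jn *m BF^t*).
Proof.
apply/matrixP => a c; rewrite jet_form HE' mxE jet_form.
have dm : (mdeg (mono a) + mdeg (mono c) < 3)%N.
  by have := mdeg_mono a; have := mdeg_mono c; lia.
rewrite -r0_ker // -[b'](subrK (fconst _ s)) mulrDl kerD ker_constM.
rewrite [X in X + _](_ : _ = 0) ?add0r //.
rewrite /ker; apply: (@vanishM _ _ mdeg 2 1); rewrite ?mdeg_mjoin //.
  exact: mdeg_morph.
by apply/vanish1P.
Qed.

Let BF_unit : BF \in unitmx.
Proof.
rewrite -row_free_unit; apply: jet_hom_free => // v.
by move/(congr1 (mulmx (invmx (fmap_jacobian F)))); rewrite mulKmx // mulmx0.
Qed.

(** The rows of W span the 1-jet of the embedding; the coordinates with respect to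
    W of this jet are the 1-jet of (1, F). *)
Let W := invmx BF *m V.

Let W_gram : W *m J *m W^t* = s *: Jn.
Proof.
rewrite /W adj_mul !mulmxA -(mulmxA (invmx BF)) -(mulmxA (invmx BF)) V_gram.
rewrite -scalemxAr -scalemxAl !mulmxA mulVmx // mul1mx -!mulmxA -adj_mul.
by rewrite mulVmx // adj1 mulmx1.
Qed.

Let W_unit : W *m J *m W^t* \in unitmx.
Proof.
rewrite W_gram unitmxZ ?form_mx_unit //.
by case: s_pm => ->; rewrite ?unitrN1 ?unitr1.
Qed.

(** Nonnegative subspaces of s Jn: at least l + 1 dimensions for either sign,
    because 2 l <= n, and n - l + 1 dimensions if s = -1. *)
Let L_ex : exists p (P : 'M[C]_(p, n.+2)), [/\ row_free P,
    forall y : 'rV_p, 0 <= s * (y *m P *m Jn *m (y *m P)^t*) 0 0,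
    (l.+1 <= p)%N & s = -1 -> ((n - l).+1 <= p)%N].
Proof.
pose q := if s == 1 then (n - l)%N else l.
have n11 : (-1 == 1 :> C) = false.
  by apply/negbTE; rewrite eq_sym -subr_eq0 opprK -(natrD _ 1 1) pnatr_eq0.
have sq : (- s = 1 /\ q = l) \/ (- s = -1 /\ q = (n - l)%N).
  by rewrite /q; case: s_pm => ->; rewrite ?opprK ?n11 ?eqxx; [right|left].
have [L Ln] := form_cone_eqs ln sq.
exists (\rank (kermx L)), (row_base (kermx L)); split.
- exact: row_base_free.
- move=> y; have [->|y0] := eqVneq (y *m row_base (kermx L)) 0.
    by rewrite !mul0mx mxE mulr0.
  rewrite -oppr_le0 -mulNr ltW // Ln //.
  by apply/sub_kermxP; rewrite (submx_trans (submxMl _ _)) // eq_row_base.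
- have ql : (q <= n - l)%N by rewrite /q; case: ifP => _; lia.
  by rewrite mxrank_ker; have := rank_leq_col L; lia.
- move=> s1; have ql : q = l by rewrite /q s1 n11.
  by rewrite mxrank_ker; have := rank_leq_col L; lia.
Qed.

Let W_free : row_free W.
Proof.
rewrite /row_free eqn_leq rank_leq_row /= -[X in (X <= _)%N](mxrank_unit W_unit) -mulmxA.
exact: mxrankM_maxl.
Qed.

Let W_form p (P : 'M[C]_(p, n.+2)) (y : 'rV_p) :
  (y *m (P *m W) *m J *m (y *m (P *m W))^t*) 0 0 =
  s * (y *m P *m Jn *m (y *m P)^t*) 0 0.
Proof.
rewrite (mulmxA y) [(_ *m W)^t*]adj_mul.
have -> : y *m P *m W *m J *m (W^t* *m (y *m P)^t*) =
    y *m P *m (W *m J *m W^t*) *m (y *m P)^t* by rewrite !mulmxA.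
by rewrite W_gram -scalemxAr -scalemxAl mxE.
Qed.

(** The target has index l + 1, which leaves no room for n - l + 1 nonnegative
    dimensions unless 2 l = n. *)
Let s_half : s = -1 -> l.*2 = n.
Proof.
have [p [P [Pf Pp _ Pr]]] := L_ex => s1.
have : (p <= l.+1)%N.
  apply: (@form_index C (n + k) l p (P *m W) ll).
    by rewrite /row_free mxrankMfree.
  by move=> y; rewrite W_form.
by have := Pr s1; lia.
Qed.

(** A nonnegative vector orthogonal to W would add one to the l + 1 nonnegative
    dimensions in W, again exceeding the index of the target. *)
Let W_neg (x : 'rV_(n + k).+2) : x *m J *m W^t* = 0 -> x != 0 ->
  (x *m J *m x^t*) 0 0 < 0.
Proof.
move=> xW x0; have xr := form_mx_real l x.
rewrite real_ltNge ?real0 //; apply/negP => xp.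
have [p [P [Pf Pp Pl _]]] := L_ex.
have Wx : W *m J *m x^t* = 0 := adj_form_eq0 (adj_form_mx _ _ _) xW.
suff : (p + 1 <= l.+1)%N by move: Pl; clear; lia.
apply: (@form_index C (n + k) l _ (col_mx (P *m W) x) ll).
  apply: inj_row_free => v; rewrite -[v]hsubmxK mul_row_col; set v1 := lsubmx v; set v2 := rsubmx v.
  move=> v0; have v10 : v1 = 0.
    have := congr1 (fun z => z *m (J *m W^t*)) v0.
    have xW' : x *m (J *m W^t*) = 0 by rewrite mulmxA; apply: xW.
    rewrite mulmxDl mul0mx -(mulmxA v2 x) xW' mulmx0 addr0.
    have -> : v1 *m (P *m W) *m (J *m W^t*) = v1 *m P *m (W *m J *m W^t*).
      by rewrite !mulmxA.
    move/(congr1 (fun z => z *m invmx (W *m J *m W^t*))); rewrite mulmxK // mul0mx.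
    by move/eqP; rewrite mulmx_free_eq0 // => /eqP.
  move: v0; rewrite v10 mul0mx add0r [v2]mx11_scalar mul_scalar_mx => /eqP.
  rewrite scaler_eq0 (negbTE x0) orbF => /eqP ->.
  by rewrite raddf0 row_mx0.
move=> v; rewrite -[v]hsubmxK mul_row_col; set v1 := lsubmx v; set v2 := rsubmx v.
have xx : (x *m J *m x^t*) = ((x *m J *m x^t*) 0 0)%:M by apply: mx11_scalar.
have PWx : P *m W *m J *m x^t* = 0.
  by rewrite -(mulmxA P) -(mulmxA P) Wx mulmx0.
rewrite (form_orth_add v1 v2 (adj_form_mx _ _ _) PWx).
rewrite mxE W_form addr_ge0 // xx mul_mx_scalar -scalemxAl mxE.
by rewrite mulr_ge0 // dot_ge0.
Qed.

(** Up to a unit and a linear change B of homogeneous coordinates, an embedding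
    has n + 2 components c that agree with (1, F) to first order, and k further
    components phi of order two, on which the form is negative definite.  The
    change of coordinates is given by the 1-jet of the embedding, whose Gram
    matrix is that of (1, F) up to the sign s, completed by an orthonormal basis
    of its orthogonal. *)
Theorem normal_position :
  [/\ csgn (b 0%MM) = -1 -> l.*2 = n, normal_unit b 0%MM != 0,
      fl (normal_factor b) = fconst d (csgn (b 0%MM)) &
  exists (B : 'M[C]_(n.+2 + k, (n + k).+2))
    (c : 'I_n.+2 -> fps C d) (phi : 'I_k -> fps C d),
  [/\ (B : 'M_((n + k).+2)) \in unitmx /\
        B *m J *m B^t* = block_mx (csgn (b 0%MM) *: Jn) 0 0 (- 1%:M),
      forall i, normal_unit b * hom H i = linmul (vjoin c phi) B i,
      forall i, vanish mdeg 2 (c i - hom F i), forall t, vanish mdeg 2 (phi t)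
    & fconst _ (csgn (b 0%MM)) * herm_vec l c - norm2 phi = normal_factor b * r0]].
Proof.
have [K [Bu BJ]] := @complete_basis C n.+2 k J W (adj_form_mx _ _ _) W_unit W_neg.
rewrite W_gram in BJ.
pose B := col_mx W K; pose uH i := u * hom H i.
pose Y : 'I_(n.+2 + k) -> fps C d := linmul uH (invmx (B : 'M_((n + k).+2))).
pose c i := Y (lshift k i); pose phi t := Y (rshift n.+2 t).
have Ycp : Y = vjoin c phi.
  by apply/funext => i; rewrite /vjoin; case: (split_ordP i) => j ->.
have uHE i : uH i = linmul Y B i.
  move: i; apply: cvec_inj => x; rewrite cvec_linmul /Y cvec_linmul.
  exact: esym (@mulmxKV C (n + k).+2 1 B Bu (cvec uH x)).
have jY a : cvec Y (mono a) = row_mx (cvec (hom F) (mono a)) 0.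
  rewrite /Y cvec_linmul -row_jet -/V.
  have VE : V = BF *m W by rewrite /W mulKVmx.
  rewrite VE row_mul row_jet.
  have -> : cvec (hom F) (mono a) *m W = row_mx (cvec (hom F) (mono a)) 0 *m B.
    by rewrite mul_row_col mul0mx addr0.
  exact: (@mulmxK C (n + k).+2 1 B Bu (row_mx (cvec (hom F) (mono a)) 0)).
split; [exact: s_half|by rewrite -/u u0 invr_eq0|exact: fl_b'|].
exists B, c, phi; split.
- by split.
- by move=> i; rewrite -Ycp -uHE.
- move=> i; apply: vanish2_mono => a; rewrite coefB.
  have /rowP /(_ (lshift k i)) := jY a; rewrite row_mxEl !mxE => E.
  by rewrite [c i _]E subrr.
- move=> j; apply: vanish2_mono => a.
  by have /rowP /(_ (rshift n.+2 j)) := jY a; rewrite row_mxEr !mxE => E; apply: E.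
- rewrite -HE' -(herm_split Y BJ).
  by congr herm_vec; apply/funext => i; rewrite -uHE.
Qed.

End NormalPosition.

(** * Convergence of quotients of affine functions *)

Section AffineQuotients.
Variable C : numClosedFieldType.

Lemma mevalE_bound d (p : {mpoly C[d]}) v k : (msize p <= k)%N ->
  p.@[v] = \sum_(m : 'X_{1..d < k}) p@_m * \prod_i v i ^+ m i.
Proof.
move=> pk; rewrite {1}(mpolywE pk) raddf_sum /=; apply: eq_bigr => m _.
by rewrite mevalZ mevalX.
Qed.

Lemma meval_ftrunc d k (f : fps C d) (v : 'I_d -> C) :
  (ftrunc k f).@[v] = \sum_(m : 'X_{1..d < k.+1}) f m * \prod_i v i ^+ m i.
Proof.
rewrite /ftrunc raddf_sum /=; apply: eq_bigr => m _.
by rewrite mevalZ mevalX.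
Qed.

Lemma meval_norm_le d (p q : {mpoly C[d]}) (v x : 'I_d -> C) :
    (forall m, `|p@_m| <= q@_m) -> (forall i, `|v i| <= x i) ->
  `|p.@[v]| <= q.@[x].
Proof.
move=> pq vx; pose k := maxn (msize p) (msize q).
rewrite (@mevalE_bound _ p _ k) ?leq_maxl // (@mevalE_bound _ q _ k) ?leq_maxr //.
apply: (le_trans (ler_norm_sum _ _ _)); apply: ler_sum => m _.
rewrite normrM ler_pM ?normr_ge0 ?pq // normr_prod ler_prod // => i _; rewrite normr_ge0 normrX /=.
by rewrite lerXn2r ?nnegrE ?normr_ge0 // (le_trans (normr_ge0 _) (vx i)).
Qed.

Lemma meval_ge0 d (p : {mpoly C[d]}) (x : 'I_d -> C) :
  (forall m, 0 <= p@_m) -> (forall i, 0 <= x i) -> 0 <= p.@[x].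
Proof.
move=> p0 x0; rewrite (mevalE_bound _ (leqnn _)); apply: sumr_ge0 => m _.
by rewrite mulr_ge0 // prodr_ge0 // => i _; rewrite exprn_ge0.
Qed.

Definition fabs d (f : fps C d) : fps C d := fun m => `|f m|.

Section Estimate.
Variables (d : nat) (a0 : C) (a c : 'I_d -> C) (f : fps C d) (Z : 'cV[C]_d).
Hypothesis a0_neq0 : a0 != 0.
Hypothesis fE : (fconst d a0 + flinear a) * f = flinear c.
Hypothesis aZ : \sum_i `|a i| * `|Z i 0| <= `|a0| / 2.

Let x i := `|Z i 0|.
Let v i := Z i 0.
Let abs_a : {mpoly C[d]} := \sum_i `|a i| *: 'X_i.
Let abs_c : {mpoly C[d]} := \sum_i `|c i| *: 'X_i.
Let theta := \sum_i `|a i| * x i.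

Let x_ge0 i : 0 <= x i. Proof. exact: normr_ge0. Qed.

Let eval_abs_a : abs_a.@[x] = theta.
Proof. by rewrite raddf_sum; apply: eq_bigr => i _; rewrite /= mevalZ mevalXU. Qed.

Let a0_gt0 : 0 < `|a0|. Proof. by rewrite normr_gt0. Qed.

Let coef_linM (b : 'I_d -> C) (g : fps C d) m :
  (flinear b * g) m = \sum_i b i * (fvar C i * g) m.
Proof.
rewrite /flinear mulr_suml coef_sum; apply: eq_bigr => i _.
by rewrite -mulrA coef_constM.
Qed.

Let recursion m : a0 * f m = flinear c m - \sum_i a i * (fvar C i * f) m.
Proof. by rewrite -fE mulrDl coefD coef_constM coef_linM addrK. Qed.

Let coef_varM_poly i (p : {mpoly C[d]}) m : ('X_i * p)@_m = (fvar C i * fpoly p) m.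
Proof. by rewrite -rmorphM. Qed.

Let coef_abs_aM (p : {mpoly C[d]}) m :
  (abs_a * p)@_m = \sum_i `|a i| * (fvar C i * fpoly p) m.
Proof.
rewrite mulr_suml raddf_sum; apply: eq_bigr => i _.
by rewrite /= -scalerAl mcoeffZ coef_varM_poly.
Qed.

(** The absolute values of the terms of degree k. *)
Let tail k : {mpoly C[d]} := ftrunc k (fabs f) - ftrunc k.-1 (fabs f).

Let coef_tail k m : (0 < k)%N -> (tail k)@_m = if mdeg m == k then `|f m| else 0.
Proof.
move=> k0; rewrite mcoeffB !mcoeff_ftrunc /fabs.
case: ltngtP => mk.
- by rewrite (_ : (mdeg m <= k.-1)%N = true) ?subrr //; lia.
- by rewrite (_ : (mdeg m <= k.-1)%N = false) ?subrr //; lia.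
- by rewrite (_ : (mdeg m <= k.-1)%N = false) ?subr0 //; lia.
Qed.

Let theta_le (y : C) : 0 <= y -> theta * y <= `|a0| * (y / 2).
Proof. by move=> y0; rewrite mulrA mulrAC ler_wpM2r. Qed.

(** The coefficients satisfy a0 f = c - a f, so the partial sum A of absolute
    values satisfies |a0| A <= |c| + |a| A, and |a| is at most |a0| / 2 at Z. *)
Lemma quotient_abs_bound k :
  (ftrunc k (fabs f)).@[x] <= 2 * abs_c.@[x] / `|a0|.
Proof.
set A := ftrunc k (fabs f).
have A0 : 0 <= A.@[x].
  apply: meval_ge0 => // m; rewrite mcoeff_ftrunc; case: ifP => // _; exact: normr_ge0.
have : `|(`|a0| *: A).@[x]| <= (abs_c + abs_a * A).@[x].
  apply: meval_norm_le => // [m|i]; last by rewrite normr_id.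
  rewrite mcoeffZ mcoeffD coef_abs_aM normrM normr_id /A mcoeff_ftrunc.
  have cm : `|flinear c m| <= abs_c@_m.
    rewrite raddf_sum /flinear coef_sum; apply: (le_trans (ler_norm_sum _ _ _)).
    apply: ler_sum => i _; rewrite coef_constM coef_fvar /= mcoeffZ mcoeffX eq_sym.
    by rewrite normrM normr_nat.
  have s0 : 0 <= \sum_i `|a i| * (fvar C i * fpoly (ftrunc k (fabs f))) m.
    apply: sumr_ge0 => i _; rewrite mulr_ge0 // coef_varM; case: ifP => // _.
    by rewrite /fpoly mcoeff_ftrunc; case: ifP => // _; apply: normr_ge0.
  case: leqP => mk; last first.
    by rewrite normr0 mulr0 addr_ge0 // (le_trans (normr_ge0 _) cm).
  rewrite /fabs normr_id -normrM recursion.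
  apply: (le_trans (ler_normB _ _)); apply: lerD => //.
  apply: (le_trans (ler_norm_sum _ _ _)); apply: ler_sum => i _.
  rewrite normrM ler_wpM2l // !coef_varM; case: ifP => mi; last by rewrite normr0.
  rewrite /fpoly mcoeff_ftrunc /fabs.
  suff -> : (mdeg (m - U_(i)) <= k)%N by [].
  apply: leq_trans mk; rewrite -[X in (_ <= mdeg X)%N](@submK _ U_(i)%MM m).
    by rewrite mdegD leq_addr.
  by apply/mnm_lepP => j; rewrite mnm1E; case: eqP => // <-.
rewrite mevalZ normrM normr_id (ger0_norm A0) mevalD mevalM eval_abs_a => le1.
have : `|a0| * (A.@[x] / 2) <= abs_c.@[x].
  rewrite -(lerD2r (`|a0| * (A.@[x] / 2))) -mulrDr -splitr.
  by apply: (le_trans le1); rewrite lerD2l theta_le.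
rewrite mulrA ler_pdivrMr ?ltr0n // [in leLHS]mulrC => le2.
by rewrite ler_pdivlMr // [2 * _]mulrC.
Qed.

Let tail_ge0 k : (0 < k)%N -> 0 <= (tail k).@[x].
Proof.
by move=> k0; apply: meval_ge0 => // m; rewrite coef_tail //; case: ifP.
Qed.

(** In degree above 1 the recursion reads a0 f = - a f, which loses a factor 2 per
    degree. *)
Let tail_step k : (0 < k)%N -> (tail k.+1).@[x] <= (tail k).@[x] / 2.
Proof.
move=> k0.
have : `|(`|a0| *: tail k.+1).@[x]| <= (abs_a * tail k).@[x].
  apply: meval_norm_le => // [m|i]; last by rewrite normr_id.
  rewrite mcoeffZ coef_abs_aM normrM normr_id coef_tail //.
  have s0 : 0 <= \sum_i `|a i| * (fvar C i * fpoly (tail k)) m.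
    apply: sumr_ge0 => i _; rewrite mulr_ge0 // coef_varM; case: ifP => // _.
    by rewrite /fpoly coef_tail //; case: ifP.
  case: eqP => mk; last by rewrite normr0 mulr0.
  have cm : flinear c m = 0.
    rewrite /flinear coef_sum big1 // => i _; rewrite coef_constM coef_fvar.
    case: eqP => [e|]; last by rewrite mulr0.
    by move: mk; rewrite e mdeg1; lia.
  rewrite normr_id -normrM recursion cm sub0r normrN.
  apply: (le_trans (ler_norm_sum _ _ _)); apply: ler_sum => i _.
  rewrite normrM ler_wpM2l // !coef_varM; case: ifP => mi; last by rewrite normr0.
  rewrite /fpoly coef_tail //.
  suff -> : mdeg (m - U_(i)) == k by [].
  have := mdegD (m - U_(i))%MM U_(i)%MM; rewrite submK; first by rewrite mdeg1 mk; lia.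
  by apply/mnm_lepP => j; rewrite mnm1E; case: eqP => // <-.
rewrite mevalZ normrM normr_id ger0_norm ?tail_ge0 // mevalM eval_abs_a => le1.
rewrite -(ler_pM2l a0_gt0); apply: (le_trans le1); apply: theta_le.
exact: tail_ge0.
Qed.

Let tail_geom k : (tail k.+1).@[x] <= (tail 1).@[x] / 2 ^+ k.
Proof.
elim: k => [|k IH]; first by rewrite expr0 divr1.
apply: (le_trans (tail_step (ltn0Sn _))).
by rewrite exprSr invfM mulrA ler_wpM2r // invr_ge0.
Qed.

Let lam := a0 + \sum_i a i * Z i 0.

Let sum_le : `|\sum_i a i * Z i 0| <= `|a0| / 2.
Proof.
apply: le_trans aZ; apply: (le_trans (ler_norm_sum _ _ _)).
by apply: ler_sum => i _; rewrite normrM.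
Qed.

Lemma affine_lower_bound : `|a0| / 2 <= `|lam|.
Proof.
have := lerB_dist a0 (- \sum_i a i * Z i 0); rewrite opprK normrN; apply: le_trans.
by rewrite lerBrDr {2}[`|a0|]splitr lerD2l.
Qed.

Lemma affine_neq0 : lam != 0.
Proof.
by rewrite -normr_gt0; apply: lt_le_trans affine_lower_bound; rewrite divr_gt0 // ltr0n.
Qed.

(** The partial sum S satisfies lam S = mu up to the product of a with the last
    homogeneous part of S. *)
Lemma quotient_error k :
  `|(ftrunc k.+1 f).@[v] - (\sum_i c i * Z i 0) / lam| <= (tail 1).@[x] / 2 ^+ k.
Proof.
set S := (ftrunc k.+1 f).@[v]; set mu := \sum_i c i * Z i 0.
pose lamP : {mpoly C[d]} := a0%:MP + \sum_i a i *: 'X_i.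
pose muP : {mpoly C[d]} := \sum_i c i *: 'X_i.
have lamE : lamP.@[v] = lam.
  rewrite mevalD mevalC raddf_sum; congr (_ + _); apply: eq_bigr => i _.
  by rewrite /= mevalZ mevalXU.
have muE : muP.@[v] = mu.
  by rewrite /muP /mu raddf_sum; apply: eq_bigr => i _; rewrite /= mevalZ mevalXU.
have err : `|lam * S - mu| <= theta * (tail k.+1).@[x].
  rewrite -lamE -muE -mevalM -mevalB -eval_abs_a -mevalM.
  apply: meval_norm_le => // m; rewrite coef_abs_aM.
  have muc : muP@_m = flinear c m.
    rewrite raddf_sum /flinear coef_sum; apply: eq_bigr => i _.
    by rewrite coef_constM coef_fvar /= mcoeffZ mcoeffX eq_sym.
  have lamc : (lamP * ftrunc k.+1 f)@_m =
      a0 * (ftrunc k.+1 f)@_m + \sum_i a i * (fvar C i * fpoly (ftrunc k.+1 f)) m.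
    rewrite mulrDl mcoeffD mul_mpolyC mcoeffZ; congr (_ + _).
    rewrite mulr_suml raddf_sum.
    by apply: eq_bigr => i _; rewrite /= -scalerAl mcoeffZ coef_varM_poly.
  rewrite mcoeffB lamc muc mcoeff_ftrunc.
  have dU i : (0 < m i)%N -> mdeg m = (mdeg (m - U_(i))).+1.
    move=> mi; have := mdegD (m - U_(i))%MM U_(i)%MM; rewrite submK ?mdeg1 ?addn1 //.
    by apply/mnm_lepP => j; rewrite mnm1E; case: eqP => // <-.
  case: leqP => mk.
    have -> : \sum_i a i * (fvar C i * fpoly (ftrunc k.+1 f)) m =
        \sum_i a i * (fvar C i * f) m.
      apply: eq_bigr => i _; rewrite !coef_varM; case: ifP => mi //.
      rewrite /fpoly mcoeff_ftrunc (_ : (mdeg (m - U_(i)) <= k.+1)%N) //.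
      by move: mk; rewrite (dU _ mi); lia.
    rewrite recursion subrK subrr normr0.
    apply: sumr_ge0 => i _; rewrite mulr_ge0 // coef_varM; case: ifP => // _.
    by rewrite /fpoly coef_tail //; case: ifP.
  have cm : flinear c m = 0.
    rewrite /flinear coef_sum big1 // => i _; rewrite coef_constM coef_fvar.
    case: eqP => [e|]; last by rewrite mulr0.
    by move: mk; rewrite e mdeg1; lia.
  rewrite mulr0 add0r cm subr0.
  apply: (le_trans (ler_norm_sum _ _ _)); apply: ler_sum => i _.
  rewrite normrM ler_wpM2l // !coef_varM; case: ifP => mi; last by rewrite normr0.
  rewrite /fpoly coef_tail // mcoeff_ftrunc.
  have := dU _ mi; case: leqP => mk'; last by rewrite normr0; case: ifP.
  by move=> e; rewrite (_ : mdeg _ == k.+1) //; move: mk; rewrite e; lia.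
have -> : S - mu / lam = (lam * S - mu) / lam.
  by rewrite mulrBl mulrAC mulfV ?affine_neq0 // mul1r.
have lam0 : 0 < `|lam| by rewrite normr_gt0 affine_neq0.
rewrite normrM normfV ler_pdivrMr //; apply: (le_trans err).
apply: (le_trans (theta_le (tail_ge0 (ltn0Sn _)))).
rewrite mulrCA; apply: (@le_trans _ _ ((tail k.+1).@[x] * `|lam|)).
  by rewrite ler_wpM2l ?tail_ge0 // affine_lower_bound.
by rewrite ler_wpM2r // tail_geom.
Qed.

End Estimate.

(** On the polydisc where \sum_i |a_i| |Z_i| <= |a0| / 2 the homogeneous parts of
    the series decay like 2^-k.  That 2^-k tends to 0 is an assumption on C, as it
    fails over a field with infinitesimals. *)
Lemma quotient_converges d (a0 : C) (a : 'I_d -> C) :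
    (forall b e : C, 0 <= b -> 0 < e -> exists k, b / 2 ^+ k < e) -> a0 != 0 ->
  near0 (fun Z : 'cV[C]_d => a0 + \sum_i a i * Z i 0 != 0 /\
    forall c f, (fconst d a0 + flinear a) * f = flinear c ->
      converges_to f Z ((\sum_i c i * Z i 0) / (a0 + \sum_i a i * Z i 0))).
Proof.
move=> arch a00; pose N := 1 + \sum_i `|a i|.
have N0 : 0 < N by rewrite ltr_pwDl // sumr_ge0.
(* N bounds the sum of the |a_i| and is nonzero. *)
exists (`|a0| / 2 / N); first by rewrite !divr_gt0 ?normr_gt0 ?ltr0n.
move=> Z Zr.
have aZ : \sum_i `|a i| * `|Z i 0| <= `|a0| / 2.
  apply: (@le_trans _ _ (\sum_i `|a i| * (`|a0| / 2 / N))).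
    by apply: ler_sum => i _; rewrite ler_wpM2l // ltW.
  rewrite -mulr_suml mulrCA -[leRHS]mulr1 ler_wpM2l ?divr_ge0 //.
  by rewrite ler_pdivrMr // mul1r lerDr.
split=> [|c f fE]; first exact: affine_neq0.
have fterm_abs (g : fps C d) (m : 'X_{1..d}) : `|fterm g Z m| =
    fabs g m * \prod_i `|Z i 0| ^+ m i.
  rewrite /fterm normrM normr_prod; congr (_ * _).
  by apply: eq_bigr => i _; rewrite normrX.
split.
  exists (2 * (\sum_i `|c i| *: 'X_i : {mpoly C[d]}).@[fun i => `|Z i 0|] / `|a0|).
  case=> [|k].
    rewrite big1 => [|m _]; last by have := bmdeg m; rewrite ltn0.
    apply: le_trans (quotient_abs_bound a00 fE aZ 0); apply: meval_ge0 => // m.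
    by rewrite mcoeff_ftrunc; case: ifP => // _; apply: normr_ge0.
  apply: le_trans (quotient_abs_bound a00 fE aZ k); rewrite meval_ftrunc.
  by apply: ler_sum => m _; rewrite fterm_abs.
move=> e e0; set T : {mpoly C[d]} := ftrunc 1 (fabs f) - ftrunc 0 (fabs f).
have T0 : 0 <= T.@[fun i => `|Z i 0|].
  apply: meval_ge0 => // m; rewrite mcoeffB !mcoeff_ftrunc.
  by case: (mdeg m) => [|[|j]]; rewrite /= ?subrr ?subr0 //; apply: normr_ge0.
have [k ke] := arch _ _ T0 e0.
exists k.+2 => [[|[|j]]] // jk; rewrite -meval_ftrunc.
have := quotient_error a00 fE aZ j => /le_lt_trans; apply; apply: le_lt_trans ke.
rewrite ler_wpM2l // lef_pV2 ?posrE ?exprn_gt0 ?ltr0n //.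
by rewrite ler_weXn2l ?ler1n.
Qed.

End AffineQuotients.

(** * Fractional linear automorphisms *)

Section FractionalLinear.
Variables (C : numClosedFieldType) (m l : nat).
Local Open Scope sesquilinear_scope.
Local Notation J := (form_mx C m l).
Hypothesis arch : forall b e : C, 0 <= b -> 0 < e -> exists k, b / 2 ^+ k < e.

Definition hvec (Z : 'cV[C]_m.+1) : 'rV[C]_m.+2 :=
  \row_i if unlift ord0 i is Some j then Z j 0 else 1.

(** Vectors are rows, and matrices act on them from the right. *)
Definition frac_map (T : 'M[C]_m.+2) (Z : 'cV[C]_m.+1) : 'cV[C]_m.+1 :=
  \col_j ((hvec Z *m T) 0 (lift ord0 j) / (hvec Z *m T) 0 ord0).

Definition frac_taylor (T : 'M[C]_m.+2) : fmap C m.+1 m.+1 := fun j =>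
  finv (linmul (hom (fun i => fvar C i)) T ord0)
  * linmul (hom (fun i => fvar C i)) T (lift ord0 j).

Definition fixes0 (T : 'M[C]_m.+2) := forall i, T ord0 (lift ord0 i) = 0.

Lemma hvec0 Z : hvec Z 0 ord0 = 1. Proof. by rewrite mxE unlift_none. Qed.
Lemma hvecS Z j : hvec Z 0 (lift ord0 j) = Z j 0. Proof. by rewrite mxE liftK. Qed.

Lemma hvecM Z (T : 'M[C]_m.+2) i : (hvec Z *m T) 0 i =
  T ord0 i + \sum_j T (lift ord0 j) i * Z j 0.
Proof.
rewrite mxE big_ord_recl hvec0 mul1r; congr (_ + _); apply: eq_bigr => j _.
by rewrite hvecS mulrC.
Qed.

Lemma linmul_hom d (G : fmap C d m.+1) (T : 'M[C]_m.+2) i : linmul (hom G) T i =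
  fconst d (T ord0 i) + \sum_j fconst d (T (lift ord0 j) i) * G j.
Proof.
rewrite /linmul big_ord_recl hom0 mulr1; congr (_ + _); apply: eq_bigr => j _.
by rewrite homS.
Qed.

Lemma fixes0_neq0 T : T \in unitmx -> fixes0 T -> T ord0 ord0 != 0.
Proof.
move=> Tu T0; apply/negP => /eqP T00.
have : delta_mx 0 ord0 *m T = 0 :> 'rV_m.+2.
  rewrite -rowE; apply/rowP => i; rewrite !mxE.
  by case: (unliftP ord0 i) => [j ->|->].
move/(congr1 (fun M => M *m invmx T)); rewrite mulmxK // mul0mx.
by move=> /rowP /(_ ord0) /eqP; rewrite !mxE !eqxx oner_eq0.
Qed.

Lemma fixes0_inv T : T \in unitmx -> fixes0 T -> fixes0 (invmx T).
Proof.
move=> Tu T0 i; have T00 := fixes0_neq0 Tu T0.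
have E : delta_mx 0 ord0 *m T = T ord0 ord0 *: delta_mx 0 ord0 :> 'rV_m.+2.
  rewrite -rowE; apply/rowP => j; rewrite !mxE eqxx /=.
  by case: (unliftP ord0 j) => [j' ->|->]; rewrite ?T0 ?mulr0 ?eqxx ?mulr1.
have /(congr1 (fun M => M *m invmx T)) := E; rewrite mulmxK // -scalemxAl -rowE.
move=> /rowP /(_ (lift ord0 i)); rewrite !mxE eqxx /= => /esym/eqP.
by rewrite mulf_eq0 (negbTE T00) => /eqP.
Qed.

Lemma frac_taylorE (T : 'M[C]_m.+2) j : T \in unitmx -> fixes0 T ->
  (fconst _ (T ord0 ord0) + flinear (fun i => T (lift ord0 i) ord0)) * frac_taylor T j
  = flinear (fun i => T (lift ord0 i) (lift ord0 j)).
Proof.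
move=> Tu T0; rewrite /frac_taylor !linmul_hom T0 rmorph0 add0r mulrA.
rewrite fmulV ?mul1r // coefD coef_fconst eqxx -/(flinear _) flinear0 addr0.
exact: fixes0_neq0.
Qed.

Lemma frac_taylor_converges (T : 'M[C]_m.+2) : T \in unitmx -> fixes0 T ->
  near0 (fun Z => (hvec Z *m T) 0 ord0 != 0 /\
    forall i, converges_to (frac_taylor T i) Z (frac_map T Z i 0)).
Proof.
move=> Tu T0; have T00 := fixes0_neq0 Tu T0.
have [r r0 rZ] := quotient_converges (fun i => T (lift ord0 i) ord0) arch T00.
exists r => // Z /rZ [ne cv]; split=> [|i]; first by rewrite hvecM.
rewrite mxE !hvecM T0 add0r; apply: cv.
exact: frac_taylorE.
Qed.

Lemma hvec_frac_map T Z : (hvec Z *m T) 0 ord0 != 0 ->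
  hvec (frac_map T Z) = ((hvec Z *m T) 0 ord0)^-1 *: (hvec Z *m T).
Proof.
move=> ne; apply/rowP => i; rewrite [LHS]mxE [RHS]mxE.
case: (unliftP ord0 i) => [j ->|->]; last by rewrite mulVf.
by rewrite mxE mulrC.
Qed.

Lemma frac_map_inv T Z : T \in unitmx -> (hvec Z *m T) 0 ord0 != 0 ->
  frac_map (invmx T) (frac_map T Z) = Z.
Proof.
move=> Tu ne; apply/colP => i; rewrite mxE hvec_frac_map // -scalemxAl mulmxK //.
by rewrite [X in X / _]mxE [X in _ / X]mxE hvecS hvec0 mulr1 mulrAC mulfV ?mul1r // invr_eq0.
Qed.

Lemma hyperquadric_pointsE (Z : 'cV[C]_m.+1) :
  hyperquadric_points l Z <-> (hvec Z *m J *m (hvec Z)^t*) 0 0 = 0.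
Proof.
rewrite form_mxE !hvecS hvec0 rmorph1 mulr1 mul1r /hyperquadric_points.
rewrite (form_lE l (idfun : {rmorphism C -> C})) /=.
have -> : 'Im (Z (wi m) 0) = (2 * 'i)^-1 * (Z (wi m) 0 - (Z (wi m) 0)^*).
  rewrite ImE invfM invCi mulrAC; ring.
under [X in _ <-> _ - X = _]eq_bigr => j _ do rewrite hvecS.
by split=> [->|/eqP]; rewrite ?subrr // subr_eq0 => /eqP.
Qed.

(** The hyperquadric is the isotropic cone of the form in the affine chart
    x_0 = 1, so a matrix preserving the form acts on it; its inverse provides
    the inverse germ. *)
Lemma frac_map_aut (T : 'M[C]_m.+2) : T \in unitmx -> fixes0 T ->
  T *m J *m T^t* = J -> hyperquadric_aut l (frac_taylor T).
Proof.
move=> Tu T0 TJ; have Tiu : invmx T \in unitmx by rewrite unitmx_inv.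
have Ti0 := fixes0_inv Tu T0.
have [r r0 rT] := frac_taylor_converges Tu T0.
have [r' r'0 r'T] := frac_taylor_converges Tiu Ti0.
exists (frac_map T), (frac_map (invmx T)), (frac_taylor (invmx T)); split.
- by split; [exists r => // Z /rT []|exists r' => // Z /r'T []].
- apply/colP => i; rewrite mxE hvecM T0 add0r big1 ?mul0r ?mxE // => j _.
  by rewrite mxE mulr0.
- by exists r => // Z /rT [ne _]; apply: frac_map_inv.
- exists r' => // Z /r'T [ne _]; rewrite -{1}[T]invmxK.
  exact: frac_map_inv.
- exists r => // Z /rT [ne _]; rewrite !hyperquadric_pointsE hvec_frac_map //.
  set a := _^-1; have a0 : a != 0 by rewrite invr_eq0.
  have -> : (a *: (hvec Z *m T))^t* = a^* *: (T^t* *m (hvec Z)^t*).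
    by rewrite -adj_mul; apply/matrixP => i j; rewrite !mxE rmorphM.
  rewrite -!scalemxAl -scalemxAr.
  have -> : hvec Z *m T *m J *m (T^t* *m (hvec Z)^t*) = hvec Z *m J *m (hvec Z)^t*.
    by rewrite -[in RHS]TJ !mulmxA.
  rewrite [X in _ <-> X = _]mxE [X in _ <-> _ * X = _]mxE.
  split=> [->|/eqP]; first by rewrite !mulr0.
  by rewrite !mulf_eq0 conjC_eq0 (negbTE a0) => /eqP.
Qed.

(** Division by the denominator is avoided: composing with the map amounts to
    multiplying homogeneous vectors by the matrix, up to a common factor. *)
Lemma fsub_frac_taylor d (G : fmap C d m.+1) (T : 'M[C]_m.+2) j :
    (forall i, G i 0%MM = 0) -> T \in unitmx -> fixes0 T ->
  linmul (hom G) T ord0 * fsub G (frac_taylor T j) = linmul (hom G) T (lift ord0 j).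
Proof.
move=> G0 Tu T0; have := congr1 (fsub G) (frac_taylorE j Tu T0).
rewrite rmorphM rmorphD /= fsub_const !fsub_flinear !linmul_hom T0 rmorph0 add0r.
by under eq_bigr => i _ do rewrite fcenter_id //;
   under [in X in _ = X -> _]eq_bigr => i _ do rewrite fcenter_id //.
Qed.

End FractionalLinear.

(** * Change of coordinates and the linear embedding *)

Section Transport.
Variable C : numClosedFieldType.
Local Open Scope sesquilinear_scope.

Lemma pull2_lr d e (P : fmap C d e) f g :
  pull2 P (lft f * rgt (fconj g)) = lft (fsub P f) * rgt (fconj (fsub P g)).
Proof. by rewrite (rmorphM (pull2 P)) /= pull2_lft pull2_rgt. Qed.

Lemma pull2_constM d e (P : fmap C d e) c f :
  pull2 P (fconst _ c * f) = fconst _ c * pull2 P f.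
Proof. by rewrite (rmorphM (pull2 P)) /= pull2_const. Qed.

Lemma pull2_herm_vec d e m l (P : fmap C d e) (Y : 'I_m.+2 -> fps C e) :
  pull2 P (herm_vec l Y) = herm_vec l (fun i => fsub P (Y i)).
Proof.
rewrite /herm_vec /herm_form rmorphB; congr (_ - _).
  by rewrite /= pull2_constM rmorphB /= !pull2_lr.
by rewrite rmorph_sum; apply: eq_bigr => j _; rewrite /= pull2_constM pull2_lr.
Qed.

Lemma pull2_norm2 d e k (P : fmap C d e) (p : 'I_k -> fps C e) :
  pull2 P (norm2 p) = norm2 (fun t => fsub P (p t)).
Proof. by rewrite /norm2 rmorph_sum; apply: eq_bigr => t _; rewrite /= pull2_lr. Qed.

Lemma norm2M d k (p : 'I_k -> fps C d) u :
  norm2 (fun t => u * p t) = lft u * rgt (fconj u) * norm2 p.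
Proof.
rewrite /norm2 mulr_sumr; apply: eq_bigr => t _.
by rewrite (rmorphM (@fconj C d)) !rmorphM; apply: mulrACA.
Qed.

(** Substituting H into the equation of the hyperquadric evaluates the form at
    the homogeneous vector (1, H). *)
Lemma hyperquadric_pull d m l (H : fmap C d m.+1) : (forall i, H i 0%MM = 0) ->
  fcomp (fpoly (hyperquadric_poly C m l)) (fmap_with_bar H) = herm_vec l (hom H).
Proof.
move=> H0; rewrite -[LHS]/(pull2 H _) /hyperquadric_poly.
have fZ a (p : {mpoly C[m.+1 + m.+1]}) : fpoly (a *: p) = fconst _ a * fpoly p.
  by rewrite -mul_mpolyC rmorphM.
have vl i : pull2 H (fpoly 'X_(lshift m.+1 i)) = lft (H i).
  rewrite -[fpoly _]/(fvar C (lshift m.+1 i)) -lft_var pull2_lft fsub_var.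
  by rewrite fcenter_id.
have vr i : pull2 H (fpoly 'X_(rshift m.+1 i)) = rgt (fconj (H i)).
  rewrite -[fpoly _]/(fvar C (rshift m.+1 i)) -rgt_var -fconj_var pull2_rgt fsub_var.
  by rewrite fcenter_id.
rewrite rmorphB rmorphB /= fZ (rmorphM (pull2 H)) /= pull2_const rmorphB rmorphB /= vl vr.
rewrite /herm_vec /herm_form hom0 !homS; congr (_ - _).
  by rewrite !rmorph1 mulr1 mul1r.
have -> : form_l l (fun j => 'X_(lshift m.+1 (zi j)))
    (fun j => 'X_(rshift m.+1 (zi j))) =
    \sum_j (eps C l j)%:MP * ('X_(lshift m.+1 (zi j)) * 'X_(rshift m.+1 (zi j)))
    :> {mpoly C[m.+1 + m.+1]}.
  exact: (form_lE l (mpolyC (m.+1 + m.+1) (R := C) : {rmorphism C -> _})).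
rewrite !rmorph_sum; apply: eq_bigr => j _.
rewrite (rmorphM (@fpoly _ _)) (rmorphM (pull2 H)) (rmorphM (@fpoly _ _)).
rewrite (rmorphM (pull2 H)) /= vl vr !homS; congr (_ * _).
exact: pull2_const.
Qed.

Section TangentialPart.
Variables (n l k k' : nat) (s : C) (F : fmap C n.+1 n.+1).
Variables (c c' : 'I_n.+2 -> fps C n.+1).
Variables (p : 'I_k -> fps C n.+1) (p' : 'I_k' -> fps C n.+1).
Hypothesis F0 : forall i, F i 0%MM = 0.
Hypothesis F_unit : fmap_jacobian F \in unitmx.
Hypothesis s0 : s != 0.
Hypothesis cF : forall i, vanish mdeg 2 (c i - hom F i).
Hypothesis cF' : forall i, vanish mdeg 2 (c' i - hom F i).
Hypothesis p2 : forall t, vanish mdeg 2 (p t).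
Hypothesis p2' : forall t, vanish mdeg 2 (p' t).

Lemma jet_hom_unit : jet (hom F) \in unitmx.
Proof.
rewrite -row_free_unit; apply: jet_hom_free => // v.
by move/(congr1 (mulmx (invmx (fmap_jacobian F)))); rewrite mulKmx // mulmx0.
Qed.

(** Polarization: the rows of the equation at the monomials of degree at most 1
    only see the 1-jets of the vectors on the left, which are those of (1, F)
    and form a basis.  So they determine c. *)
Lemma tangential_part :
  fconst _ s * herm_vec l c - norm2 p = fconst _ s * herm_vec l c' - norm2 p' ->
  forall i, c i = c' i.
Proof.
move=> E; apply: cvec_inj => y; apply: (@adj_inj C); rewrite /=.
have cancel_unit (A : 'M[C]_n.+2) (M N : 'M[C]_(n.+2, 1)) : A \in unitmx ->
    A *m M = A *m N -> M = N.
  by move=> Au /(congr1 (mulmx (invmx A))); rewrite !mulKmx.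
apply: (cancel_unit _ _ _ (form_mx_unit C n l)).
apply: (cancel_unit _ _ _ jet_hom_unit); apply/matrixP => a j.
have jc (c0 : 'I_n.+2 -> fps C n.+1) : (forall i, vanish mdeg 2 (c0 i - hom F i)) ->
    cvec c0 (mono a) = row a (jet (hom F)).
  move=> c0F; rewrite row_jet; apply/rowP => i; rewrite !mxE.
  by apply: (eqmodE (c0F i)); rewrite ltnS mdeg_mono.
have val k0 (c0 : 'I_n.+2 -> fps C n.+1) (p0 : 'I_k0 -> fps C n.+1) :
    (forall i, vanish mdeg 2 (c0 i - hom F i)) -> (forall t, vanish mdeg 2 (p0 t)) ->
    ker (fconst _ s * herm_vec l c0 - norm2 p0) (mono a) y =
    s * (jet (hom F) *m (form_mx C n l *m (cvec c0 y)^t*)) a 0.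
  move=> c0F p02; rewrite kerB ker_norm2 big1 => [|t _]; last first.
    by rewrite p02 ?mul0r // ltnS mdeg_mono.
  rewrite subr0 ker_constM ker_herm_vec jc // -!row_mul mxE.
  by rewrite mulmxA.
have := congr1 (fun f => ker f (mono a) y) E; rewrite /= !val // => /(mulfI s0).
by rewrite (ord1 j).
Qed.

End TangentialPart.

Section LinearEmbedding.
Variables (d m m' l : nat) (mm' : (m <= m')%N) (H : fmap C d m.+1).
Hypothesis H0 : forall i, H i 0%MM = 0.

Let LH := fmap_comp (linear_embedding C m m') H.

Lemma linear_embedding_w : LH (wi m') = H (wi m).
Proof.
rewrite /LH /fmap_comp /linear_embedding unlift_none -[fcomp _ _]/(fsub H (fvar C (wi m))).
by rewrite fsub_var fcenter_id.
Qed.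

Lemma linear_embedding_z j : LH (zi j) =
  if (insub (val j) : option 'I_m) is Some a then H (zi a) else 0.
Proof.
rewrite /LH /fmap_comp /linear_embedding liftK.
case: insubP => [a _ _|_]; last by rewrite -[fcomp _ _]/(fsub H (fpoly 0)) !rmorph0.
by rewrite -[fcomp _ _]/(fsub H (fvar C (zi a))) fsub_var fcenter_id.
Qed.

Lemma linear_embedding0 i : LH i 0%MM = 0.
Proof.
case: (unliftP ord_max i) => [j ->|->]; last by rewrite linear_embedding_w H0.
by rewrite linear_embedding_z; case: insubP => [a _ _|_]; rewrite ?H0.
Qed.

(** The added coordinates are 0, and the negative squares keep their indices. *)
Lemma herm_linear_embedding : herm_vec l (hom LH) = herm_vec l (hom H).
Proof.
rewrite /herm_vec /herm_form !hom0 !homS linear_embedding_w; congr (_ - _).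
pose T (x : 'I_m) : fps C (d + d) :=
  fconst _ (eps C l x) * (lft (hom H (hz x)) * rgt (fconj (hom H (hz x)))).
pose G (j : nat) : fps C (d + d) := if (insub j : option 'I_m) is Some x then T x else 0.
transitivity (\sum_(j < m') G j).
  apply: eq_bigr => j _; rewrite /G /T !homS linear_embedding_z.
  case: insubP => [x _ xj|_]; first by rewrite homS /eps xj.
  by rewrite !rmorph0 !mulr0.
rewrite (bigID (fun j : 'I_m' => (j < m)%N)) /= [X in _ + X]big1 ?addr0; last first.
  by move=> j jm; rewrite /G insubF //; apply/negbTE.
rewrite -(big_ord_widen m' G mm'); apply: eq_bigr => j _.
by rewrite /G insubT //= => jm; rewrite /T; congr (fconst _ (eps C l _) * (lft (hom H (hz _)) * rgt (fconj (hom H (hz _))))); apply: val_inj.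
Qed.

Lemma linear_embedding_inj :
  injective (fun v : 'cV[C]_d => fmap_jacobian H *m v) ->
  injective (fun v : 'cV[C]_d => fmap_jacobian LH *m v).
Proof.
move=> Hi x y /= /matrixP xy; apply: Hi; apply/matrixP => i j.
case: (unliftP ord_max i) => [a ->|->].
  have := xy (zi (widen_ord mm' a)) j; rewrite !mxE.
  have E : LH (zi (widen_ord mm' a)) = H (zi a).
    rewrite linear_embedding_z insubT //= => am.
    by congr (H (zi _)); apply: val_inj.
  under eq_bigr => t _ do rewrite mxE E.
  under [in X in _ = X -> _]eq_bigr => t _ do rewrite mxE E.
  move=> e; etransitivity; [etransitivity; [|exact: e]|]; apply: eq_bigr => t _; rewrite mxE //.
have := xy (wi m') j; rewrite !mxE.
under eq_bigr => t _ do rewrite mxE linear_embedding_w.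
under [in X in _ = X -> _]eq_bigr => t _ do rewrite mxE linear_embedding_w.
by move=> e; etransitivity; [etransitivity; [|exact: e]|]; apply: eq_bigr => t _; rewrite mxE //.
Qed.

End LinearEmbedding.
End Transport.

(** * Comparison of two embeddings *)

Section Source.
Variables (C : numClosedFieldType) (n l : nat) (M : hypersurface C n.+1).
Local Notation d := n.+1.

(** Chain rule. *)
Lemma invertible_jacobian (p p' : 'cV[C]_d) (F : fmap C d d) :
  fmap_invertible p p' F -> fmap_jacobian F \in unitmx.
Proof.
case=> G [_ GF _].
have : fmap_jacobian G *m fmap_jacobian F = 1%:M.
  apply/matrixP => i j; rewrite !mxE.
  under eq_bigr => k _ do rewrite !mxE.
  rewrite -chain_rule -[fsub F (G i)]/(fmap_comp G F i) GF /fmap_id /fpoly.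
  rewrite mcoeffD mcoeffC mnm1_neq0 mulr0 add0r mcoeffX mnm1_inj.
  by [].
by case/mulmx1_unit.
Qed.

(** The equation r0 is that of the model pulled back by F, so the vanishing order
    of A makes it that of the hyperquadric at F up to order three.  It is a unit
    times the given equation, since both have a nonzero gradient. *)
Lemma source_equation : levi_nondegenerate_of_signature l M ->
  exists (F : fmap C d d) (r0 q : fps C (d + d)),
  [/\ forall i, F i 0%MM = 0, fmap_jacobian F \in unitmx,
      eqmod 3 r0 (herm_vec l (hom F)), r0 = q * hs_rho M & q 0%MM != 0].
Proof.
case=> M0 [A [F [pM0 rhoE A3 [[F_at [q qE]] Finv]]]].
have F0 i : F i 0%MM = 0.
  have Fat0 : fmap_at0 F = 0 by rewrite F_at.
  by have /colP /(_ i) := Fat0; rewrite !mxE.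
have Ju := invertible_jacobian Finv.
pose r0 := pull2 F (hs_rho M0).
have r0F : eqmod 3 r0 (herm_vec l (hom F)).
  have -> : r0 = herm_vec l (hom F) - pull2 F (fsub (@z_barz_Rew C n) A).
    rewrite -hyperquadric_pull // -[fcomp _ _]/(pull2 F _) -rmorphB; congr (pull2 F _).
    exact: fpsP rhoE.
  rewrite /eqmod addrAC subrr sub0r; apply: vanishN.
  by apply: pull2_vanish; apply: fsub_vanish => m; apply: A3.
exists F, r0, q; split=> //; apply/negP => /eqP q0.
have [i' ] := source_gradient F0 Ju r0F; rewrite [r0]qE fmulE.
rewrite /ker -mjoinUl coefM_U q0 hs_const mul0r mulr0 addr0.
by rewrite eqxx.
Qed.

Lemma embedding_equation m (r0 q : fps C (d + d)) (H : fmap C d m.+1) :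
    r0 = q * hs_rho M -> q 0%MM != 0 -> formal_embedding M (hyperquadric C m l) H ->
  [/\ forall i, H i 0%MM = 0, injective (fun v : 'cV_d => fmap_jacobian H *m v)
    & exists b, herm_vec l (hom H) = b * r0].
Proof.
move=> r0E q0 [[H_at [q' q'E]] Hinj].
have H0 i : H i 0%MM = 0 by have /colP /(_ i) := H_at; rewrite !mxE.
split=> //; exists (q' * finv q).
rewrite -hyperquadric_pull // -[fpoly _]/(hs_rho (hyperquadric C m l)) q'E fmulE.
by rewrite r0E -mulrA (mulrA (finv q)) [finv q * q]mulrC fmulV // mul1r.
Qed.

End Source.

Section Comparison.
Variable C : numClosedFieldType.
Local Open Scope sesquilinear_scope.
Variables (n l k1 k2 : nat).
Local Notation d := n.+1.
Hypothesis k_lt : (k1 + k2 < n)%N.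
Variables (F : fmap C d d) (r0 : fps C (d + d)).
Hypothesis F0 : forall i, F i 0%MM = 0.
Hypothesis F_unit : fmap_jacobian F \in unitmx.
Variables (s1 s2 : C) (q1 q2 : fps C (d + d)).
Hypothesis s1s1 : s1 * s1 = 1.
Hypothesis s2s2 : s2 * s2 = 1.
Variables (c1 c2 : 'I_n.+2 -> fps C d).
Variables (phi1 : 'I_k1 -> fps C d) (phi2 : 'I_k2 -> fps C d).
Hypothesis c1F : forall i, vanish mdeg 2 (c1 i - hom F i).
Hypothesis c2F : forall i, vanish mdeg 2 (c2 i - hom F i).
Hypothesis phi1_2 : forall t, vanish mdeg 2 (phi1 t).
Hypothesis phi2_2 : forall t, vanish mdeg 2 (phi2 t).
Hypothesis E1 : fconst _ s1 * herm_vec l c1 - norm2 phi1 = q1 * r0.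
Hypothesis E2 : fconst _ s2 * herm_vec l c2 - norm2 phi2 = q2 * r0.
Hypothesis fl_q1 : fl q1 = fconst d s1.
Hypothesis fl_q2 : fl q2 = fconst d s2.

Let s1_neq0 : s1 != 0.
Proof. by apply/eqP => s0; have := s1s1; rewrite s0 mul0r => /esym/eqP; rewrite oner_eq0. Qed.
Let s2_neq0 : s2 != 0.
Proof. by apply/eqP => s0; have := s2s2; rewrite s0 mul0r => /esym/eqP; rewrite oner_eq0. Qed.

Let c0 (c : 'I_n.+2 -> fps C d) i : (forall i, vanish mdeg 2 (c i - hom F i)) ->
  c i 0%MM = (i == ord0)%:R.
Proof.
move=> cF; rewrite (eqmodE (cF i)) ?mdeg0 //.
by case: (unliftP ord0 i) => [j ->|->]; rewrite ?homS ?F0 ?hom0 ?coef1 ?eqxx.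
Qed.

(** Multiplication by ep = 1 / c1_0 turns the tangential components c1 into
    (1, Phi); Phi is then used as a coordinate system, with inverse Psi. *)
Let ep := finv (c1 ord0).
Let c1_0 : c1 ord0 0%MM != 0. Proof. by rewrite c0 // eqxx oner_eq0. Qed.
Let epV : c1 ord0 * ep = 1. Proof. exact: fmulV. Qed.
Let ep0 : ep 0%MM != 0.
Proof.
apply/eqP => e0; have := congr1 (fun f : fps C d => f 0%MM) epV.
by rewrite /= coef0M e0 mulr0 coef1 eqxx => /esym/eqP; rewrite oner_eq0.
Qed.

Definition affine_chart : fmap C d d := fun i => finv (c1 ord0) * c1 (lift ord0 i).
Let Phi := affine_chart.

Let ep1 : vanish mdeg 2 (ep - 1).
Proof.
have -> : ep - 1 = - ep * (c1 ord0 - 1) by rewrite mulrBr mulNr mulrC epV; ring.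
apply: vanishMl; first exact: mdeg_morph.
by have := c1F ord0; rewrite hom0.
Qed.

Lemma affine_chart0 i : Phi i 0%MM = 0.
Proof. by rewrite /Phi /affine_chart -/ep coef0M c0 // mulr0. Qed.

Lemma affine_chart_unit : fmap_jacobian Phi \in unitmx.
Proof.
suff -> : fmap_jacobian Phi = fmap_jacobian F by [].
apply/matrixP => i j; rewrite !mxE; apply: (@eqmodE _ _ 2); last by rewrite mdeg1.
rewrite /eqmod /Phi /affine_chart -/ep; have -> : ep * c1 (lift ord0 i) - F i =
    c1 (lift ord0 i) * (ep - 1) + (c1 (lift ord0 i) - hom F (lift ord0 i)).
  by rewrite homS; ring.
apply: vanishD; last exact: c1F.
by apply: vanishMl => //; apply: mdeg_morph.
Qed.

Variable Psi : fmap C d d.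
Hypothesis Psi0 : forall i, Psi i 0%MM = 0.
Hypothesis PsiPhi : forall i, fsub Psi (Phi i) = fvar C i.
Hypothesis PhiPsi : forall i, fsub Phi (Psi i) = fvar C i.

(** Homogeneous vectors, normalized by c1_0 and expressed in the coordinates
    Phi: the vector c1 becomes (1, z, w). *)
Let tau (f : fps C d) : fps C d := fsub Psi (ep * f).

Let tau_inj : injective tau.
Proof.
move=> f g /(congr1 (fsub Phi)); rewrite /tau !fsub_comp !fsub_id.
- exact: fmul_unitI.
- by move=> i; rewrite PhiPsi fcenter_fvar.
- by move=> i; rewrite PhiPsi fcenter_fvar.
Qed.

Let tauB f g : tau (f - g) = tau f - tau g.
Proof. by rewrite /tau mulrBr rmorphB. Qed.

Let tau_vanish k f : vanish mdeg k f -> vanish mdeg k (tau f).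
Proof. by move=> fk; apply: fsub_vanish; apply: vanishMl => //; apply: mdeg_morph. Qed.

Let tau_c1_0 : tau (c1 ord0) = 1.
Proof. by rewrite /tau mulrC epV rmorph1. Qed.
Let tau_c1_S i : tau (c1 (lift ord0 i)) = fvar C i.
Proof. exact: PsiPhi. Qed.

Let c21 i : vanish mdeg 2 (tau (c2 i) - tau (c1 i)).
Proof.
rewrite -tauB; apply: tau_vanish.
have -> : c2 i - c1 i = (c2 i - hom F i) - (c1 i - hom F i) by ring.
exact: vanishB.
Qed.

Let fl_herm (c : 'I_n.+2 -> fps C d) k (p : 'I_k -> fps C d) s :
    (forall i, vanish mdeg 2 (c i - hom F i)) -> (forall t, vanish mdeg 2 (p t)) ->
  fl (fconst _ s * herm_vec l c - norm2 p) = fconst d (s * (2 * 'i)^-1) * c (hw n).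
Proof.
move=> cF p2; apply: fpsP => x; rewrite /fl kerB ker_constM ker_norm2 coef_constM -mulrA.
rewrite [X in _ - X]big1 ?subr0 => [|t _]; last first.
  by rewrite [p t 0%MM]p2 ?mdeg0 // rmorph0 mulr0.
rewrite /herm_vec ker_herm_form; congr (_ * _).
rewrite [c (h0 n) 0%MM]c0 // [c (hw n) 0%MM]c0 // eqxx rmorph1 mulr1 rmorph0 mulr0 subr0.
rewrite big1 ?subr0 // => j _; rewrite [c (hz j) 0%MM]c0 //.
by rewrite rmorph0 !mulr0.
Qed.

(** Where \bar Z = 0, both equations are the w-component times a constant, and
    both are the same multiple of r0 up to sign. *)
Let c_w : c2 (hw n) = c1 (hw n).
Proof.
have I2 : (2 * 'i : C)^-1 != 0 by rewrite invr_eq0 mulf_neq0 ?neq0Ci ?pnatr_eq0.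
have f1 := congr1 (@fl C d) E1; have f2 := congr1 (@fl C d) E2.
rewrite fl_herm // flM fl_q1 in f1; rewrite fl_herm // flM fl_q2 in f2.
have cn s (f g : fps C d) : s != 0 -> fconst d (s * (2 * 'i)^-1) * f = fconst d s * g ->
    f = fconst d (2 * 'i) * g.
  move=> s0 fg; apply: fpsP => x.
  have e : s * ((2 * 'i)^-1 * f x) = s * g x by rewrite mulrA -!coef_constM fg.
  rewrite coef_constM -(mulfI s0 e) mulVKf //.
  by rewrite mulf_neq0 ?neq0Ci ?pnatr_eq0.
by rewrite (cn _ _ _ s1_neq0 f1) (cn _ _ _ s2_neq0 f2).
Qed.

(** The ratio of the two equations. *)
Let a := fconst _ s2 * q2 * finv (fconst _ s1 * q1).

Let q10 : (fconst _ s1 * q1) 0%MM != 0.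
Proof.
rewrite coef_constM -mjoin00 -[q1 _]/(fl q1 0%MM) fl_q1 coef_fconst eqxx.
by rewrite mulr1n s1s1 oner_eq0.
Qed.

Let signed_equation s k (c : 'I_n.+2 -> fps C d) (p : 'I_k -> fps C d) qq : s * s = 1 ->
    fconst _ s * herm_vec l c - norm2 p = qq * r0 ->
  herm_vec l c - fconst _ s * norm2 p = fconst _ s * qq * r0.
Proof.
move=> ss E; rewrite -mulrA -E mulrBr mulrA -rmorphM ss rmorph1 mul1r.
by [].
Qed.

Let equation_ratio : herm_vec l c2 - fconst _ s2 * norm2 phi2 =
  a * (herm_vec l c1 - fconst _ s1 * norm2 phi1).
Proof.
rewrite (signed_equation s2s2 E2) (signed_equation s1s1 E1) /a -[RHS]mulrA; congr (_ * _).
by rewrite mulrA [finv _ * _]mulrC fmulV // mul1r.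
Qed.

Let pull2M (f g : fps C (d + d)) : pull2 Psi (f * g) = pull2 Psi f * pull2 Psi g.
Proof. exact: rmorphM. Qed.

Let tau_form s k (c : 'I_n.+2 -> fps C d) (p : 'I_k -> fps C d) :
  pull2 Psi (lft ep * rgt (fconj ep) * (herm_vec l c - fconst _ s * norm2 p)) =
  herm_vec l (fun i => tau (c i)) - fconst _ s * norm2 (fun t => tau (p t)).
Proof.
rewrite mulrBr -herm_vecM mulrCA -norm2M rmorphB /= pull2_constM.
by rewrite pull2_herm_vec pull2_norm2.
Qed.

Let tau_equation_ratio (f : fps C (d + d)) :
  herm_vec l c2 - fconst _ s2 * norm2 phi2 =
    f * (herm_vec l c1 - fconst _ s1 * norm2 phi1) ->
  herm_form l (tau (c2 ord0)) (fun j => tau (c2 (hz j))) (tau (c2 (hw n)))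
    - fconst _ s2 * norm2 (fun t => tau (phi2 t)) =
  pull2 Psi f * (herm_form l 1 (fun j => fvar C (zi j)) (fvar C (wi n))
    - fconst _ s1 * norm2 (fun t => tau (phi1 t))).
Proof.
move=> rel.
have T2 : herm_vec l (fun i => tau (c2 i)) - fconst _ s2 * norm2 (fun t => tau (phi2 t)) =
    pull2 Psi (lft ep * rgt (fconj ep) *
      (f * (herm_vec l c1 - fconst _ s1 * norm2 phi1))).
  by rewrite -rel; apply: esym (tau_form s2 c2 phi2).
have T1 : herm_vec l (fun i => tau (c1 i)) =
    herm_form l 1 (fun j => fvar C (zi j)) (fvar C (wi n)).
  have z1 : (fun j => tau (c1 (hz j))) = (fun j => fvar C (zi j)).
    by apply/funext => j; apply: (tau_c1_S (zi j)).
  exact: (f_equal3 (@herm_form C n l d) tau_c1_0 z1 (tau_c1_S (wi n))).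
apply: (etrans T2); rewrite -T1 -(tau_form s1 c1 phi1) -pull2M.
by congr (pull2 Psi _); apply: mulrCA.
Qed.

Let rigidity_in_chart : (forall i, tau (c2 i) = tau (c1 i)) /\
  forall x y, s2 * (\sum_t tau (phi2 t) x * (tau (phi2 t) y)^*) =
              s1 * \sum_t tau (phi1 t) x * (tau (phi1 t) y)^*.
Proof.
have [|||||e1 fz nn] := rigidity _ _ _ _ _ (tau_equation_ratio equation_ratio) k_lt.
- by have := c21 ord0; rewrite tau_c1_0.
- by move=> j; have := c21 (hz j); rewrite tau_c1_S.
- by rewrite c_w tau_c1_S.
- by move=> t; apply/tau_vanish/phi1_2.
- by move=> t; apply/tau_vanish/phi2_2.
split=> // i; case: (unliftP ord0 i) => [i' ->|->]; last by rewrite e1 tau_c1_0.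
case: (unliftP ord_max i') => [j ->|->]; last by rewrite -[lift _ _]/(hw n) c_w.
by rewrite -[lift _ _]/(hz j) fz tau_c1_S.
Qed.

(** After multiplication by units and in the chart Phi, the two equations satisfy
    the assumptions of the rigidity lemma. *)
Lemma comparison_tangential i : c2 i = c1 i.
Proof. by apply: tau_inj; apply: rigidity_in_chart.1. Qed.

Let tau_norm2 k (p : 'I_k -> fps C d) :
  norm2 (fun t => tau (p t)) = pull2 Psi (lft ep * rgt (fconj ep) * norm2 p).
Proof. by rewrite -norm2M pull2_norm2. Qed.

(** If the signs agree, the two families of normal components have the same sum
    of squares, that is, their Taylor coefficients have the same Gram matrix.
    The family phi stands for phi1 padded to k2 components. *)
Lemma comparison_unitary (phi : 'I_k2 -> fps C d) : s1 = s2 ->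
    norm2 phi = norm2 phi1 ->
  exists2 U : 'M[C]_k2, U *m U^t* = 1%:M & forall t, phi2 t = linmul phi U t.
Proof.
move=> s12 pp; have nn := rigidity_in_chart.2.
have gram k (p : 'I_k -> fps C d) x y :
    cvec p x *m (cvec p y)^t* = (ker (norm2 p) x y)%:M.
  apply/matrixP => i j; rewrite !ord1 !mxE eqxx ker_norm2; apply: eq_bigr => t _.
  by rewrite !mxE.
have [x y|U UU UE] := @unitary_extension C 'X_{1..d} k2
    (fun x => cvec (fun t => tau (phi t)) x) (fun x => cvec (fun t => tau (phi2 t)) x).
  rewrite !gram tau_norm2 pp -tau_norm2; congr (_%:M).
  apply: (mulfI s2_neq0); rewrite !ker_norm2 nn -s12.
  by [].
exists U => // t; apply: tau_inj.
have -> : tau (linmul phi U t) = linmul (fun t => tau (phi t)) U t.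
  rewrite /tau /linmul mulr_sumr rmorph_sum; apply: eq_bigr => j _.
  by rewrite mulrCA rmorphM /= fsub_const.
by move: t; apply: cvec_inj => x; rewrite cvec_linmul UE.
Qed.

(** If the signs are opposite, minus a sum of squares equals a sum of squares, so
    both vanish. *)
Lemma comparison_flat : s1 = - s2 -> forall t, phi1 t = 0.
Proof.
move=> s12 t; apply: tau_inj; rewrite [in RHS]/tau mulr0 rmorph0.
apply: fpsP => x; have := rigidity_in_chart.2 x x.
rewrite s12 mulNr -mulrN => /(mulfI s2_neq0) /eqP; rewrite eq_sym eqr_oppLR => /eqP nn.
have p0 k (p : 'I_k -> fps C d) : 0 <= \sum_t p t x * (p t x)^*.
  by apply: sumr_ge0 => i _; apply: mul_conjC_ge0.
have s0 : \sum_t tau (phi1 t) x * (tau (phi1 t) x)^* = 0.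
  apply/eqP; rewrite eq_le [X in _ && X](p0 _ (fun t => tau (phi1 t))) andbT nn oppr_le0.
  exact: (p0 _ (fun t => tau (phi2 t))).
have := s0 => /psumr_eq0P p1; have /eqP := p1 (fun i _ => mul_conjC_ge0 _) t isT.
by rewrite mul_conjC_eq0 => /eqP.
Qed.

End Comparison.

Section Flat.
Variables (C : numClosedFieldType) (n l : nat) (M : hypersurface C n.+1).
Local Notation d := n.+1.

(** Phi and Psi are inverse to each other at the origin; the constant terms of the
    formal equivalence and its inverse account for the base point of M. *)
Lemma flat_of_chart (Phi Psi : fmap C d d) (q : fps C (d + d)) :
    (forall i, Phi i 0%MM = 0) -> (forall i, Psi i 0%MM = 0) ->
    (forall i, fsub Psi (Phi i) = fvar C i) ->
    (forall i, fsub Phi (Psi i) = fvar C i) ->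
    herm_vec l (hom Phi) = q * hs_rho M ->
  formal_equivalence M (hyperquadric C n l) Phi.
Proof.
move=> Phi0 Psi0 PP PP' E; split.
  split; first by apply/colP => i; rewrite !mxE Phi0.
  by exists q; rewrite hyperquadric_pull.
pose p := hs_pt M.
have idE (p' : 'cV[C]_d) i : fmap_id p' i = fconst d (p' i 0) + fvar C i.
  by rewrite /fmap_id rmorphD.
exists (fun i => fconst d (p i 0) + Psi i); split.
- apply/colP => i; rewrite mxE coefD coef_fconst eqxx Psi0 addr0.
  by rewrite mulr1n.
- apply/funext => i; rewrite idE /fmap_comp -[fcomp _ _]/(fsub Phi _).
  by rewrite rmorphD /= fsub_const PP'.
- apply/funext => i; rewrite idE mxE rmorph0 add0r -PP -[LHS]/(fsub _ (Phi i)).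
  apply: eq_fsub => j; rewrite !fcenterE !coefD coef_fconst eqxx Psi0.
  by rewrite rmorph0 addr0 subr0 mulr1n addrAC subrr add0r.
Qed.

End Flat.

Section MainProof.
Variable C : numClosedFieldType.
Local Open Scope sesquilinear_scope.
Hypothesis arch : forall b e : C, 0 <= b -> 0 < e -> exists k, b / 2 ^+ k < e.
Variables (n l k1 k2 : nat) (M : hypersurface C n.+1).
Local Notation d := n.+1.

Lemma block_unitary k s (U : 'M[C]_k) : U *m U^t* = 1%:M ->
  block_mx 1%:M 0 0 U *m block_mx (s *: form_mx C n l) 0 0 (- 1%:M) *m
    (block_mx 1%:M 0 0 U)^t* = block_mx (s *: form_mx C n l) 0 0 (- 1%:M)
    :> 'M_(n.+2 + k).
Proof.
move=> UU; rewrite tr_block_mx map_block_mx !mulmx_block !trmx0 !map_mx0 trmx1 map_mx1.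
rewrite !(mulmx0, mul0mx, addr0, add0r) mul1mx mulmx1.
by rewrite mulmxN mulmx1 mulNmx UU.
Qed.

(** The Taylor coefficients of u (1, G) are mapped to those of v (1, H) by the
    matrix T that undoes B, applies U to the normal components and applies B'.
    It preserves the form, and fixes the line of (1, 0), being the value of both
    vectors at 0; so H = T(G) in affine coordinates. *)
Lemma automorphism_of_components k s (G H : fmap C d (n + k).+1) (u v : fps C d)
    (B B' : 'M[C]_(n.+2 + k, (n + k).+2)) (U : 'M[C]_k)
    (c : 'I_n.+2 -> fps C d) (phi phi' : 'I_k -> fps C d) :
    (forall i, G i 0%MM = 0) -> (forall i, H i 0%MM = 0) ->
    u 0%MM != 0 -> v 0%MM != 0 ->
    (B : 'M_((n + k).+2)) \in unitmx -> (B' : 'M_((n + k).+2)) \in unitmx ->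
    B *m form_mx C (n + k) l *m B^t* = block_mx (s *: form_mx C n l) 0 0 (- 1%:M) ->
    B' *m form_mx C (n + k) l *m B'^t* = block_mx (s *: form_mx C n l) 0 0 (- 1%:M) ->
    (forall i, u * hom G i = linmul (vjoin c phi) B i) ->
    (forall i, v * hom H i = linmul (vjoin c phi') B' i) ->
    U *m U^t* = 1%:M -> (forall t, phi' t = linmul phi U t) ->
  exists T : fmap C (n + k).+1 (n + k).+1, hyperquadric_aut l T /\ H = fmap_comp T G.
Proof.
move=> G0 H0 u0 v0 Bu B'u BJ B'J GE HE UU pU.
pose D : 'M[C]_((n + k).+2) := block_mx 1%:M 0 0 U : 'M_(n.+2 + k).
have Du : D \in unitmx.
  have [U1 _] := mulmx1_unit UU.
  rewrite unitmxE /D (@det_lblock _ n.+2 k) det1 mul1r -unitmxE.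
  exact: U1.
have DJ := block_unitary s UU; rewrite -/D in DJ.
pose b : 'M[C]_((n + k).+2) := B; pose b' : 'M[C]_((n + k).+2) := B'.
pose J := form_mx C (n + k) l.
pose Q : 'M[C]_((n + k).+2) := block_mx (s *: form_mx C n l) 0 0 (- 1%:M) : 'M_(n.+2 + k).
have bJ : b *m J *m b^t* = Q by exact: BJ.
have b'J : b' *m J *m b'^t* = Q by exact: B'J.
have DQ : D *m Q *m D^t* = Q by exact: DJ.
pose T := invmx b *m D *m b'.
have Tu : T \in unitmx by rewrite !unitmx_mul unitmx_inv Bu Du B'u.
have ibQ : invmx b *m Q *m (invmx b)^t* = J.
  rewrite -bJ !mulmxA mulVmx // mul1mx -mulmxA -adj_mul mulVmx // adj1 mulmx1.
  by [].
have TJ : T *m J *m T^t* = J.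
  rewrite -[RHS]ibQ -[in RHS]DQ -b'J /T !adj_mul !mulmxA.
  by [].
have cT x : cvec (fun i => v * hom H i) x = cvec (fun i => u * hom G i) x *m T.
  have -> : cvec (fun i => v * hom H i) x = cvec (linmul (vjoin c phi') B') x.
    by congr cvec; apply/funext => i; rewrite HE.
  have -> : cvec (fun i => u * hom G i) x = cvec (linmul (vjoin c phi) B) x.
    by congr cvec; apply/funext => i; rewrite GE.
  pose y : 'rV[C]_((n + k).+2) := cvec (vjoin c phi) x.
  have -> : cvec (linmul (vjoin c phi) B) x = y *m b by exact: cvec_linmul.
  have yD : cvec (vjoin c phi') x = y *m D.
    rewrite /y !cvec_vjoin /D (@mul_row_block C 1 n.+2 k n.+2 k).
    rewrite !mulmx0 mulmx1 addr0 add0r; congr row_mx.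
    by rewrite -cvec_linmul; congr cvec; apply/funext => t; apply: pU.
  have -> : cvec (linmul (vjoin c phi') B') x = y *m D *m b'.
    by rewrite -yD; exact: cvec_linmul.
  by rewrite /T !mulmxA mulmxK.
have c0 (w : fps C d) (K : fmap C d (n + k).+1) : (forall i, K i 0%MM = 0) ->
    cvec (fun i => w * hom K i) 0%MM = w 0%MM *: delta_mx 0 ord0.
  move=> K0; apply/rowP => i; rewrite !mxE coef0M.
  by case: (unliftP ord0 i) => [j ->|->]; rewrite ?homS ?K0 ?hom0 ?coef1 ?eqxx ?mulr0 ?mulr1.
have T0 : fixes0 T.
  move=> i; have := cT 0%MM; rewrite !c0 // -scalemxAl -rowE.
  move=> /rowP /(_ (lift ord0 i)); rewrite !mxE /= mulr0 => /esym/eqP.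
  by rewrite mulf_eq0 (negbTE u0) => /eqP.
exists (frac_taylor T); split; first exact: frac_map_aut.
have lT i : u * linmul (hom G) T i = v * hom H i.
  have -> : u * linmul (hom G) T i = linmul (fun i => u * hom G i) T i.
    by rewrite /linmul mulr_sumr; apply: eq_bigr => j _; rewrite mulrCA.
  move: i; apply: cvec_inj => x; rewrite cvec_linmul -cT.
  by [].
apply/funext => j; apply: (fmul_unitI v0).
have := fsub_frac_taylor j G0 Tu T0; rewrite -[fsub G _]/(fmap_comp (frac_taylor T) G j).
move/(congr1 (fun f => u * f)); rewrite /= mulrA !lT hom0 mulr1 homS => <-.
by [].
Qed.

Hypothesis l_le : (l.*2 <= n)%N.
Hypothesis M_sign : levi_nondegenerate_of_signature l M.
Hypothesis M_not_flat : l.*2 = n ->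
  ~ exists F : fmap C d d, formal_equivalence M (hyperquadric C n l) F.
Hypothesis k12 : (k1 <= k2)%N.
Hypothesis k_lt : (k1 + k2 < n)%N.
Variables (H1 : fmap C d (n + k1).+1) (H2 : fmap C d (n + k2).+1).
Hypothesis H1_emb : formal_embedding M (hyperquadric C (n + k1) l) H1.
Hypothesis H2_emb : formal_embedding M (hyperquadric C (n + k2) l) H2.

(** The first map is used twice: itself, with k1 normal components, for the
    comparison (where the number k1 + k2 matters), and composed with the linear
    embedding, with k2 normal components, for the automorphism.  The tangential
    components of both are the same, hence so is the sum of squares of the
    normal components. *)
Theorem embeddings_differ_by_automorphism :
  exists T : fmap C (n + k2).+1 (n + k2).+1, hyperquadric_aut l T /\
    H2 = fmap_comp T (fmap_comp (linear_embedding C (n + k1) (n + k2)) H1).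
Proof.
have n_gt0 : (0 < n)%N by move: k_lt; clear; lia.
have mm : (n + k1 <= n + k2)%N by rewrite leq_add2l.
have [F [r0 [q [F0 F_unit r0F r0E q0]]]] := source_equation M_sign.
have [H1_0 H1_inj [b1 H1E]] := embedding_equation r0E q0 H1_emb.
have [H2_0 H2_inj [b2 H2E]] := embedding_equation r0E q0 H2_emb.
pose G := fmap_comp (linear_embedding C (n + k1) (n + k2)) H1.
have G0 : forall i, G i 0%MM = 0 := linear_embedding0 H1_0.
have G_inj := linear_embedding_inj mm H1_0 H1_inj.
have GE : herm_vec l (hom G) = b1 * r0 by rewrite herm_linear_embedding.
have [half1 u1 fl1 [B1 [c1 [phi1 [[B1u B1J] H1c c1F phi1_2 E1]]]]] :=
  normal_position n_gt0 l_le F0 F_unit r0F H1_0 H1_inj H1E.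
have [half2 u2 fl2 [B2 [c2 [phi2 [[B2u B2J] H2c c2F phi2_2 E2]]]]] :=
  normal_position n_gt0 l_le F0 F_unit r0F H2_0 H2_inj H2E.
have [_ _ _ [B [c [phi [[Bu BJ] Gc cF phi_2 E]]]]] :=
  normal_position n_gt0 l_le F0 F_unit r0F G0 G_inj GE.
have ss (x : C) : csgn x * csgn x = 1.
  by case: (csgn_pm x) => ->; rewrite ?mulrNN mulr1.
have sn (x : C) : csgn x != 0.
  by case: (csgn_pm x) => ->; rewrite ?oppr_eq0 oner_eq0.
have [Psi [Psi0 PsiPhi PhiPsi]] :=
  inverse_map (affine_chart0 F0 c1F) (affine_chart_unit F0 F_unit c1F).
have tang := comparison_tangential k_lt F0 (ss _) (ss _) c1F c2F phi1_2 phi2_2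
  E1 E2 fl1 fl2 PsiPhi PhiPsi.
have cc1 : c = c1.
  by apply/funext;
    apply: (tangential_part F0 F_unit (sn (b1 0%MM)) cF c1F phi_2 phi1_2 (etrans E (esym E1))).
have c21 : c2 = c1 by apply/funext.
case: (eqVneq (csgn (b1 0%MM)) (csgn (b2 0%MM))) => [s12|s12].
  have pp : norm2 phi = norm2 phi1.
    by apply: oppr_inj; apply: (addrI (fconst _ (csgn (b1 0%MM)) * herm_vec l c1));
      rewrite E1 -E cc1.
  have [U UU UE] := comparison_unitary k_lt F0 (ss _) (ss _) c1F c2F phi1_2 phi2_2
    E1 E2 fl1 fl2 PsiPhi PhiPsi s12 pp.
  rewrite c21 in H2c; rewrite cc1 in Gc; rewrite -s12 in B2J.
  exact: (automorphism_of_components G0 H2_0 u1 u2 Bu B2u BJ B2J Gc H2c UU UE).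
have s12' : csgn (b1 0%MM) = - csgn (b2 0%MM).
  move: s12; case: (csgn_pm (b1 0%MM)) => ->; case: (csgn_pm (b2 0%MM)) => ->.
  - by rewrite eqxx.
  - by rewrite opprK.
  - by [].
  - by rewrite eqxx.
(* One of the signs is -1. *)
have half : l.*2 = n.
  by case: (csgn_pm (b1 0%MM)) => s1; [apply: half2; rewrite -[LHS]opprK -s12' s1|apply: half1].
have phi0 := comparison_flat k_lt F0 (ss _) (ss _) c1F c2F phi1_2 phi2_2
  E1 E2 fl1 fl2 PsiPhi PhiPsi s12'.
case: (M_not_flat half); exists (affine_chart c1).
pose ep := finv (c1 ord0).
have e1 : c1 ord0 * ep = 1.
  by apply: fmulV; rewrite (eqmodE (c1F ord0)) ?mdeg0 // hom0 coef1 eqxx oner_eq0.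
have n0 : norm2 phi1 = 0.
  by rewrite /norm2 big1 // => t _; rewrite phi0 rmorph0 mul0r.
apply: (flat_of_chart (q := lft ep * rgt (fconj ep) *
  (fconst _ (csgn (b1 0%MM)) * normal_factor b1 * q)) _ Psi0 PsiPhi PhiPsi).
  exact: (affine_chart0 F0 c1F).
have hE : hom (affine_chart c1) = fun i => ep * c1 i.
  apply/funext => i; case: (unliftP ord0 i) => [j ->|->]; first by rewrite homS.
  by rewrite hom0 mulrC e1.
have h1 : fconst _ (csgn (b1 0%MM)) * herm_vec l c1 = normal_factor b1 * r0.
  by rewrite -E1 n0 subr0.
have h2 : herm_vec l c1 = fconst _ (csgn (b1 0%MM)) * normal_factor b1 * r0.
  by rewrite -[RHS]mulrA -h1 mulrA -rmorphM ss rmorph1 mul1r.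
by rewrite hE herm_vecM h2 r0E !mulrA.
Qed.

End MainProof.

(** * Complex numbers over the reals *)

(** The archimedean property of the reals. *)
Lemma complex_dyadic (R : realType) (b e : R[i]) : 0 <= b -> 0 < e ->
  exists k, b / 2 ^+ k < e.
Proof.
move=> b0 e0; have [bE eE] : b = (complex.Re b)%:C%C /\ e = (complex.Re e)%:C%C.
  by split; apply/esym/RRe_real; [apply: ger0_real|apply: gtr0_real].
have {}e0 : 0 < complex.Re e by rewrite -ltcR -eE.
have {}b0 : 0 <= complex.Re b by rewrite -lecR -bE.
pose x := complex.Re b / complex.Re e.
have x0 : 0 <= x by rewrite divr_ge0 // ltW.
exists (Num.bound x).
rewrite ltr_pdivrMr ?exprn_gt0 ?ltr0n // bE eE.
have -> : (2 : R[i]) = (2%:R : R)%:C%C by rewrite rmorph_nat.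
rewrite -rmorphXn -rmorphM ltcR mulrC -ltr_pdivrMr //.
apply: (lt_le_trans (archi_boundP x0)); rewrite -natrX ler_nat ltnW //.
exact: ltn_expl.
Qed.

Local Close Scope ring_scope.
Theorem theorem1p6 (R : realType) (n l : nat) (M : hypersurface R[i] n.+1)
    (l_le : (l.*2 <= n)%N)
    (M_sign : levi_nondegenerate_of_signature l M)
    (M_not_flat : l.*2 = n ->
       ~ exists F : fmap R[i] n.+1 n.+1,
           formal_equivalence M (hyperquadric R[i] n l) F)
    (k1 k2 : nat) (k12 : (k1 <= k2)%N)
    (H1 : fmap R[i] n.+1 (n + k1).+1) (H2 : fmap R[i] n.+1 (n + k2).+1)
    (H1_emb : formal_embedding M (hyperquadric R[i] (n + k1) l) H1)
    (H2_emb : formal_embedding M (hyperquadric R[i] (n + k2) l) H2)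
    (k_lt : (k1 + k2 < n)%N) :
  exists T : fmap R[i] (n + k2).+1 (n + k2).+1,
    hyperquadric_aut l T /\
    H2 = fmap_comp T
           (fmap_comp (linear_embedding R[i] (n + k1) (n + k2)) H1).
Proof.
exact: (embeddings_differ_by_automorphism (@complex_dyadic R) l_le M_sign
  M_not_flat k12 k_lt H1_emb H2_emb).
Qed.
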